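(* Let $0<\alpha<1$, $0<s<1$, and let $u=u(x,t)\in C^{1,1}_{loc}(\mathbb{R}^n)\times C^1(\mathbb{R})$ be a bounded solution of $$\partial_t^\alpha u(x,t)+(-\Delta)^s u(x,t)=0\quad\text{in }\mathbb{R}^n\times\mathbb{R}.$$ Then $u$ must be constant.
   Context: The Marchaud fractional derivative of order $\alpha\in(0,1)$ in time is $$\partial_t^\alpha u(x,t)=C_\alpha\int_{-\infty}^t\frac{u(x,t)-u(x,\tau)}{(t-\tau)^{1+\alpha}}\,d\tau,\qquad C_\alpha=\frac{\alpha}{\Gamma(1-\alpha)},$$ and the fractional Laplacian of order $s\in(0,1)$ in space is $$(-\Delta)^s u(x,t)=C_{n,s}\,\mathrm{P.V.}\int_{\mathbb{R}^n}\frac{u(x,t)-u(y,t)}{|x-y|^{n+2s}}\,dy,\qquad C_{n,s}=\frac{4^s\,\Gamma\left(\frac{n+2s}{2}\right)}{\pi^{n/2}|\Gamma(-s)|},$$ with P.V. the Cauchy principal value; the equation is understood pointwise. The notation $u\in X\times Y$, with $X$ a space of functions of $x$ and $Y$ a space of functions of $t$, means $u(\cdot,t)\in X$ for each $t$ and $u(x,\cdot)\in Y$ for each $x$. *)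

(* Defs.v *)
From HB Require Import structures.
From mathcomp Require Import all_boot all_order all_algebra.
From mathcomp Require Import all_classical all_reals all_analysis.

Set Implicit Arguments.
Unset Strict Implicit.
Unset Printing Implicit Defensive.
Import Order.TTheory GRing.Theory Num.Theory.
Import numFieldNormedType.Exports.

Local Open Scope classical_set_scope.
Local Open Scope ring_scope.

(* Lebesgue measure on R^n, with points represented as n-tuples (the type on
   which the library puts the product sigma-algebra). *)
Section lebesgue_cons.
Context {R : realType}.
Local Notation T := (measurableTypeR R).

Definition tuple_cons n (p : T * n.-tuple T) : n.+1.-tuple T :=
  [tuple of p.1 :: p.2].

Definition tuple_uncons n (y : n.+1.-tuple T) : T * n.-tuple T :=
  (thead y, [tuple of behead y]).

Lemma tuple_consK n : cancel (@tuple_cons n) (@tuple_uncons n).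
Proof. by move=> [a y]; congr pair => //; exact: val_inj. Qed.

Lemma tuple_unconsK n : cancel (@tuple_uncons n) (@tuple_cons n).
Proof. by move=> y; rewrite [RHS]tuple_eta; exact: val_inj. Qed.

Lemma measurable_tuple_cons n : measurable_fun setT (@tuple_cons n).
Proof. exact: measurable_cons. Qed.

Lemma measurable_tuple_uncons n : measurable_fun setT (@tuple_uncons n).
Proof.
apply: measurable_fun_pair; first exact: measurable_tnth.
exact: measurable_behead.
Qed.

Variables (n : nat) (m : {sigma_finite_measure set (n.-tuple T) -> \bar R}).

Definition lebesgue_cons : set (n.+1.-tuple T) -> \bar R :=
  pushforward (lebesgue_measure \x m)%E (@tuple_cons n).

Let lebesgue_cons0 : lebesgue_cons set0 = 0%E.
Proof. by rewrite /lebesgue_cons /pushforward preimage_set0 measure0. Qed.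

Let lebesgue_cons_ge0 A : (0 <= lebesgue_cons A)%E.
Proof. exact: (measure_ge0 (lebesgue_measure \x m)%E). Qed.

Let lebesgue_cons_sigma_additive : semi_sigma_additive lebesgue_cons.
Proof.
move=> F mF tF mUF; rewrite /lebesgue_cons /pushforward preimage_bigcup.
apply: (@measure_semi_sigma_additive _ _ _ (lebesgue_measure \x m)%E).
- by move=> i; rewrite -[X in measurable X]setTI; exact: measurable_tuple_cons.
- apply/trivIsetP => i j _ _ ij; rewrite -preimage_setI.
  by move/trivIsetP : tF => /(_ _ _ _ _ ij) ->//; rewrite preimage_set0.
- rewrite -preimage_bigcup -[X in measurable X]setTI.
  exact: measurable_tuple_cons.
Qed.

HB.instance Definition _ := isMeasure.Build _ _ _ lebesgue_cons
  lebesgue_cons0 lebesgue_cons_ge0 lebesgue_cons_sigma_additive.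

Let lebesgue_cons_sigma_finite : sigma_finite setT lebesgue_cons.
Proof.
have /sigma_finiteP[F [TF ndF Foo]] := sigma_finiteT (@lebesgue_measure R).
have /sigma_finiteP[G [TG ndG Goo]] := sigma_finiteT m.
exists (fun i => @tuple_uncons n @^-1` (F i `*` G i)).
  apply/esym; rewrite -subTset => y _.
  have : setT (thead y) by []; rewrite TF => -[i _ Fi].
  have : setT [tuple of behead y] by []; rewrite TG => -[j _ Gj].
  exists (maxn i j) => //; split => /=.
  - by move: (thead y) Fi; exact/subsetPset/ndF/leq_maxl.
  - by move: [tuple of behead y] Gj; exact/subsetPset/ndG/leq_maxr.
move=> i; have [mF Fi] := Foo i; have [mG Gi] := Goo i; split.
  rewrite -[X in measurable X]setTI; apply: measurable_tuple_uncons => //.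
  exact: measurableX.
rewrite /lebesgue_cons /pushforward -comp_preimage.
rewrite (_ : _ \o _ = id); last by apply/funext => p /=; rewrite tuple_consK.
by rewrite preimage_id product_measure1E// lte_mul_pinfty// ge0_fin_numE.
Qed.

HB.instance Definition _ := Measure_isSigmaFinite.Build _ _ _ lebesgue_cons
  lebesgue_cons_sigma_finite.

End lebesgue_cons.

Fixpoint lebesgue_tuple (R : realType) (n : nat) :
    {sigma_finite_measure set (n.-tuple (measurableTypeR R)) -> \bar R} :=
  match n with
  | 0 => \d_([tuple] : 0.-tuple (measurableTypeR R))
  | n'.+1 => lebesgue_cons (lebesgue_tuple R n')
  end.

Lemma lebesgue_tuple_box (R : realType) (n : nat)
    (A : 'I_n -> set (measurableTypeR R)) : (forall i, measurable (A i)) ->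
  lebesgue_tuple R n [set y | forall i, A i (tnth y i)] =
  (\prod_(i < n) lebesgue_measure (A i))%E.
Proof.
elim: n A => [|n IH] A mA.
  by rewrite big_ord0 /= diracE mem_set// => -[].
rewrite big_ord_recl -IH//=.
rewrite -product_measure1E//=; last first.
  rewrite (_ : [set _ | _] = \bigcap_(i in [set: 'I_n])
      ((@tnth n (measurableTypeR R))^~ i @^-1` A (lift ord0 i))); last first.
    by apply/seteqP; split => y /= h i => [_|]; exact: h.
  apply: fin_bigcap_measurable => // i _.
  by rewrite -[X in measurable X]setTI; exact: measurable_tnth.
rewrite /lebesgue_cons /pushforward; congr (product_measure1 _ _ _).
apply/seteqP; split=> -[a y] /=.
  move=> h; split; first exact: h ord0.
  by move=> i; have := h (lift ord0 i); rewrite tnthS.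
move=> [h0 h] i; case: (unliftP ord0 i) => [j|] ->; last exact: h0.
by rewrite tnthS; have := h j; congr (A _ (tnth _ _)); exact: val_inj.
Qed.

Section fractional_operators.
Context {R : realType}.
Local Notation mu := (@lebesgue_measure R).

Definition rv_of_tuple n (y : n.-tuple R) : 'rV[R]_n := \row_i tnth y i.

(* The library norm on 'rV[R]_n is the sup norm. *)
Definition euclid n (x : 'rV[R]_n) : R := Num.sqrt (\sum_i x 0 i ^+ 2).

Definition Gamma_integral (x : R) : R :=
  \int[mu]_(r in `]0, +oo[) (r `^ (x - 1) * expR (- r)).

(* Euler's integral for x > 0, continued to negative non-integers by
   Gamma x = Gamma (x + k) / (x (x + 1) ... (x + k - 1)). *)
Definition Gamma (x : R) : R :=
  if 0 < x then Gamma_integral x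
  else let k := (Num.truncn (- x)).+1 in
       Gamma_integral (x + k%:R) / \prod_(i < k) (x + i%:R).

Definition marchaud_const (alpha : R) : R := alpha / Gamma (1 - alpha).

Definition marchaud n (alpha : R) (u : 'rV[R]_n -> R -> R)
    (x : 'rV[R]_n) (t : R) : R :=
  marchaud_const alpha *
  \int[mu]_(tau in `]-oo, t[) ((u x t - u x tau) / (t - tau) `^ (1 + alpha)).

Definition frac_laplacian_const (n : nat) (s : R) : R :=
  4 `^ s * Gamma ((n%:R + 2 * s) / 2) / (pi `^ (n%:R / 2) * `|Gamma (- s)|).

Definition frac_laplacian_truncated n (s : R) (u : 'rV[R]_n -> R -> R)
    (x : 'rV[R]_n) (t : R) (eps : R) : R :=
  \int[lebesgue_tuple R n]_(y in [set y | eps <= euclid (x - rv_of_tuple y)])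
    ((u x t - u (rv_of_tuple y) t)
     / euclid (x - rv_of_tuple y) `^ (n%:R + 2 * s)).

(* For u bounded and C^{1,1}_loc in space the truncated integrals are absolutely
   convergent and the limit exists, so no default value is involved. *)
Definition frac_laplacian n (s : R) (u : 'rV[R]_n -> R -> R)
    (x : 'rV[R]_n) (t : R) : R :=
  frac_laplacian_const n s *
  lim (frac_laplacian_truncated s u x t eps @[eps --> 0^'+]).

Definition gradient n (v : 'rV[R]_n -> R) (x : 'rV[R]_n) : 'rV[R]_n :=
  \row_i 'D_(delta_mx 0 i) v x.

Definition C11_loc n (v : 'rV[R]_n -> R) : Prop :=
  (forall x, differentiable v x) /\
  (forall K : set 'rV[R]_n, compact K -> [lipschitz gradient v x | x in K]).

Definition C1 (g : R -> R) : Prop :=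
  (forall t, derivable g t 1) /\ continuous (derive1 g).

End fractional_operators.

(* Main.v *)
Require Import Defs.
From HB Require Import structures.
From mathcomp Require Import all_boot all_order all_algebra.
From mathcomp Require Import all_classical all_reals all_analysis.
From mathcomp Require Import measurable_realfun.
From mathcomp Require Import ring lra.

(** The change of variables [tau = t - r], [y = x +- z] turns the equation into
    [c1 * int (u(x,t) - u(x,t-r)) r^(-1-alpha) dr
     + c2 * int (2 u(x,t) - u(x+z,t) - u(x-z,t)) |z|^(-n-2s) dz = 0].
    Where a solution is touched from above by a bump of height [a] living in the
    parabolic box of order [l] (space length [l^(1/2s)], time length [l^(1/alpha)]),
    the negative part of both integrals is [O(a / l)], hence so is the positive part.

    Let [w(x,t) = u(x+h,t) - u(x,t)], again a solution, exceed [e] somewhere. A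
    penalised maximum yields a contact point [(x1,t1)] of [w] with such a bump and with
    [w(x1,t1) > e]. The sum of the second differences of [w] at [x1] over the translates
    [z + h, z + 2h, ..., z + Nh] telescopes in [u], so it is at least [2Ne - 4M], and the
    integral is at least of order [e / |h|^(2s)]. This forces [l <= C |h|^(2s)]. The same
    holds for time increments, and letting [l] tend to infinity proves that [u] is constant.

    The maximum exists only if [u] is jointly continuous, and the hypotheses are separate
    in [x] and [t]. Suppose that [u] is discontinuous at some points. By Baire's theorem,
    near one of them the discontinuities lie in a product [X * Y] such that [u(x,.)] is
    uniformly Lipschitz for [x] in [X] and [u(.,t)] is uniformly Lipschitz for [t] in [Y];
    so the restriction of [u] to the cross [X * R] u [R^n * Y] is continuous there. A
    penalised maximum off the cross, at the scale of the distance to [X], then shows that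
    [u] cannot jump above the value on the cross. *)

Set Implicit Arguments.
Unset Strict Implicit.
Unset Printing Implicit Defensive.
Import Order.TTheory GRing.Theory Num.Theory.
Import numFieldNormedType.Exports.
Local Open Scope classical_set_scope.
Local Open Scope ring_scope.

(** * Integrals of singular kernels *)

Section dyadic.
Context {R : realType}.

(** Touching is one-sided: at a contact point both differences are bounded below by minus a bump,
    and the equation makes their weighted integrals cancel, so neither can be large on a set of
    substantial kernel weight. In the second difference a bump is quadratic, integrable against
    [|z|^(-n-2s)] near 0 as [s < 1]; in time it is only linear, which suffices as [alpha < 1].

    The moduli of continuity carry a factor [kap] independent of [u] and of the order [l], and they
    ask for joint continuity only in a cylinder of order [l]; farther away [u] enters through its
    bound [M]. So they serve twice: at large [l] to conclude, and at small [l] beside the cross,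
    before joint continuity is known everywhere.

    The obstacle beside the cross is nonlocality: a small bump says nothing about [u] far away.
    Hence [touching] admits two bumps, a low one of small order [l] and one of height comparable to
    [M] and fixed order [l0]. The cost [M / l0] of the second is negligible against a gain of order
    [1 / l]. *)

Lemma expr2_powR (j : nat) (a : R) : ((2 : R) ^+ j) `^ a = (2 `^ a) ^+ j.
Proof. by rewrite -powR_mulrn// -powRrM mulrC powRrM powR_mulrn// powR_ge0. Qed.

Lemma dyadic_above (z : R) : 1 <= z -> exists j : nat, 2 ^+ j <= z < 2 ^+ j.+1.
Proof.
move=> z1.
have [j jz] : exists j : nat, z < 2 ^+ j.
  exists (Num.truncn z).+1; apply: lt_trans (truncnS_gt z) _.
  by rewrite -natrX ltr_nat; exact: ltn_expl.
pose P := [pred j : nat | z < 2 ^+ j].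
have /(_ (ex_intro _ j jz)) := @ex_minnP P.
case: ex_minnP => -[|k] /= zk mink _.
  by move: zk; rewrite expr0 ltNge z1.
exists k; rewrite zk andbT leNgt; apply/negP => /mink.
by rewrite ltnn.
Qed.

Lemma geometric_nneseries (c z : R) : 0 <= c -> 0 <= z < 1 ->
  (\sum_(0 <= j <oo) (c * z ^+ j)%:E = (c / (1 - z))%:E)%E.
Proof.
move=> c0 /andP[z0 z1].
have z_norm : `|z| < 1 by rewrite ger0_norm.
rewrite (_ : (fun n => _) = EFin \o series (geometric c z)); last first.
  by apply/funext => n /=; rewrite /series /= -sumEFin.
rewrite EFin_lim; last exact: is_cvg_geometric_series.
by congr EFin; apply/cvg_lim => //; exact: cvg_geometric_series.
Qed.

Lemma powR2_lt1 (a : R) : a < 0 -> (2 : R) `^ a < 1.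
Proof.
move=> a0; have -> : a = - (- a) by rewrite opprK.
rewrite powRN invf_lt1 ?powR_gt0//.
have := @gt0_ltr_powR R (- a); rewrite oppr_gt0 => /(_ a0 1 2).
by rewrite !nnegrE powR1; apply; lra.
Qed.

Variables (d : measure_display) (T : measurableType d).
Variables (mu : {measure set T -> \bar R}) (f : T -> R) (V N b p : R).
Hypotheses (mf : measurable_fun [set: T] f) (f0 : forall y, 0 <= f y).
Hypotheses (V0 : 0 <= V) (N0 : 0 <= N) (b0 : 0 < b) (bp : b < p).
Hypothesis growth : forall r : R, 0 < r ->
  (mu [set y | (f y < r)%R] <= (V * r `^ N)%:E)%E.

Let level r : set T := [set y | f y < r].

Let mlevel r : measurable (level r).
Proof.
rewrite (_ : level r = f @^-1` `]-oo, r[); last first.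
  by apply/seteqP; split => y /=; rewrite in_itv.
by rewrite -[X in measurable X]setTI; exact: mf.
Qed.

Let level_integral (a r : R) : 0 <= a -> 0 < r ->
  (\int[mu]_y (a * \1_(level r) y)%:E <= (a * (V * r `^ N))%:E)%E.
Proof.
move=> a0 r0.
under eq_integral do rewrite EFinM.
rewrite ge0_integralZl//; last exact/measurable_EFinP/measurable_indic/mlevel.
by rewrite integral_indic// ?setIT// EFinM lee_wpmul2l ?lee_fin// growth.
Qed.

(** Bounds of the kernel on the annuli [2^j r <= f < 2^(j+1) r] and, with the factor [2^(-jp)] due
    to the damping, [2^(-j-1) r <= f <= 2^(-j) r]. Each annulus is enclosed in a [level] set, whose
    measure [growth] controls. *)
Let A r (j : nat) : R := (2 ^+ j * r) `^ (- (N + b)).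
Let B r (j : nat) : R := (2 ^- j) `^ p * (2 ^- j.+1 * r) `^ (- (N + b)).

Let kernel_le_dyadic (r : R) y : 0 < r ->
  ((Num.min ((f y / r) `^ p) 1 / f y `^ (N + b))%:E <=
   \sum_(0 <= j <oo) ((A r j * \1_(level (2 * (2 ^+ j * r))) y)%:E +
                      (B r j * \1_(level (2 * (2 ^- j * r))) y)%:E))%E.
Proof.
move=> r0; have p0 : 0 < p by exact: lt_trans bp.
have Nb0 : 0 < N + b by rewrite ltr_wpDl.
have A0 j : 0 <= A r j by exact: powR_ge0.
have B0 j : 0 <= B r j by rewrite mulr_ge0// powR_ge0.
have term_le (j : nat) (x : R) :
    x <= A r j * \1_(level (2 * (2 ^+ j * r))) y +
         B r j * \1_(level (2 * (2 ^- j * r))) y ->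
    (x%:E <= \sum_(0 <= j <oo) ((A r j * \1_(level (2 * (2 ^+ j * r))) y)%:E +
                      (B r j * \1_(level (2 * (2 ^- j * r))) y)%:E))%E.
  move=> xj; apply: le_trans (nneseries_lim_ge j.+1 _) => //.
    rewrite big_nat_recr//= -[leLHS]add0e leeD//.
    by apply: sume_ge0 => i _; rewrite adde_ge0// lee_fin mulr_ge0.
  by move=> i _ _; rewrite adde_ge0// lee_fin mulr_ge0.
(* The kernel vanishes where [f y = 0], because [0^-1 = 0]. Elsewhere [y] lies in an annulus, and
   the single corresponding term of the series already dominates. *)
have [fy0|fy0] := eqVneq (f y) 0.
  apply: (term_le 0%N); rewrite fy0 powR0 ?gt_eqF// invr0 mulr0.
  by rewrite addr_ge0// mulr_ge0.
have fy : 0 < f y by rewrite lt_def fy0 f0.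
have [rf|fr] := leP r (f y).
- have fr1 : 1 <= f y / r by rewrite ler_pdivlMr// mul1r.
  have [k /andP[jl ju]] := dyadic_above fr1.
  move: jl ju; rewrite ler_pdivlMr// ltr_pdivrMr// => jl ju.
  apply: (term_le k); rewrite -[leLHS]addr0; apply: lerD; last by apply: mulr_ge0 => //; exact: B0.
  rewrite indicE mem_set ?mulr1; last by rewrite /level/= mulrA -exprS.
  apply: (@le_trans _ _ (1 / f y `^ (N + b))).
    by rewrite ler_wpM2r ?invr_ge0 ?powR_ge0// ge_min lexx orbT.
  rewrite mul1r /A powRN lef_pV2 ?posrE ?powR_gt0 ?mulr_gt0//.
  by rewrite ge0_ler_powR// ?nnegrE ?mulr_ge0// ltW.
- have rf1 : 1 <= r / f y by rewrite ler_pdivlMr// mul1r ltW.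
  have [k /andP[jl ju]] := dyadic_above rf1.
  have {}jl : f y <= 2 ^- k * r.
    by move: jl; rewrite ler_pdivlMr// ler_pdivlMl ?exprn_gt0.
  have {}ju : 2 ^- k.+1 * r <= f y.
    by move: ju; rewrite ltr_pdivrMr// => /ltW; rewrite ler_pdivrMl ?exprn_gt0.
  apply: (term_le k); rewrite -[leLHS]add0r; apply: lerD; first by apply: mulr_ge0 => //; exact: A0.
  rewrite indicE mem_set ?mulr1; last first.
    rewrite /level/=; apply: le_lt_trans jl _.
    by rewrite ltr_pMl ?mulr_gt0 ?invr_gt0 ?exprn_gt0// ltr1n.
  rewrite /B ler_pM ?invr_ge0 ?powR_ge0//.
  + by rewrite le_min powR_ge0 ler01.
  + have frk : f y / r <= 2 ^- k by rewrite ler_pdivrMr.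
    rewrite ge_min ge0_ler_powR ?nnegrE ?divr_ge0 ?invr_ge0 ?exprn_ge0//; exact: ltW.
  + rewrite powRN lef_pV2 ?posrE ?powR_gt0 ?mulr_gt0 ?invr_gt0 ?exprn_gt0//.
    by rewrite ge0_ler_powR// ?nnegrE ?mulr_ge0// ?invr_ge0 ?exprn_ge0// ltW.
Qed.

(** Volume growth against the kernel leaves geometric terms, of ratio [2^(-b)] outwards and, in
    [B_sum], [2^(b-p)] inwards; both ratios are below 1 since [0 < b < p]. *)
Let A_sum (r : R) j : 0 < r ->
  A r j * (V * (2 * (2 ^+ j * r)) `^ N) =
  V * 2 `^ N * r `^ (- b) * (2 `^ (- b)) ^+ j.
Proof.
move=> r0; rewrite /A; have w0 : 0 < 2 ^+ j * r by rewrite mulr_gt0 ?exprn_gt0.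
rewrite [(2 * _) `^ N]powRM ?(ltW w0)//.
have E : (2 ^+ j * r) `^ (- b) = r `^ (- b) * (2 `^ (- b)) ^+ j.
  by rewrite powRM ?exprn_ge0 ?(ltW r0)// expr2_powR mulrC.
have F : (2 ^+ j * r) `^ (- b) = (2 ^+ j * r) `^ (- (N + b)) * (2 ^+ j * r) `^ N.
  rewrite -powRD; last by apply/implyP => _; rewrite gt_eqF.
  by congr powR; ring.
rewrite -[RHS]mulrA -E F; ring.
Qed.

Let B_sum (r : R) j : 0 < r ->
  B r j * (V * (2 * (2 ^- j * r)) `^ N) =
  V * 2 `^ N * 2 `^ (N + b) * r `^ (- b) * (2 `^ (b - p)) ^+ j.
Proof.
move=> r0; have p0 : 0 < p by exact: lt_trans bp.
have i0 : 0 < (2 : R) ^- j by rewrite invr_gt0 exprn_gt0.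
have E : (2 ^- j : R) `^ (p - b) = (2 `^ (b - p)) ^+ j.
  rewrite -(opprB p b) powRN exprVn -expr2_powR.
  by apply: (@mulIf _ ((2 ^+ j) `^ (p - b))); rewrite ?gt_eqF ?powR_gt0 ?exprn_gt0//
    mulVf ?gt_eqF ?powR_gt0 ?exprn_gt0// -powRM ?ltW// ?exprn_gt0//
    mulVf ?powR1// gt_eqF ?exprn_gt0.
have E1 : (2 ^- j : R) `^ (p - b) = (2 ^- j) `^ p * (2 ^- j) `^ (- (N + b)) * (2 ^- j) `^ N.
  rewrite -!powRD; first by congr powR; ring.
  - by apply/implyP => _; rewrite gt_eqF.
  - by apply/implyP => _; rewrite gt_eqF.
have E2 : r `^ (- b) = r `^ (- (N + b)) * r `^ N.
  rewrite -powRD; first by congr powR; ring.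
  by apply/implyP => _; rewrite gt_eqF.
have E3 : (2 ^- j.+1 * r) `^ (- (N + b)) =
    2 `^ (N + b) * ((2 ^- j) `^ (- (N + b)) * r `^ (- (N + b))).
  rewrite exprS invfM powRM ?mulr_ge0 ?invr_ge0 ?exprn_ge0 ?ltW//.
  rewrite powRM ?invr_ge0 ?exprn_ge0//.
  rewrite -[in 2 `^ (N + b)](invrK 2) -powR_inv1 ?invr_ge0// -powRrM mulN1r.
  by rewrite mulrA.
rewrite -E E1 E2 /B E3 powRM ?mulr_ge0 ?ltW// powRM ?ltW//; ring.
Qed.

(** The power [r^(-b)] becomes [1 / l] for [r = rs l], [b = 2 * s] and for [r = rt l], [b = alpha].
    The damping exponent [p] is 2 in space and 1 in time; [b = 1], [p = x + 1] serves the Gamma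
    integrand. *)
Lemma kernel_integral_le : exists2 C : R, 0 <= C & forall r : R, 0 < r ->
  (\int[mu]_y (Num.min ((f y / r) `^ p) 1 / f y `^ (N + b))%:E <=
   (C * r `^ (- b))%:E)%E.
Proof.
pose q1 := 2 `^ (- b) : R; pose q2 := 2 `^ (b - p) : R.
have q1P : 0 <= q1 < 1 by rewrite powR_ge0 powR2_lt1// oppr_lt0.
have q2P : 0 <= q2 < 1 by rewrite powR_ge0 powR2_lt1// subr_lt0.
pose c1 := V * 2 `^ N : R; pose c2 := V * 2 `^ N * 2 `^ (N + b) : R.
have c10 : 0 <= c1 by rewrite mulr_ge0 ?powR_ge0.
have c20 : 0 <= c2 by rewrite mulr_ge0 ?powR_ge0.
exists (c1 / (1 - q1) + c2 / (1 - q2)).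
  case/andP : q1P => _ /ltW; rewrite -subr_ge0 => q1P.
  case/andP : q2P => _ /ltW; rewrite -subr_ge0 => q2P.
  by rewrite addr_ge0// divr_ge0.
move=> r r0.
have A0 j : 0 <= A r j by exact: powR_ge0.
have B0 j : 0 <= B r j by rewrite mulr_ge0// powR_ge0.
have mind (a t : R) : measurable_fun [set: T] (fun y => (a * \1_(level t) y)%:E).
  by apply/measurable_EFinP/measurable_funM.
apply: (@le_trans _ _ (\int[mu]_y (\sum_(0 <= j <oo)
    ((A r j * \1_(level (2 * (2 ^+ j * r))) y)%:E +
     (B r j * \1_(level (2 * (2 ^- j * r))) y)%:E))))%E.
  apply: ge0_le_integral => //.
  - by move=> y _; rewrite lee_fin divr_ge0 ?powR_ge0// le_min powR_ge0/=.
  - apply/measurable_EFinP/measurable_funM.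
      apply: measurable_minr => //.
      apply: (measurableT_comp (measurable_powR p)) => //.
      by apply: measurable_funM.
    rewrite (_ : (fun y => _) = (@powR R ^~ (- (N + b))) \o f).
      exact: measurableT_comp (measurable_powR _) mf.
    by apply/funext => y /=; rewrite powRN.
  - apply: (@ge0_emeasurable_sum _ _ _ _ _ xpredT).
      by move=> j y _ _; rewrite adde_ge0// lee_fin mulr_ge0.
    by move=> j _; apply: emeasurable_funD.
  - by move=> y _; exact: kernel_le_dyadic.
rewrite integral_nneseries//; last 2 first.
- by move=> j; apply: emeasurable_funD.
- by move=> j y _; rewrite adde_ge0// lee_fin mulr_ge0.
have jle j : (\int[mu]_y ((A r j * \1_(level (2 * (2 ^+ j * r))) y)%:E +
     (B r j * \1_(level (2 * (2 ^- j * r))) y)%:E) <=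
    (c1 * r `^ (- b) * q1 ^+ j)%:E + (c2 * r `^ (- b) * q2 ^+ j)%:E)%E.
  rewrite ge0_integralD//; [|by move=> y _; rewrite lee_fin mulr_ge0..].
  rewrite -A_sum// -B_sum//.
  by rewrite leeD// level_integral// !mulr_gt0 ?invr_gt0 ?exprn_gt0.
apply: le_trans (lee_nneseries _ _) _; last 2 first.
- by move=> j _; exact: jle.
- rewrite nneseriesD//; last 2 first.
  + by move=> j _; rewrite lee_fin !mulr_ge0 ?powR_ge0 ?exprn_ge0 ?powR_ge0.
  + by move=> j _; rewrite lee_fin !mulr_ge0 ?powR_ge0 ?exprn_ge0 ?powR_ge0.
  rewrite (geometric_nneseries _ q1P) ?mulr_ge0 ?powR_ge0//.
  rewrite (geometric_nneseries _ q2P) ?mulr_ge0 ?powR_ge0//.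
  by rewrite -EFinD lee_fin; lra.
- by move=> j _ _; apply: integral_ge0 => y _; rewrite adde_ge0// lee_fin mulr_ge0.
Qed.

End dyadic.

(** * Invariance of Lebesgue measure under translations and point reflections *)

Section measure_preserving.
Context {R : realType} (d : measure_display) (T : measurableType d).
Variable mu : {measure set T -> \bar R}.

Definition measure_preserving (phi : T -> T) : Prop :=
  measurable_fun [set: T] phi /\
  (forall A, measurable A -> mu (phi @^-1` A) = mu A).

Lemma ge0_integral_measure_preserving phi (f : T -> \bar R) D :
  measure_preserving phi -> measurable D -> measurable_fun D f ->
  (forall y, D y -> (0 <= f y)%E) ->
  (\int[mu]_(y in phi @^-1` D) f (phi y) = \int[mu]_(y in D) f y)%E.
Proof.
move=> [mphi muphi] mD mf f0.
pose phi_pack : {mfun T >-> T} := HB.pack phi (isMeasurableFun.Build _ _ _ _ _ mphi).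
rewrite -(@ge0_integral_pushforward _ _ _ _ _ phi mphi mu D f)//; last first.
  by move=> y /set_mem; exact: f0.
apply: (@eq_measure_integral _ _ _ D mu (pushforward mu phi_pack)) => A mA _.
by rewrite -[RHS]muphi.
Qed.

Lemma integral_measure_preserving phi (f : T -> \bar R) D :
  measure_preserving phi -> measurable D -> measurable_fun D f ->
  (\int[mu]_(y in phi @^-1` D) f (phi y) = \int[mu]_(y in D) f y)%E.
Proof.
move=> mp mD mf; rewrite integralE [RHS]integralE.
congr (_ - _)%E.
  rewrite -(ge0_integral_measure_preserving mp mD (measurable_funepos mf))//.
  by apply: eq_integral => y _; rewrite -[RHS]/((f^\+ \o phi)%E y) -funepos_comp.
rewrite -(ge0_integral_measure_preserving mp mD (measurable_funeneg mf))//.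
by apply: eq_integral => y _; rewrite -[RHS]/((f^\- \o phi)%E y) -funeneg_comp.
Qed.

End measure_preserving.

Section affine_reflections.
Context {R : realType}.
Local Notation T := (measurableTypeR R).

(* [b] chooses between the translation [x |-> a + x] and the point reflection [x |-> a - x]. *)
Definition affine (b : bool) (a x : R) : R := if b then a - x else a + x.

Lemma measurable_affine b a : measurable_fun [set: T] (affine b a : T -> T).
Proof.
by case: b; [apply: measurable_funB|apply: measurable_funD].
Qed.

(** By uniqueness of Lebesgue measure, half-open intervals suffice. The reflection exchanges the
    open and the closed end, which does not affect the length. *)
Lemma measure_preserving_affine b a :
  measure_preserving (@lebesgue_measure R) (affine b a).
Proof.
have mphi := measurable_affine b a.
split => // A mA; apply/esym.
pose phi_pack : {mfun T >-> T} :=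
  HB.pack (affine b a : T -> T) (isMeasurableFun.Build _ _ _ _ _ mphi).
apply: (@lebesgue_measure_unique R (pushforward lebesgue_measure phi_pack)) => // X.
move=> [[x y] /= xy <-].
rewrite /pushforward /= lebesgue_measure_itv/= lte_fin.
have -> : affine b a @^-1` `]x, y] =
    if b then `[a - y, a - x[%classic else `]x - a, y - a]%classic.
  rewrite /affine; case: b {mphi phi_pack}; apply/seteqP; split => z /=;
    rewrite !in_itv/= => /andP[? ?]; apply/andP; split; lra.
by case: b {mphi phi_pack}; rewrite lebesgue_measure_itv/= lte_fin;
  do 2 case: ifP; rewrite -?EFinB => ? ?; try (congr EFin); lra.
Qed.

Definition tuple_affine n (b : bool) (a : 'rV[R]_n) (y : n.-tuple T) : n.-tuple T :=
  [tuple affine b (a 0 i) (tnth y i) | i < n].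

Lemma tuple_affineE n b (a : 'rV[R]_n) (y : n.-tuple T) :
  rv_of_tuple (tuple_affine b a y) =
  if b then a - rv_of_tuple y else a + rv_of_tuple y.
Proof.
by apply/rowP => i; rewrite mxE tnth_mktuple /affine; case: b; rewrite !mxE.
Qed.

Lemma measurable_tuple_affine n b (a : 'rV[R]_n) :
  measurable_fun [set: n.-tuple T] (tuple_affine b a).
Proof.
apply/measurable_fun_tnthP => i.
rewrite (_ : _ \o _ = affine b (a 0 i) \o (fun y : n.-tuple T => tnth y i)).
  apply: measurableT_comp; first exact: measurable_affine.
  exact: measurable_tnth.
by apply/funext => y /=; rewrite tnth_mktuple.
Qed.

(** Induction through the slices of the product measure: the induction hypothesis preserves the
    measure of each slice, and the one-dimensional case preserves the integral over the first
    coordinate. *)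
Lemma measure_preserving_tuple_affine n b (a : 'rV[R]_n) :
  measure_preserving (lebesgue_tuple R n) (tuple_affine b a).
Proof.
elim: n a => [|n IH] a.
  split => [|A mA]; first exact: measurable_tuple_affine.
  rewrite (_ : tuple_affine b a = id) ?preimage_id//.
  by apply/funext => y; apply: eq_from_tnth => -[].
split => [|A mA]; first exact: measurable_tuple_affine.
rewrite /= /lebesgue_cons /pushforward /product_measure1.
set B := @tuple_cons R n @^-1` A.
have mB : measurable B by rewrite -[X in measurable X]setTI; exact: measurable_tuple_cons.
pose a' : 'rV[R]_n := \row_i a 0 (lift ord0 i).
have [mphi muphi] := IH a'.
rewrite -[RHS](integral_measure_preserving (measure_preserving_affine b (a 0 ord0)))//=;
  last exact: (measurable_fun_xsection (lebesgue_tuple R n) mB).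
rewrite preimage_setT; apply: eq_integral => z _ /=.
rewrite -[RHS]muphi; last exact: (measurable_xsection _ mB).
rewrite !xsectionE /B; congr (_ _).
suff E y : tuple_affine b a (tuple_cons (z, y)) =
    tuple_cons (affine b (a 0 ord0) z, tuple_affine b a' y).
  by apply/seteqP; split => y /=; rewrite E.
apply: eq_from_tnth => i; rewrite tnth_mktuple.
by case: (unliftP ord0 i) => [j|] -> //=; rewrite !tnthS tnth_mktuple mxE.
Qed.

End affine_reflections.

Lemma continuous_atP {R : realType} (V : normedModType R) (f : V -> R) (x : V) :
  {for x, continuous f} <->
  (forall e : R, 0 < e -> exists2 r : R, 0 < r &
     forall y, `|x - y| < r -> `|f x - f y| < e).
Proof.
split=> [/cvgrPdist_lt cf e /cf /nbhs_ballP[r /= r0 rP]|cf].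
  by exists r => // y xy; apply: rP; rewrite -ball_normE.
apply/cvgrPdist_lt => e /cf[r r0 rP]; apply/nbhs_ballP; exists r => // y.
by rewrite -ball_normE => /rP.
Qed.

(** * The Euclidean norm on row vectors *)

Section euclidean_norm.
Context {R : realType} {n : nat}.
Implicit Types x y : 'rV[R]_n.

Definition sqnorm x : R := \sum_i x 0 i ^+ 2.

Lemma sqnorm_ge0 x : 0 <= sqnorm x.
Proof. by apply: sumr_ge0 => i _; exact: sqr_ge0. Qed.

Lemma euclid_ge0 x : 0 <= euclid x.
Proof. exact: sqrtr_ge0. Qed.

Lemma sqr_euclid x : euclid x ^+ 2 = sqnorm x.
Proof. by rewrite sqr_sqrtr// sqnorm_ge0. Qed.

Lemma euclidN x : euclid (- x) = euclid x.
Proof. by congr Num.sqrt; apply: eq_bigr => i _; rewrite mxE sqrrN. Qed.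

Lemma euclidB x y : euclid (x - y) = euclid (y - x).
Proof. by rewrite -euclidN opprB. Qed.

Lemma euclid0 : euclid (0 : 'rV[R]_n) = 0.
Proof.
by rewrite /euclid big1 ?sqrtr0// => i _; rewrite mxE expr0n.
Qed.

Lemma coord_le_euclid x i : `|x 0 i| <= euclid x.
Proof.
rewrite -sqrtr_sqr ler_wsqrtr// (bigD1 i)//= lerDl.
by apply: sumr_ge0 => j _; exact: sqr_ge0.
Qed.

Lemma euclid_eq0 x : euclid x = 0 -> x = 0.
Proof.
move=> x0; apply/rowP => i; rewrite mxE; apply/normr0_eq0/le_anti.
by rewrite normr_ge0 -x0 coord_le_euclid.
Qed.

Lemma euclid_le x (r : R) : 0 <= r -> (forall i, `|x 0 i| <= r) ->
  euclid x <= n%:R * r.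
Proof.
move=> r0 xr; rewrite -[leRHS]ger0_norm ?mulr_ge0// -sqrtr_sqr ler_wsqrtr//.
apply: (@le_trans _ _ (\sum_(i < n) r ^+ 2)).
  by apply: ler_sum => i _; rewrite -real_normK ?num_real// ler_pXn2r ?nnegrE.
rewrite sumr_const card_ord -[leLHS]mulr_natl exprMn ler_wpM2r ?sqr_ge0//.
by rewrite -natrX ler_nat; case: (n) => // k; rewrite expnS leq_pmulr.
Qed.

Lemma norm_le_euclid x : `|x| <= euclid x.
Proof.
rewrite /Num.norm/= mx_normrE; apply: bigmax_le => [|[i j] _ /=].
  exact: euclid_ge0.
by rewrite ord1 coord_le_euclid.
Qed.

Lemma coord_le_norm x i : `|x 0 i| <= `|x|.
Proof.
rewrite [leRHS]/Num.norm/= mx_normrE.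
by rewrite (le_bigmax _ (fun ij : 'I_1 * 'I_n => `|x ij.1 ij.2|) (0, i)).
Qed.

Lemma euclidZ (a : R) x : euclid (a *: x) = `|a| * euclid x.
Proof.
rewrite /euclid -sqrtr_sqr -sqrtrM ?sqr_ge0// mulr_sumr; congr Num.sqrt.
by apply: eq_bigr => i _; rewrite mxE exprMn.
Qed.

Lemma euclid_le_norm x : euclid x <= n%:R * `|x|.
Proof.
by apply: euclid_le => // i; exact: coord_le_norm.
Qed.

Lemma sqnorm_parallelogram x y :
  sqnorm (x + y) + sqnorm (x - y) = 2 * sqnorm x + 2 * sqnorm y.
Proof.
rewrite /sqnorm !mulr_sumr -!big_split/=; apply: eq_bigr => i _.
by rewrite !mxE; ring.
Qed.

(** Cauchy-Schwarz in weighted form: with [p], [q] the two norms,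
    [2 a b <= a^2 (q / p) + b^2 (p / q)] for each pair of coordinates, and the right-hand sides add
    up to [2 p q]. *)
Lemma euclid_triangle x y : euclid (x + y) <= euclid x + euclid y.
Proof.
have [x0|x0] := eqVneq (euclid x) 0; first by rewrite (euclid_eq0 x0) add0r euclid0 add0r.
have [y0|y0] := eqVneq (euclid y) 0; first by rewrite (euclid_eq0 y0) addr0 euclid0 addr0.
have {}x0 : 0 < euclid x by rewrite lt_def x0 euclid_ge0.
have {}y0 : 0 < euclid y by rewrite lt_def y0 euclid_ge0.
rewrite -ler_sqr ?nnegrE ?addr_ge0 ?euclid_ge0// sqrrD !sqr_euclid.
have sum_le : \sum_i (x + y) 0 i ^+ 2 <=
    \sum_i (x 0 i ^+ 2 + (x 0 i ^+ 2 * (euclid y / euclid x) +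
                          y 0 i ^+ 2 * (euclid x / euclid y)) + y 0 i ^+ 2).
  apply: ler_sum => i _; rewrite !mxE.
  have := sqr_ge0 (x 0 i * euclid y - y 0 i * euclid x).
  set a := x 0 i; set b := y 0 i; set p := euclid x; set q := euclid y => H.
  have : 0 <= (a * q - b * p) ^+ 2 / (p * q) by rewrite divr_ge0 ?sqr_ge0// mulr_ge0 ?ltW.
  suff -> : (a * q - b * p) ^+ 2 / (p * q) =
    a ^+ 2 * (q / p) + b ^+ 2 * (p / q) - 2 * a * b by lra.
  by field; rewrite !gt_eqF.
apply: le_trans sum_le _; rewrite !big_split/= -!mulr_suml -/(sqnorm x) -/(sqnorm y).
rewrite -!sqr_euclid le_eqVlt; apply/orP; left; apply/eqP.
by field; rewrite !gt_eqF.
Qed.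

Lemma euclid_dist_triangle x y z : euclid (x - z) <= euclid (x - y) + euclid (y - z).
Proof. by rewrite -[x - z](subrKA y) euclid_triangle. Qed.

End euclidean_norm.

Section measurability_rv.
Context {R : realType} {n : nat}.
Local Notation T := (measurableTypeR R).

(** Tuples carry the product sigma-algebra and row vectors the topology of the sup norm. The two
    meet because an open set is the countable union of the boxes of rational centre and radius
    [1 / (k + 1)] that it contains. *)
Lemma continuous_rv_of_tuple_measurable (g : 'rV[R]_n -> R) : continuous g ->
  measurable_fun [set: n.-tuple T] (g \o @rv_of_tuple R n).
Proof.
move=> /continuousP cg; apply: (measurability _ (RGenOpens.measurableE R)).
move=> _ [_ [a [b ->] <-]]; rewrite setTI comp_preimage.
have : open (g @^-1` `]a, b[%classic) by exact/cg/interval_open.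
set U := g @^-1` _ => oU {cg}.
pose box (q : 'rV[rat]_n * nat) : set (n.-tuple T) :=
  [set y | forall i, ball (ratr (q.1 0 i) : R) q.2.+1%:R^-1 (tnth y i)].
pose inside (q : 'rV[rat]_n * nat) : Prop :=
  ball (\row_i ratr (q.1 0 i) : 'rV[R]_n) q.2.+1%:R^-1 `<=` U.
rewrite (_ : _ @^-1` U = \bigcup_q (if `[< inside q >] then box q else set0)).
  apply: countable_bigcupT_measurable; first exact: countableP.
  move=> q; case: asboolP => // _.
  rewrite (_ : box q = \bigcap_(i in [set: 'I_n]) ((@tnth n T)^~ i @^-1`
      (ball (ratr (q.1 0 i) : R) q.2.+1%:R^-1))); last first.
    by apply/seteqP; split => y /= h i => [_|]; exact: h.
  apply: fin_bigcap_measurable => // i _.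
  rewrite -[X in measurable X]setTI; apply: measurable_tnth => //.
  exact: measurable_ball.
apply/seteqP; split => y /=.
- move=> Uy; have /nbhs_ballP[e /= e0 eU] := open_nbhs_nbhs (conj oU Uy).
  (* Two radii add up: from [y] to the rational centre, then from the centre to a point of the box.
     Hence the bound [e / 2] on each. *)
  pose k := Num.truncn (2 / e).
  have ke : k.+1%:R^-1 < e / 2.
    by rewrite invf_plt ?posrE ?divr_gt0// invf_div truncnS_gt.
  have k0 : 0 < k.+1%:R^-1 :> R by [].
  have [q qP] : exists q : 'rV[rat]_n, forall i,
      ball (ratr (q 0 i) : R) k.+1%:R^-1 (tnth y i).
    have /choice[q qP] : forall i, exists r : rat,
        ball (ratr r : R) k.+1%:R^-1 (tnth y i).
      move=> i; have := @dense_rat R (ball (tnth y i : R) k.+1%:R^-1).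
      case; first by exists (tnth y i); exact: ballxx.
        exact: ball_open.
      by move=> z [/= yq [r _ rE]]; exists r; rewrite rE; exact: ball_sym.
    by exists (\row_i q i) => i; rewrite mxE.
  exists (q, k) => //; rewrite asboolT//= => z [_ zq]; apply: eU.
  split => // i j; rewrite mxE ord1.
  have := zq i j; rewrite mxE ord1 /= => zqj; have yqj := qP j.
  apply: (@le_ball _ _ _ (k.+1%:R^-1 + k.+1%:R^-1)).
    by rewrite [leRHS]splitr lerD// ltW.
  exact: ball_triangle (ball_sym yqj) zqj.
- move=> [q _]; have [qU|nqU] := pselect (inside q); last by rewrite asboolF.
  by rewrite asboolT// => yq; apply: qU; split => // i j; rewrite !mxE; exact: yq.
Qed.

Lemma continuous_euclid : continuous (@euclid R n).
Proof.
move=> x; apply/continuous_atP => e e0.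
exists (e / n.+1%:R) => [|y xy]; first by rewrite divr_gt0.
apply: (@le_lt_trans _ _ (euclid (x - y))).
  have := euclid_triangle y (x - y); have := euclid_triangle x (y - x).
  by rewrite !subrKC (euclidB y x) ler_norml => ? ?; apply/andP; split; lra.
apply: le_lt_trans (euclid_le_norm _) _.
apply: (@le_lt_trans _ _ (n.+1%:R * `|x - y|)); last by rewrite mulrC -ltr_pdivlMr.
by rewrite ler_wpM2r// ler_nat.
Qed.

End measurability_rv.

Section kernels.
Context {R : realType}.
Local Notation T := (measurableTypeR R).

Definition box n (r : R) : set (n.-tuple T) :=
  [set y | forall i, `|tnth y i : R| < r].
Arguments box n r : clear implicits.

Lemma measurable_box n r : measurable (box n r).
Proof.
rewrite (_ : box n r = \bigcap_(i in [set: 'I_n]) ((@tnth n T)^~ i @^-1` `]-r, r[%classic)).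
  apply: fin_bigcap_measurable => // i _.
  by rewrite -[X in measurable X]setTI; exact: measurable_tnth.
apply/seteqP; split => y /=.
  by move=> h i _ /=; rewrite in_itv/= -ltr_norml; exact: h.
by move=> h i; have := h i I; rewrite /= in_itv/= -ltr_norml.
Qed.

Lemma lebesgue_box n r : 0 < r ->
  lebesgue_tuple R n (box n r) = ((2 * r) ^+ n)%:E.
Proof.
move=> r0.
rewrite (_ : box n r = [set y | forall i : 'I_n, `]-r, r[%classic (tnth y i)]).
  rewrite (@lebesgue_tuple_box R n (fun=> `]-r, r[%classic))//.
  rewrite -[in RHS](card_ord n) -prodr_const -prodEFin; apply: eq_bigr => i _.
  by rewrite lebesgue_measure_itv/= lte_fin gtrN// -EFinB; congr EFin; ring.
by apply/seteqP; split => y /= h i; have := h i; rewrite /= in_itv/= -ltr_norml.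
Qed.

Lemma box_euclid n r (y : n.-tuple T) : 0 < r -> box n r y ->
  euclid (rv_of_tuple y) <= n%:R * r.
Proof.
move=> r0 yr; apply: euclid_le; first exact: ltW.
by move=> i; rewrite mxE; exact/ltW/yr.
Qed.

Lemma measurable_euclid n :
  measurable_fun [set: n.-tuple T] (fun y => euclid (rv_of_tuple y)).
Proof. exact: (continuous_rv_of_tuple_measurable (@continuous_euclid R n)). Qed.

(** The growth constant [2 ^+ n] comes from enclosing a Euclidean ball in the cube of half side
    [r]. *)
Lemma space_kernel_integral_le n (s : R) : 0 < s < 1 ->
  exists2 C : R, 0 <= C & forall r : R, 0 < r ->
  (\int[lebesgue_tuple R n]_y
     (Num.min ((euclid (rv_of_tuple y) / r) ^+ 2) 1 /
      euclid (rv_of_tuple y) `^ (n%:R + 2 * s))%:E <= (C * r `^ (- (2 * s)))%:E)%E.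
Proof.
move=> /andP[s0 s1].
have [||||||C C0 CP] := @kernel_integral_le R _ _ (lebesgue_tuple R n)
  (fun y => euclid (rv_of_tuple y)) (2 ^+ n) n%:R (2 * s) 2 (@measurable_euclid n).
- by move=> y; exact: euclid_ge0.
- by [].
- by [].
- lra.
- lra.
- move=> r r0; apply: (@le_trans _ _ (lebesgue_tuple R n (box n r))).
    apply: le_measure; rewrite ?inE.
    + rewrite (_ : [set _ | _] = (fun y => euclid (rv_of_tuple y)) @^-1` `]-oo, r[%classic).
        by rewrite -[X in measurable X]setTI; exact: measurable_euclid.
      by apply/seteqP; split => y /=; rewrite in_itv.
    + exact: measurable_box.
    + move=> y /= yr i; apply: le_lt_trans yr.
      by have := coord_le_euclid (rv_of_tuple y) i; rewrite mxE.
  by rewrite lebesgue_box// lee_fin exprMn powR_mulrn// ltW.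
exists C => // r r0; apply: le_trans (CP _ r0).
rewrite le_eqVlt; apply/orP; left; apply/eqP; apply: eq_integral => y _.
by rewrite powR_mulrn// divr_ge0 ?euclid_ge0// ltW.
Qed.

Lemma measurable_time_damp (p q t : R) D : measurable_fun D
  (fun r : T => Num.min ((r / t) `^ p) 1 / r `^ q).
Proof.
apply/measurable_funTS/measurable_funM.
  apply: measurable_minr => //; apply: (measurableT_comp (measurable_powR _)) => //.
  exact: measurable_funM.
rewrite (_ : (fun r : T => _) = (@powR R ^~ (- q))); first exact: measurable_powR.
by apply/funext => y /=; rewrite powRN.
Qed.

Lemma time_kernel_integral_le (a p : R) : 0 < a -> a < p ->
  exists2 C : R, 0 <= C & forall r : R, 0 < r ->
  (\int[@lebesgue_measure R]_(y in `]0%R, +oo[)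
     (Num.min ((y / r) `^ p) 1 / y `^ (1 + a))%:E <= (C * r `^ (- a))%:E)%E.
Proof.
move=> a0 ap.
have [||||||C C0 CP] := @kernel_integral_le R _ _ (@lebesgue_measure R)
  (fun y => `|y|) 2 1 a p (@normr_measurable R setT) => //.
- move=> r r0.
  rewrite (_ : [set _ | _] = `]-r, r[%classic); last first.
    by apply/seteqP; split => y /=; rewrite in_itv/= -ltr_norml.
  have E : lebesgue_measure `]-r, r[%classic = (2 * r)%:E.
    by rewrite lebesgue_measure_itv/= lte_fin gtrN// -EFinB; congr EFin; ring.
  by rewrite powRr1 ?(ltW r0)// -E.
exists C => // r r0; apply: le_trans (CP r r0).
apply: (@le_trans _ _ (\int[@lebesgue_measure R]_(y in `]0%R, +oo[)
    (Num.min ((`|y| / r) `^ p) 1 / `|y| `^ (1 + a))%:E)%E).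
  rewrite le_eqVlt; apply/orP; left; apply/eqP; apply: eq_integral => y.
  by rewrite inE/= in_itv/= andbT => y0; rewrite gtr0_norm.
apply: ge0_subset_integral => //.
- apply/measurable_EFinP.
  exact: (measurableT_comp (measurable_time_damp p (1 + a) r (D := setT))
    (@normr_measurable R setT)).
- by move=> y _; rewrite lee_fin divr_ge0 ?powR_ge0// le_min powR_ge0/=.
Qed.

End kernels.
Arguments box {R} n r.

(** * Positivity of the Gamma integral *)

Section gamma.
Context {R : realType}.
Local Notation mu := (@lebesgue_measure R).

(* Together with [time_kernel_integral_le], this makes the integrand of [Gamma_integral x]
   integrable. *)
Let gamma_le_kernel (x : R) : 0 < x -> exists2 C : R, 0 <= C & forall r : R, 0 < r ->
  r `^ (x - 1) * expR (- r) <= C * (Num.min ((r / 1) `^ (x + 1)) 1 / r `^ (1 + 1)).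
Proof.
(* For [r >= 1], [r^(x+1) <= r^(k+1) <= (k+1)! e^r] by the exponential series. *)
move=> x0; pose k := Num.truncn (x + 1).
have kx : x + 1 < k.+1%:R by exact: truncnS_gt.
exists (k.+1`!%:R) => // r r0; rewrite divr1.
have E : r `^ (x - 1) = r `^ (x + 1) / r `^ (1 + 1).
  by rewrite -powRB; [congr powR; ring|apply/implyP => _; rewrite gt_eqF].
have k1 : 1 <= k.+1`!%:R :> R by rewrite ler1n fact_gt0.
have e1 : expR (- r) <= 1 by rewrite -[leRHS]expR0 ler_expR oppr_le0 ltW.
have rx0 : 0 <= r `^ (x + 1) by exact: powR_ge0.
rewrite E mulrAC mulrA ler_wpM2r ?invr_ge0 ?powR_ge0//.
have [r1|r1] := leP r 1.
  have /min_idPl -> : r `^ (x + 1) <= 1.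
    have := @ge0_ler_powR R (x + 1) _ r 1; rewrite powR1 !nnegrE; apply => //; first lra.
    exact: ltW.
  by rewrite mulrC ler_pM ?expR_ge0// (le_trans e1).
have /min_idPr -> : 1 <= r `^ (x + 1).
  have := @ge0_ler_powR R (x + 1) _ 1 r; rewrite powR1 !nnegrE; apply => //; first lra.
  - exact: ltW.
  - exact: ltW.
rewrite mulr1 expRN ler_pdivrMr ?expR_gt0//.
apply: (@le_trans _ _ (r ^+ k.+1)).
  by rewrite -powR_mulrn ?(ltW r0)// ler_powR ?(ltW r1)// ltW.
rewrite mulrC -ler_pdivrMr ?ltr0n ?fact_gt0//.
by apply: le_trans (expR_ge1Dxn k (ltW r0)); rewrite lerDr.
Qed.

(** Finiteness has to be proved as well, since [fine] sends [+oo] to 0. The lower bound comes from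
    []1, 2[], where [r^(x-1)] lies between 1 and [2^(x-1)]. *)
Lemma Gamma_integral_gt0 (x : R) : 0 < x -> 0 < Gamma_integral x.
Proof.
move=> x0; have [C C0 CP] := gamma_le_kernel x0.
have [K K0 KP] : exists2 C : R, 0 <= C & forall r : R, 0 < r ->
  (\int[mu]_(y in `]0%R, +oo[) (Num.min ((y / r) `^ (x + 1)) 1 / y `^ (1 + 1))%:E <=
   (C * r `^ (- 1))%:E)%E by apply: time_kernel_integral_le; lra.
pose g (r : R) := r `^ (x - 1) * expR (- r).
have g0 r : 0 <= g r by rewrite mulr_ge0 ?powR_ge0 ?expR_ge0.
have mg D : measurable_fun D (EFin \o g).
  apply/measurable_EFinP/measurable_funM; apply: measurable_funTS.
    exact: measurable_powR.
  by apply: measurableT_comp => //; exact: measurable_funB.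
have finite : (\int[mu]_(r in `]0%R, +oo[) (g r)%:E < +oo)%E.
  apply: (@le_lt_trans _ _ (\int[mu]_(y in `]0%R, +oo[) (C%:E *
    (Num.min ((y / 1) `^ (x + 1)) 1 / y `^ (1 + 1))%:E)))%E.
    apply: ge0_le_integral => //.
    - by move=> r _; rewrite lee_fin.
    - exact: mg.
    - apply: measurable_funeM; apply/measurable_EFinP; exact: measurable_time_damp.
    - move=> r; rewrite /= in_itv/= andbT => r0; rewrite -EFinM lee_fin.
      exact: CP.
  rewrite ge0_integralZl//.
  - apply: (@le_lt_trans _ _ (C%:E * (K * 1 `^ (- 1))%:E)%E); last by rewrite -EFinM ltry.
    by rewrite lee_wpmul2l ?lee_fin//; exact: (KP 1 ltr01).
  - apply/measurable_EFinP; exact: measurable_time_damp.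
  - by move=> y _; rewrite lee_fin divr_ge0 ?powR_ge0// le_min powR_ge0/=.
rewrite /Gamma_integral /Rintegral fine_gt0// finite andbT.
have lower : forall r, `]1, 2[%classic r -> (Num.min 1 (2 `^ (x - 1)) * expR (- 2) <= g r).
  move=> r /=; rewrite in_itv/= => /andP[r1 r2].
  rewrite ler_pM ?expR_ge0// ?le_min ?powR_ge0 ?ler01//; last by rewrite ler_expR; lra.
  have [x1|x1] := leP 1 x.
    rewrite ge_min; apply/orP; left.
    apply: (@le_trans _ _ (1 `^ (x - 1))); first by rewrite powR1.
    by apply: ge0_ler_powR; rewrite ?nnegrE; lra.
  rewrite ge_min; apply/orP; right.
  rewrite -[x - 1]opprK opprB !powRN lef_pV2 ?posrE ?powR_gt0//; last lra.
  by apply: ge0_ler_powR; rewrite ?nnegrE; lra.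
apply: (@lt_le_trans _ _
  (\int[mu]_(r in `]1%R, 2%R[) (Num.min 1 (2 `^ (x - 1)) * expR (- 2))%:E)%E).
  rewrite integral_cst//= lebesgue_measure_itv/= lte_fin ltr1n -EFinB -EFinM lte_fin.
  by rewrite !mulr_gt0 ?expR_gt0 ?subr_gt0 ?ltr1n// lt_min ltr01 powR_gt0.
apply: (@le_trans _ _ (\int[mu]_(r in `]1%R, 2%R[) (g r)%:E)%E).
  by apply: ge0_le_integral => //; exact: mg.
apply: ge0_subset_integral => //.
  exact: mg.
- by move=> r _; rewrite lee_fin; exact: g0.
- by apply: subset_itv; rewrite bnd_simp.
Qed.

End gamma.

(** * The equation in terms of differences *)

Section integral_bounds.
Context {R : realType} (d : measure_display) (T : measurableType d).
Variable mu : {measure set T -> \bar R}.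

(** Here [f] is a difference of unknown sign and [g] the bump that makes [f + g] nonnegative. The
    finite value [A] can then be inserted into the equation, which is a statement about the
    integrals of [f]. *)
Lemma integral_add_bounded (D : set T) (f g : T -> R) (q : R) :
  measurable D -> mu.-integrable D (EFin \o f) -> measurable_fun D g ->
  (forall y, D y -> 0 <= g y) -> (\int[mu]_(y in D) (g y)%:E <= q%:E)%E ->
  (forall y, D y -> 0 <= f y + g y) ->
  exists A : R, [/\ (\int[mu]_(y in D) (f y + g y)%:E = A%:E)%E, 0 <= A &
    A <= \int[mu]_(y in D) f y + q].
Proof.
move=> mD fi mg g0 gq fg0.
have gi : mu.-integrable D (EFin \o g).
  apply/integrableP; split; first exact/measurable_EFinP.
  apply: (@le_lt_trans _ _ q%:E); last by rewrite ltry.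
  apply: le_trans gq; rewrite le_eqVlt; apply/orP; left; apply/eqP.
  by apply: eq_integral => y /set_mem Dy /=; rewrite ger0_norm// g0.
have E : (\int[mu]_(y in D) (f y + g y)%:E =
    (\int[mu]_(y in D) f y + \int[mu]_(y in D) g y)%:E)%E.
  rewrite (_ : (fun y => _) = (EFin \o f) \+ (EFin \o g))%E//.
  rewrite integralD// EFinD !fineK//; by exact: integrable_fin_num.
exists (\int[mu]_(y in D) f y + \int[mu]_(y in D) g y); split => //.
- by rewrite -lee_fin -E; apply: integral_ge0 => y Dy; rewrite lee_fin fg0.
- by rewrite lerD2l -lee_fin fineK//; exact: integrable_fin_num.
Qed.

End integral_bounds.

Section reduced_equation.
Context {R : realType} (n : nat) (alpha s : R).
Hypotheses (alpha01 : 0 < alpha < 1) (s01 : 0 < s < 1).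
Local Notation T := (measurableTypeR R).
Local Notation mu := (@lebesgue_measure R).
Local Notation nu := (lebesgue_tuple R n).
Local Notation space_kernel y := ((euclid y `^ (n%:R + 2 * s))^-1).
Local Notation time_kernel r := ((r `^ (1 + alpha))^-1).

(* [rs l] and [rt l] are the space and time lengths of a parabolic box of order [l]. *)
Definition rs (l : R) : R := l `^ (2 * s)^-1.
Definition rt (l : R) : R := l `^ alpha^-1.

Let s2 : 0 < 2 * s. Proof. by case/andP : s01 => ? _; rewrite mulr_gt0. Qed.
Let a0 : 0 < alpha. Proof. by case/andP : alpha01. Qed.

Lemma rs_gt0 l : 0 < l -> 0 < rs l. Proof. exact: powR_gt0. Qed.
Lemma rt_gt0 l : 0 < l -> 0 < rt l. Proof. exact: powR_gt0. Qed.

Lemma rsM a b : 0 <= a -> 0 <= b -> rs (a * b) = rs a * rs b.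
Proof. by move=> ? ?; rewrite /rs powRM. Qed.

Lemma rtM a b : 0 <= a -> 0 <= b -> rt (a * b) = rt a * rt b.
Proof. by move=> ? ?; rewrite /rt powRM. Qed.

Lemma rsK l : 0 <= l -> rs l `^ (2 * s) = l.
Proof. by move=> l0; rewrite /rs -powRrM mulVf ?gt_eqF// powRr1. Qed.

Lemma rtK l : 0 <= l -> rt l `^ alpha = l.
Proof. by move=> l0; rewrite /rt -powRrM mulVf ?gt_eqF// powRr1. Qed.

Lemma powR_rsK l : 0 <= l -> rs (l `^ (2 * s)) = l.
Proof. by move=> l0; rewrite /rs -powRrM mulfV ?gt_eqF// powRr1. Qed.

Lemma powR_rtK l : 0 <= l -> rt (l `^ alpha) = l.
Proof. by move=> l0; rewrite /rt -powRrM mulfV ?gt_eqF// powRr1. Qed.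

Lemma le_rs a b : 0 <= a -> a <= b -> rs a <= rs b.
Proof.
move=> a_ge0 ab; apply: ge0_ler_powR; rewrite ?nnegrE ?invr_ge0 ?(ltW s2)//.
exact: le_trans ab.
Qed.

Lemma le_rt a b : 0 <= a -> a <= b -> rt a <= rt b.
Proof.
move=> a_ge0 ab; apply: ge0_ler_powR; rewrite ?nnegrE ?invr_ge0 ?(ltW a0)//.
exact: le_trans ab.
Qed.

(** The sign is opposite to that of the usual second difference, so that it is nonnegative at a
    maximum, like [past_diff]. *)
Definition sym_diff (v : 'rV[R]_n -> R -> R) x t (y : 'rV[R]_n) : R :=
  2 * v x t - v (x + y) t - v (x - y) t.

Definition past_diff (v : 'rV[R]_n -> R -> R) x t (r : R) : R :=
  v x t - v x (t - r).

(** Symmetrisation removes the principal value: the integrals converge absolutely. Integrability is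
    recorded because the real-valued integral would otherwise be a default value. *)
Definition reduced_eqn (c1 c2 : R) (v : 'rV[R]_n -> R -> R) x t : Prop :=
  [/\ mu.-integrable `]0, +oo[%classic
        (fun r => (past_diff v x t r * time_kernel r)%:E),
      nu.-integrable [set: n.-tuple T]
        (fun y => (sym_diff v x t (rv_of_tuple y) * space_kernel (rv_of_tuple y))%:E) &
      c1 * \int[mu]_(r in `]0, +oo[) (past_diff v x t r * time_kernel r) +
      c2 * \int[nu]_y (sym_diff v x t (rv_of_tuple y) * space_kernel (rv_of_tuple y)) = 0].

(** Profiles of a bump of height 1 seen from the contact point: quadratic in space, where the
    gradient cancels in the second difference, linear in time, and saturated outside the box. As
    [rs l ^ (2s) = rt l ^ alpha = l], both integrate against their kernels to [O(1 / l)]. *)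
Definition sdamp (l : R) (y : 'rV[R]_n) : R := Num.min ((euclid y / rs l) ^+ 2) 1.
Definition tdamp (l r : R) : R := Num.min (r / rt l) 1.

Lemma sdamp_ge0 l y : 0 <= sdamp l y.
Proof. by rewrite le_min sqr_ge0/=. Qed.

Lemma tdamp_ge0 l r : 0 < l -> 0 <= r -> 0 <= tdamp l r.
Proof. by move=> l0 r0; rewrite le_min ler01 andbT divr_ge0// ltW// rt_gt0. Qed.

Lemma measurable_space_kernel :
  measurable_fun [set: n.-tuple T] (fun y => space_kernel (rv_of_tuple y)).
Proof.
rewrite (_ : (fun y => _) = (@powR R ^~ (- (n%:R + 2 * s))) \o
    (fun y : n.-tuple T => euclid (rv_of_tuple y))).
  exact: measurableT_comp (measurable_powR _) (@measurable_euclid R n).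
by apply/funext => y /=; rewrite powRN.
Qed.

Lemma measurable_sdamp l :
  measurable_fun [set: n.-tuple T] (fun y => sdamp l (rv_of_tuple y)).
Proof.
apply: measurable_minr => //; apply: measurable_funX.
by apply: measurable_funM => //; exact: measurable_euclid.
Qed.

Lemma measurable_time_kernel D : measurable_fun D (fun r : T => time_kernel r).
Proof.
rewrite (_ : (fun y => _) = (@powR R ^~ (- (1 + alpha)))).
  by apply: measurable_funTS; exact: measurable_powR.
by apply/funext => y /=; rewrite powRN.
Qed.

Lemma measurable_tdamp l D : measurable_fun D (tdamp l : T -> T).
Proof. by apply: measurable_minr => //; exact: measurable_funM. Qed.

Lemma space_cost : exists2 C : R, 0 <= C & forall a l : R, 0 <= a -> 0 < l ->
  (\int[nu]_y (a * sdamp l (rv_of_tuple y) * space_kernel (rv_of_tuple y))%:E <=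
   (C * (a / l))%:E)%E.
Proof.
have [C C0 CP] := space_kernel_integral_le n s01.
exists C => // a l a_ge0 l0; have := CP _ (rs_gt0 l0).
rewrite powRN rsK ?(ltW l0)// => H.
under eq_integral do rewrite -mulrA EFinM.
rewrite ge0_integralZl//; last 2 first.
- by apply/measurable_EFinP/measurable_funM;
    [exact: measurable_sdamp|exact: measurable_space_kernel].
- by move=> y _; rewrite lee_fin mulr_ge0 ?sdamp_ge0// invr_ge0 powR_ge0.
by rewrite mulrCA EFinM lee_wpmul2l ?lee_fin.
Qed.

Lemma time_cost : exists2 C : R, 0 <= C & forall a l : R, 0 <= a -> 0 < l ->
  (\int[mu]_(r in `]0%R, +oo[) (a * tdamp l r * time_kernel r)%:E <=
   (C * (a / l))%:E)%E.
Proof.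
have a1 : alpha < 1 by case/andP : alpha01.
have [C C0 CP] := @time_kernel_integral_le R alpha 1 a0 a1.
exists C => // a l a_ge0 l0; have := CP _ (rt_gt0 l0).
rewrite powRN rtK ?(ltW l0)// => H.
under eq_integral do rewrite -mulrA EFinM.
rewrite ge0_integralZl//; last 2 first.
- apply/measurable_EFinP/measurable_funM; first exact: measurable_tdamp.
  exact: measurable_time_kernel.
- move=> r; rewrite /= in_itv/= andbT => /ltW r0.
  by rewrite lee_fin mulr_ge0 ?tdamp_ge0// invr_ge0 powR_ge0.
rewrite mulrCA EFinM lee_wpmul2l ?lee_fin//; apply: le_trans H.
rewrite le_eqVlt; apply/orP; left; apply/eqP; apply: eq_integral => r.
by rewrite inE/= in_itv/= andbT => r0; rewrite powRr1// divr_ge0 ?ltW ?rt_gt0.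
Qed.

Variables (c1 c2 : R).
Hypotheses (c1_gt0 : 0 < c1) (c2_gt0 : 0 < c2).

(** Adding the bumps makes both integrands nonnegative. Since the integrals of the bare differences
    cancel, the two new integrals, weighted by [c1] and [c2], add up to at most the cost of the
    bumps. *)
Lemma touching : exists2 C : R, 0 <= C & forall v x t (a1 a2 l1 l2 : R),
  reduced_eqn c1 c2 v x t -> 0 <= a1 -> 0 <= a2 -> 0 < l1 -> 0 < l2 ->
  (forall y, - (a1 * sdamp l1 y + a2 * sdamp l2 y) <= sym_diff v x t y) ->
  (forall r, 0 < r -> - (a1 * tdamp l1 r + a2 * tdamp l2 r) <= past_diff v x t r) ->
  (\int[nu]_y ((sym_diff v x t (rv_of_tuple y) +
      (a1 * sdamp l1 (rv_of_tuple y) + a2 * sdamp l2 (rv_of_tuple y))) *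
      space_kernel (rv_of_tuple y))%:E <= (C * (a1 / l1 + a2 / l2))%:E)%E /\
  (\int[mu]_(r in `]0%R, +oo[) ((past_diff v x t r +
      (a1 * tdamp l1 r + a2 * tdamp l2 r)) * time_kernel r)%:E <=
      (C * (a1 / l1 + a2 / l2))%:E)%E.
Proof.
have [Cs Cs0 CsP] := space_cost; have [Ct Ct0 CtP] := time_cost.
exists ((c1 * Ct + c2 * Cs) / c1 + (c1 * Ct + c2 * Cs) / c2).
  by rewrite addr_ge0// divr_ge0 ?addr_ge0 ?mulr_ge0// ltW.
move=> v x t a1 a2 l1 l2 [tint sint eqn] a1_ge0 a2_ge0 l1_gt0 l2_gt0 Sge Dge.
set q := a1 / l1 + a2 / l2.
have q0 : 0 <= q by rewrite addr_ge0// divr_ge0// ltW.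
have sk0 (y : 'rV[R]_n) : 0 <= space_kernel y by rewrite invr_ge0 powR_ge0.
have tk0 (r : R) : 0 <= time_kernel r by rewrite invr_ge0 powR_ge0.
have [||||As [AsE As0 Asle]] := @integral_add_bounded R _ _ nu setT
  (fun y => sym_diff v x t (rv_of_tuple y) * space_kernel (rv_of_tuple y))
  (fun y => (a1 * sdamp l1 (rv_of_tuple y) + a2 * sdamp l2 (rv_of_tuple y)) *
      space_kernel (rv_of_tuple y)) (Cs * q) measurableT sint.
- apply: measurable_funM; last exact: measurable_space_kernel.
  by apply: measurable_funD; apply: measurable_funM => //; exact: measurable_sdamp.
- by move=> y _; rewrite mulr_ge0// addr_ge0// mulr_ge0// sdamp_ge0.
- have msk a l : 0 <= a -> 0 < l -> measurable_fun [set: n.-tuple T]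
      (fun y => (a * sdamp l (rv_of_tuple y) * space_kernel (rv_of_tuple y))%:E).
    move=> _ _; apply/measurable_EFinP/measurable_funM; last exact: measurable_space_kernel.
    by apply: measurable_funM => //; exact: measurable_sdamp.
  under eq_integral do rewrite mulrDl EFinD.
  rewrite ge0_integralD//; last 4 first.
  + by move=> y _; rewrite lee_fin !mulr_ge0// sdamp_ge0.
  + exact: msk.
  + by move=> y _; rewrite lee_fin !mulr_ge0// sdamp_ge0.
  + exact: msk.
  by rewrite mulrDr EFinD leeD// CsP.
- move=> y _; rewrite -mulrDl mulr_ge0//.
  by have := Sge (rv_of_tuple y); lra.
have [||||At [AtE At0 Atle]] := @integral_add_bounded R _ _ mu `]0, +oo[%classic
  (fun r => past_diff v x t r * time_kernel r)
  (fun r => (a1 * tdamp l1 r + a2 * tdamp l2 r) * time_kernel r)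
  (Ct * q) (measurable_itv _) tint.
- apply: measurable_funM; last exact: measurable_time_kernel.
  by apply: measurable_funD; apply: measurable_funM => //; exact: measurable_tdamp.
- move=> r; rewrite /= in_itv/= andbT => /ltW r0.
  by rewrite mulr_ge0// addr_ge0// mulr_ge0// tdamp_ge0.
- have mtk a l : measurable_fun (`]0%R, +oo[%classic : set T)
      (fun r : T => (a * tdamp l r * time_kernel r)%:E).
    apply/measurable_EFinP/measurable_funM; last exact: measurable_time_kernel.
    by apply: measurable_funM => //; exact: measurable_tdamp.
  under eq_integral do rewrite mulrDl EFinD.
  rewrite ge0_integralD//; last 2 first.
  + move=> r; rewrite /= in_itv/= andbT => /ltW r0.
    by rewrite lee_fin !mulr_ge0// tdamp_ge0.
  + move=> r; rewrite /= in_itv/= andbT => /ltW r0.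
    by rewrite lee_fin !mulr_ge0// tdamp_ge0.
  by rewrite mulrDr EFinD leeD// CtP.
- move=> r; rewrite /= in_itv/= andbT => r0; rewrite -mulrDl mulr_ge0//.
  by have := Dge r r0; lra.
have combine (I1 I2 : R) : c1 * I1 + c2 * I2 = 0 -> At <= I1 + Ct * q ->
    As <= I2 + Cs * q -> c1 * At + c2 * As <= (c1 * Ct + c2 * Cs) * q.
  move=> I0 h1 h2; rewrite -(ler_pM2l c1_gt0) in h1.
  rewrite -(ler_pM2l c2_gt0) in h2.
  by clear -I0 h1 h2; lra.
have cost := combine _ _ eqn Atle Asle.
have K0 : 0 <= c1 * Ct + c2 * Cs by rewrite addr_ge0// mulr_ge0// ltW.
(* Each integral is bounded separately by dropping the other one, which is nonnegative. *)
have le1 : At <= (c1 * Ct + c2 * Cs) / c1 * q.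
  rewrite mulrAC ler_pdivlMr// mulrC; apply: le_trans cost.
  by rewrite lerDl mulr_ge0// ltW.
have le2 : As <= (c1 * Ct + c2 * Cs) / c2 * q.
  rewrite mulrAC ler_pdivlMr// mulrC; apply: le_trans cost.
  by rewrite lerDr mulr_ge0// ltW.
have m1 : 0 <= (c1 * Ct + c2 * Cs) / c1 * q by rewrite mulr_ge0// divr_ge0// ltW.
have m2 : 0 <= (c1 * Ct + c2 * Cs) / c2 * q by rewrite mulr_ge0// divr_ge0// ltW.
split.
  under eq_integral do rewrite mulrDl.
  by rewrite AsE lee_fin mulrDl (le_trans le2)// lerDr.
under eq_integral do rewrite mulrDl.
by rewrite AtE lee_fin mulrDl (le_trans le1)// lerDl.
Qed.

End reduced_equation.

(** * Moduli of continuity *)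

Section telescope.
Context {R : realType} (d : measure_display) (T : measurableType d).
Variables (mu : {measure set T -> \bar R}) (phi : nat -> T -> T) (N : nat).
Hypothesis mp : forall k, measure_preserving mu (phi k).

(** All translates of [f] have the same integral. They may overlap; the factor [N] pays for this. *)
Lemma telescope (f : T -> \bar R) (A : set T) (m : R) :
  measurable_fun [set: T] f -> (forall y, 0 <= f y)%E -> measurable A -> 0 <= m ->
  (forall y, A y -> (m%:E <= \sum_(k < N) f (phi k y))%E) ->
  (m%:E * mu A <= N%:R%:E * \int[mu]_y f y)%E.
Proof.
move=> mf f0 mA m0 sum_ge.
have mfk k : measurable_fun [set: T] (fun y => f (phi k y)).
  by apply: measurableT_comp => //; case: (mp k).
have -> : (N%:R%:E * \int[mu]_y f y = \int[mu]_y \sum_(k < N) f (phi k y))%E.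
  rewrite ge0_integral_sum//; rewrite (eq_bigr (fun=> \int[mu]_y f y)%E).
    have : (0 <= \int[mu]_y f y)%E by exact: integral_ge0.
    move: (\int[mu]_y f y)%E => c c0; elim: N => [|k IH]; first by rewrite big_ord0 mul0e.
    by rewrite big_ord_recr/= -IH -natr1 EFinD ge0_muleDl ?lee_fin// mul1e.
  move=> k _; rewrite -[RHS](ge0_integral_measure_preserving (mp k))//.
rewrite -integral_cst//.
apply: (@le_trans _ _ (\int[mu]_(y in A) \sum_(k < N) f (phi k y))%E).
  apply: ge0_le_integral => //.
  apply: measurable_funTS; exact: emeasurable_sum.
apply: ge0_subset_integral => //.
- exact: emeasurable_sum.
- by move=> y _; apply: sume_ge0.
Qed.

End telescope.

Section telescope_kernels.
Context {R : realType} (n : nat) (alpha s : R).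
Local Notation T := (measurableTypeR R).
Local Notation mu := (@lebesgue_measure R).
Local Notation nu := (lebesgue_tuple R n).
Local Notation space_kernel y := ((euclid y `^ (n%:R + 2 * s))^-1).
Local Notation time_kernel r := ((r `^ (1 + alpha))^-1).

Lemma telescope_space (p : 'rV[R]_n -> R) (N : nat) (h : 'rV[R]_n) (m rho r : R) :
  0 < s -> measurable_fun [set: n.-tuple T] (fun y => p (rv_of_tuple y)) ->
  (forall y, 0 <= p y) -> 0 < rho -> 0 <= m ->
  (forall y, box n rho y -> m <= \sum_(k < N) p (h *+ k.+1 + rv_of_tuple y)) ->
  (forall y (k : 'I_N), box n rho y -> 0 < euclid (h *+ k.+1 + rv_of_tuple y) <= r) ->
  ((m / r `^ (n%:R + 2 * s) * (2 * rho) ^+ n)%:E <=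
    N%:R%:E * \int[nu]_y (p (rv_of_tuple y) * space_kernel (rv_of_tuple y))%:E)%E.
Proof.
move=> s0 mp p0 rho0 m0 sum_ge near_r.
have e0 : 0 < n%:R + 2 * s by rewrite ltr_wpDl// mulr_gt0.
have sk0 (y : 'rV[R]_n) : 0 <= space_kernel y by rewrite invr_ge0 powR_ge0.
rewrite EFinM -(lebesgue_box n rho0).
apply: (@telescope _ _ _ nu (fun k => tuple_affine false (h *+ k.+1))) => //.
- by move=> k; exact: measure_preserving_tuple_affine.
- by apply/measurable_EFinP/measurable_funM => //; exact: measurable_space_kernel.
- by move=> y; rewrite lee_fin mulr_ge0.
- exact: measurable_box.
- by rewrite divr_ge0// powR_ge0.
move=> y yrho; rewrite sumEFin lee_fin.
apply: (@le_trans _ _ (\sum_(k < N) p (h *+ k.+1 + rv_of_tuple y) / r `^ (n%:R + 2 * s))).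
  by rewrite -mulr_suml ler_wpM2r ?invr_ge0 ?powR_ge0// sum_ge.
apply: ler_sum => k _; rewrite !tuple_affineE ler_wpM2l//.
(* Positivity matters: at the origin the kernel takes the value [0^-1 = 0], below the claimed
   bound. *)
have /andP[y0 yr] := near_r y k yrho.
rewrite lef_pV2 ?posrE ?powR_gt0//; last exact: lt_le_trans yr.
apply: ge0_ler_powR => //; rewrite ?nnegrE ?(ltW e0) ?(ltW y0)//.
exact: le_trans (ltW y0) yr.
Qed.

Lemma telescope_time (p : R -> R) (N : nat) (h m : R) :
  0 < alpha -> measurable_fun (`]0%R, +oo[%classic : set T) (p : T -> T) ->
  (forall r, 0 < r -> 0 <= p r) -> 0 < h -> 0 <= m ->
  (forall r, 0 < r < h -> m <= \sum_(k < N) p (h *+ k.+1 + r)) ->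
  ((m / (h *+ N.+1) `^ (1 + alpha) * h)%:E <=
    N%:R%:E * \int[mu]_(r in `]0%R, +oo[) (p r * time_kernel r)%:E)%E.
Proof.
move=> a0 mp p0 h0 m0 sum_ge.
have e0 : 0 < 1 + alpha by rewrite addr_gt0.
have tk0 (r : R) : 0 <= time_kernel r by rewrite invr_ge0 powR_ge0.
(* Translations do not preserve the half-line, so the integrand is extended by 0 to the whole
   line. *)
rewrite integral_mkcond.
have -> : (m / (h *+ N.+1) `^ (1 + alpha) * h)%:E =
    ((m / (h *+ N.+1) `^ (1 + alpha))%:E * mu `]0%R, h[%classic)%E.
  by rewrite lebesgue_measure_itv/= lte_fin h0 -EFinB subr0.
apply: (@telescope _ _ _ mu (fun k => affine false (h *+ k.+1))) => //.
- by move=> k; exact: measure_preserving_affine.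
- apply/(measurable_restrictT _ _).1 => //.
  by apply/measurable_EFinP/measurable_funM => //; exact: measurable_time_kernel.
- move=> r; rewrite patchE; case: ifP => //; rewrite inE/= in_itv/= andbT => r0.
  by rewrite lee_fin mulr_ge0// p0.
- by rewrite divr_ge0// powR_ge0.
move=> r; rewrite /= in_itv/= => rh; have /andP[r0 rh'] := rh.
have pos (k : nat) : 0 < h *+ k.+1 + r by rewrite addr_gt0// mulrn_wgt0.
rewrite (eq_bigr (fun k : 'I_N =>
  (p (h *+ k.+1 + r) * time_kernel (h *+ k.+1 + r))%:E)); last first.
  by move=> k _; rewrite patchE mem_set//= in_itv/= andbT.
rewrite sumEFin lee_fin.
apply: (@le_trans _ _ (\sum_(k < N) p (h *+ k.+1 + r) / (h *+ N.+1) `^ (1 + alpha))).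
  by rewrite -mulr_suml ler_wpM2r ?invr_ge0 ?powR_ge0// sum_ge.
apply: ler_sum => k _; rewrite ler_wpM2l ?p0//.
have hN : 0 < h *+ N.+1 by rewrite mulrn_wgt0.
rewrite lef_pV2 ?posrE ?powR_gt0//.
apply: ge0_ler_powR; rewrite ?nnegrE ?(ltW e0) ?(ltW hN) ?(ltW (pos _))//.
apply: (@le_trans _ _ (h *+ k.+2)); first by rewrite [leRHS]mulrSr lerD2l ltW.
by rewrite ler_pMn2l// ltnS ltn_ord.
Qed.

End telescope_kernels.

(** * Penalised maxima and contact points *)

Section touching_from_above.
Context {R : realType} (n : nat) (alpha s : R).
Hypotheses (alpha01 : 0 < alpha < 1) (s01 : 0 < s < 1).
Local Notation rs := (rs s).
Local Notation rt := (rt alpha).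
Implicit Types (u v w : 'rV[R]_n -> R -> R) (x y h : 'rV[R]_n) (t tau r l : R).

Lemma continuous_euclid_dist x : continuous (fun y => euclid (y - x)).
Proof.
move=> y; apply/continuous_atP => e e0.
have [r r0 rP] := (continuous_atP _ _).1 (@continuous_euclid R n (y - x)) e e0.
exists r => // z yz; apply: rP.
by rewrite opprB addrA subrK.
Qed.

Definition jointly_continuous_at u x t : Prop :=
  forall e : R, 0 < e -> exists2 r : R, 0 < r & forall y tau,
    euclid (y - x) < r -> `|tau - t| < r -> `|u y tau - u x t| < e.

Lemma jointly_continuous_atP u x t : jointly_continuous_at u x t ->
  {for (x, t), continuous (fun p : 'rV[R]_n * R => u p.1 p.2)}.
Proof.
move=> cu; apply/continuous_atP => e /cu[r r0 rP].
have n0 : 0 < n.+1%:R :> R by [].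
exists (r / n.+1%:R) => [|[y tau]]; first by rewrite divr_gt0.
rewrite ltr_pdivlMr// prod_normE /= => xyr; rewrite distrC; apply: rP.
- rewrite euclidB; apply: le_lt_trans (euclid_le_norm _) _; apply: le_lt_trans xyr.
  rewrite mulrC; apply: ler_pM => //; first by rewrite le_max lexx.
  by rewrite ler_nat.
- rewrite distrC; apply: le_lt_trans xyr; rewrite -[leLHS]mulr1.
  by apply: ler_pM => //; rewrite ?le_max ?lexx ?orbT// ler1n.
Qed.

Definition penalty x0 t0 l y tau : R :=
  (euclid (y - x0) / rs l) ^+ 2 + ((tau - t0) / rt l) ^+ 2.

Lemma penalty_ge0 x0 t0 l y tau : 0 <= penalty x0 t0 l y tau.
Proof. by rewrite addr_ge0 ?sqr_ge0. Qed.

Lemma penalty_center x0 t0 l : penalty x0 t0 l x0 t0 = 0.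
Proof. by rewrite /penalty !subrr euclid0 !mul0r expr0n addr0. Qed.

Lemma penalty_gt1 x0 t0 l y tau : 0 < l ->
  ~~ ((euclid (y - x0) <= rs l) && (`|tau - t0| <= rt l)) ->
  1 < penalty x0 t0 l y tau.
Proof.
move=> l0; rewrite negb_and -!ltNge => /orP[yl|tl].
  apply: (@lt_le_trans _ _ ((euclid (y - x0) / rs l) ^+ 2)); last by rewrite lerDl sqr_ge0.
  by rewrite exprn_egt1// ltr_pdivlMr ?mul1r// rs_gt0.
apply: (@lt_le_trans _ _ (((tau - t0) / rt l) ^+ 2)); last by rewrite lerDr sqr_ge0.
rewrite -real_normK ?num_real// exprn_egt1// normrM [X in _ * X]gtr0_norm ?invr_gt0 ?rt_gt0//.
by rewrite ltr_pdivlMr ?mul1r// rt_gt0.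
Qed.

(** Parallelogram law: the second difference of the squared norm does not depend on the base point,
    so the contact point may lie anywhere in the box. *)
Lemma penalty_sym x0 t0 l x1 t1 y :
  penalty x0 t0 l (x1 + y) t1 + penalty x0 t0 l (x1 - y) t1 -
  2 * penalty x0 t0 l x1 t1 = 2 * (euclid y / rs l) ^+ 2.
Proof.
rewrite /penalty !exprMn !sqr_euclid.
rewrite [x1 + y - x0]addrAC [x1 - y - x0]addrAC.
have -> : sqnorm (x1 - x0 - y) = 2 * sqnorm (x1 - x0) + 2 * sqnorm y - sqnorm (x1 - x0 + y).
  by rewrite -sqnorm_parallelogram; ring.
by ring.
Qed.

(** The numerator is [r^2 - 2 r (t1 - t0)], with [r] and [|t1 - t0|] at most [rt l]: hence
    [1 + 2 = 3]. *)
Lemma penalty_past x0 t0 l x1 t1 r : 0 < l -> `|t1 - t0| <= rt l -> 0 <= r <= rt l ->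
  penalty x0 t0 l x1 (t1 - r) - penalty x0 t0 l x1 t1 <= 3 * (r / rt l).
Proof.
move=> l0; have tl := rt_gt0 alpha l0; rewrite ler_norml => /andP[t1l t1u] /andP[r0 rl].
rewrite /penalty opprD addrACA subrr add0r !exprMn -mulrBl.
rewrite exprVn ler_pdivrMr ?exprn_gt0//.
have -> : 3 * (r / rt l) * rt l ^+ 2 = 3 * r * rt l by field; rewrite gt_eqF.
have : 0 <= r * (rt l - r) by rewrite mulr_ge0// subr_ge0.
have : 0 <= r * (rt l + (t1 - t0)) by rewrite mulr_ge0//; lra.
by move: (rt l) => L h1 h2; nra.
Qed.

Lemma compact_euclid_ball x0 (a : R) : compact [set y | euclid (y - x0) <= a].
Proof.
apply: bounded_closed_compact.
  exists (`|x0| + a); split; first exact: num_real.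
  move=> M Mlt y /= yl; apply: ltW; apply: le_lt_trans Mlt.
  rewrite -[y](subrKC x0); apply: le_trans (ler_normD _ _) _.
  by rewrite lerD2l; exact: le_trans (norm_le_euclid _) yl.
rewrite (_ : [set y | _] = (fun y : 'rV[R]_n => euclid (y - x0)) @^-1` [set z | z <= a])//.
apply: closed_comp; last exact: closed_le.
by move=> y _; exact: continuous_euclid_dist.
Qed.

Lemma compact_cylinder x0 t0 (a b : R) :
  compact ([set y | euclid (y - x0) <= a] `*` `[t0 - b, t0 + b]%classic : set ('rV[R]_n * R)).
Proof. by apply: compact_setX; [exact: compact_euclid_ball|exact: segment_compact]. Qed.

(** Compactness gives the maximum over the cylinder only; points outside are compared by means of
    [penalty_gt1]. *)
Lemma penalized_max w x0 t0 l (K : R) : 0 < l ->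
  (forall y tau, euclid (y - x0) <= rs l -> `|tau - t0| <= rt l ->
    jointly_continuous_at w y tau) ->
  exists x1 t1, [/\ euclid (x1 - x0) <= rs l, `|t1 - t0| <= rt l &
    forall y tau, euclid (y - x0) <= rs l -> `|tau - t0| <= rt l ->
      w y tau - K * penalty x0 t0 l y tau <= w x1 t1 - K * penalty x0 t0 l x1 t1].
Proof.
move=> l0 cw.
pose A : set ('rV[R]_n * R) :=
  [set y | euclid (y - x0) <= rs l] `*` `[t0 - rt l, t0 + rt l]%classic.
have AP y tau : A (y, tau) <-> euclid (y - x0) <= rs l /\ `|tau - t0| <= rt l.
  by rewrite /A/= in_itv/= ler_distl.
have cA : compact A by exact: compact_cylinder.
have A0 : A !=set0.
  exists (x0, t0); apply/AP; rewrite !subrr euclid0 normr0.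
  by split; apply: ltW; [exact: rs_gt0|exact: rt_gt0].
pose g (p : 'rV[R]_n * R) := w p.1 p.2 - K * penalty x0 t0 l p.1 p.2.
have cg : {within A, continuous g}.
  apply: continuous_in_subspaceT => -[y tau]; rewrite inE => /AP[yl tl].
  rewrite /g; apply: cvgB; first exact: (jointly_continuous_atP (cw _ _ yl tl)).
  apply: cvgM; first exact: cvg_cst.
  rewrite /penalty; apply: cvgD.
    apply: (@continuous_comp _ _ _ (fun p : 'rV[R]_n * R => euclid (p.1 - x0) / rs l)
      (fun z => z ^+ 2));
      last exact: exprn_continuous.
    apply: cvgM; last exact: cvg_cst.
    apply: (@continuous_comp _ _ _ fst (fun z : 'rV[R]_n => euclid (z - x0))).
      exact: cvg_fst.
    exact: continuous_euclid_dist.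
  apply: (@continuous_comp _ _ _ (fun p : 'rV[R]_n * R => (p.2 - t0) / rt l) (fun z => z ^+ 2));
    last exact: exprn_continuous.
  apply: cvgM; last exact: cvg_cst.
  by apply: cvgB; [exact: cvg_snd|exact: cvg_cst].
have [[x1 t1]] := compact_EVT_max A0 cA cg; rewrite inE => /AP[xl tl] gmax.
exists x1, t1; split => // y tau yl tl'.
by apply: (gmax (y, tau)); rewrite inE; apply/AP.
Qed.

(** Inside the box of order [l0] increments are controlled by the penalty, capped at [K]; beyond it
    only the bound [F] remains, taken twice in a second difference. The factor 3 is that of
    [penalty_past]; space would give 2. *)
Lemma max_touch w x0 t0 x1 t1 (K F : R) l l0 :
  0 <= K -> 0 <= F -> 0 < l -> 0 < l0 -> `|t1 - t0| <= rt l ->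
  (forall y, euclid y < rs l0 -> w (x1 + y) t1 - w x1 t1 <=
     Num.min K (K * (penalty x0 t0 l (x1 + y) t1 - penalty x0 t0 l x1 t1))) ->
  (forall r, 0 < r < rt l0 -> w x1 (t1 - r) - w x1 t1 <=
     Num.min K (K * (penalty x0 t0 l x1 (t1 - r) - penalty x0 t0 l x1 t1))) ->
  (forall y tau, w y tau - w x1 t1 <= F) ->
  (forall y, - (3 * K * sdamp s l y + 2 * F * sdamp s l0 y) <= sym_diff w x1 t1 y) /\
  (forall r, 0 < r -> - (3 * K * tdamp alpha l r + 2 * F * tdamp alpha l0 r) <=
     past_diff w x1 t1 r).
Proof.
move=> K0 F0 l_gt0 l0_gt0 t1l near_space near_time far; split.
- move=> y.
  have K1 : 0 <= 3 * K * sdamp s l y by rewrite !mulr_ge0// sdamp_ge0.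
  have K2 : 0 <= 2 * F * sdamp s l0 y by rewrite !mulr_ge0// sdamp_ge0.
  have [yl|ly] := ltP (euclid y) (rs l0); last first.
    have E : sdamp s l0 y = 1.
      apply/min_idPr; rewrite exprn_ege1// ler_pdivlMr ?rs_gt0//; last by rewrite mul1r.
    have := far (x1 + y) t1; have := far (x1 - y) t1; rewrite /sym_diff.
    by move: K1; rewrite E; lra.
  have := near_space y yl; have := near_space (- y); rewrite euclidN => /(_ yl).
  rewrite !le_min => /andP[m1 m2] /andP[p1 p2].
  have E := penalty_sym x0 t0 l x1 t1 y.
  suff : - (3 * K * sdamp s l y) <= sym_diff w x1 t1 y by lra.
  move: m2 p2 E; set p := penalty _ _ _ (x1 + y) t1; set m := penalty _ _ _ (x1 - y) t1.
  set c := penalty _ _ _ x1 t1; rewrite /sdamp /sym_diff; set z := _ ^+ 2 => m2 p2 E.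
  have z0 : 0 <= z by exact: sqr_ge0.
  have [z1|z1] := leP z 1.
    have Kz : 0 <= K * z by rewrite mulr_ge0.
    have : K * (p + m - 2 * c) = 2 * (K * z) by rewrite E; ring.
    by lra.
  by lra.
- move=> r r0.
  have K1 : 0 <= 3 * K * tdamp alpha l r by rewrite !mulr_ge0// tdamp_ge0// ltW.
  have K2 : 0 <= 2 * F * tdamp alpha l0 r by rewrite !mulr_ge0// tdamp_ge0// ltW.
  have [rl|lr] := ltP r (rt l0); last first.
    have E : tdamp alpha l0 r = 1.
      by apply/min_idPr; rewrite ler_pdivlMr ?rt_gt0// mul1r.
    by have := far x1 (t1 - r); rewrite /past_diff; move: K1; rewrite E; lra.
  have := near_time r; rewrite r0 rl => /(_ isT); rewrite le_min => /andP[m1 m2].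
  suff : - (3 * K * tdamp alpha l r) <= past_diff w x1 t1 r by lra.
  rewrite /tdamp /past_diff.
  have [z1|z1] := leP (r / rt l) 1; last by lra.
  have rl' : 0 <= r <= rt l by rewrite (ltW r0)/=; move: z1; rewrite ler_pdivrMr ?rt_gt0// mul1r.
  have := penalty_past x0 x1 l_gt0 t1l rl'.
  move: m2; set c := penalty _ _ _ x1 t1; set c' := penalty _ _ _ _ (t1 - r).
  move: (r / rt l) => z m2 H.
  have : 0 <= K * (3 * z - (c' - c)) by rewrite mulr_ge0// subr_ge0.
  by lra.
Qed.

End touching_from_above.

Section modulus.
Context {R : realType} (n : nat) (alpha s c1 c2 : R).
Hypotheses (alpha01 : 0 < alpha < 1) (s01 : 0 < s < 1).
Hypotheses (c1_gt0 : 0 < c1) (c2_gt0 : 0 < c2).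
Local Notation T := (measurableTypeR R).
Local Notation rs := (rs s).
Local Notation rt := (rt alpha).
Local Notation reduced_eqn := (reduced_eqn alpha s c1 c2).
Implicit Types (u v w : 'rV[R]_n -> R -> R) (x y h : 'rV[R]_n) (t tau r l e M : R).

Let s2 : 0 < 2 * s. Proof. by case/andP : s01 => ? _; rewrite mulr_gt0. Qed.

Definition solution M u : Prop :=
  [/\ forall x t, `|u x t| <= M, forall t, continuous (fun x => u x t),
      forall x, continuous (u x) & forall x t, reduced_eqn u x t].

(** The three base points may differ, so linearity and translation invariance are obtained
    together. *)
Lemma reduced_eqnB v v1 v2 x x1 x2 t t1 t2 :
  (forall r, past_diff v x t r = past_diff v1 x1 t1 r - past_diff v2 x2 t2 r) ->
  (forall y, sym_diff v x t y = sym_diff v1 x1 t1 y - sym_diff v2 x2 t2 y) ->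
  reduced_eqn v1 x1 t1 -> reduced_eqn v2 x2 t2 -> reduced_eqn v x t.
Proof.
move=> pE sE [p1 s1 E1] [p2 s2' E2].
have pE' : (fun r : T => (past_diff v x t r * (r `^ (1 + alpha))^-1)%:E) =
    ((fun r : T => (past_diff v1 x1 t1 r * (r `^ (1 + alpha))^-1)%:E) \-
     (fun r : T => (past_diff v2 x2 t2 r * (r `^ (1 + alpha))^-1)%:E))%E.
  by apply/funext => r /=; rewrite pE mulrBl EFinB.
have sE' : (fun z : n.-tuple T => (sym_diff v x t (rv_of_tuple z) *
      (euclid (rv_of_tuple z) `^ (n%:R + 2 * s))^-1)%:E) =
    ((fun z : n.-tuple T => (sym_diff v1 x1 t1 (rv_of_tuple z) *
      (euclid (rv_of_tuple z) `^ (n%:R + 2 * s))^-1)%:E) \-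
     (fun z : n.-tuple T => (sym_diff v2 x2 t2 (rv_of_tuple z) *
      (euclid (rv_of_tuple z) `^ (n%:R + 2 * s))^-1)%:E))%E.
  by apply/funext => r /=; rewrite sE mulrBl EFinB.
split.
- by rewrite pE'; exact: integrableB.
- by rewrite sE'; exact: integrableB.
- under eq_Rintegral do rewrite pE mulrBl.
  rewrite RintegralB//.
  under [X in _ + _ * X]eq_Rintegral do rewrite sE mulrBl.
  rewrite RintegralB//.
  rewrite !mulrBr addrACA E1 -opprD E2 subr0//.
Qed.

Lemma reduced_eqn0 x t : reduced_eqn (fun _ _ => 0) x t.
Proof.
split.
- apply: (eq_integrable _ (cst 0%E)) => //; last exact: integrable0.
  by move=> r _; rewrite /past_diff subrr mul0r.
- apply: (eq_integrable _ (cst 0%E)) => //; last exact: integrable0.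
  by move=> z _; rewrite /sym_diff mulr0 !subrr mul0r.
- under eq_Rintegral do rewrite /past_diff subrr mul0r.
  under [X in _ + _ * X]eq_Rintegral do rewrite /sym_diff mulr0 !subrr mul0r.
  by rewrite !Rintegral_cst// !mul0r !mulr0 addr0.
Qed.

Lemma solutionN M u : solution M u -> solution M (fun x t => - u x t).
Proof.
move=> [bu cx ct eqn]; split.
- by move=> x t; rewrite normrN.
- by move=> t x; apply: continuousN; exact: cx.
- by move=> x t; apply: continuousN; exact: ct.
- move=> x t; apply: (reduced_eqnB _ _ (reduced_eqn0 x t) (eqn x t)).
  + by move=> r; rewrite /past_diff; ring.
  + by move=> y; rewrite /sym_diff; ring.
Qed.

Lemma jointly_continuousN u x t : jointly_continuous_at u x t ->
  jointly_continuous_at (fun x t => - u x t) x t.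
Proof.
move=> cu e /cu[r r0 rP]; exists r => // y tau yr tr.
by rewrite opprK addrC distrC; exact: rP.
Qed.

Lemma euclidMn h k : euclid (h *+ k) = k%:R * euclid h.
Proof. by rewrite -scaler_nat euclidZ normr_nat. Qed.

Lemma measurable_sym_diff w x t : continuous (fun y => w y t) ->
  measurable_fun [set: n.-tuple T] (fun z => sym_diff w x t (rv_of_tuple z)).
Proof.
move=> cw.
have mw (b : bool) : measurable_fun [set: n.-tuple T]
    (fun z => w (if b then x - rv_of_tuple z else x + rv_of_tuple z) t).
  rewrite (_ : (fun z => _) =
    ((fun y => w y t) \o @rv_of_tuple R n) \o tuple_affine b x); last first.
    by apply/funext => z /=; rewrite tuple_affineE.
  apply: measurableT_comp; last exact: measurable_tuple_affine.
  exact: continuous_rv_of_tuple_measurable.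
apply: measurable_funB; last exact: (mw true).
by apply: measurable_funB => //; exact: (mw false).
Qed.

Lemma measurable_past_diff w x t D : continuous (w x) ->
  measurable_fun D (past_diff w x t : T -> T).
Proof.
move=> cw; apply: measurable_funB => //; apply: measurable_funTS.
apply: (@measurableT_comp _ _ _ _ _ _ (w x : T -> T)).
  exact: continuous_measurable_fun.
exact: measurable_funB.
Qed.

(** The weight [4 * M] bounds the oscillation of [w], so no point outside the cylinder beats the
    contact point. The costs are [12 M = 3 * (4 M)] and [4 M = 2 * (2 M)]: as [w] is positive at the
    contact point, no increment from it exceeds [2 M]. *)
Lemma global_touch w x0 t0 M l : 0 < l -> 0 <= M ->
  (forall x t, `|w x t| <= 2 * M) ->
  (forall y tau, euclid (y - x0) <= rs l -> `|tau - t0| <= rt l ->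
    jointly_continuous_at w y tau) ->
  0 < w x0 t0 ->
  exists x1 t1, [/\ w x0 t0 <= w x1 t1,
    forall y, - (12 * M * sdamp s l y + 4 * M * sdamp s l y) <= sym_diff w x1 t1 y &
    forall r, 0 < r ->
      - (12 * M * tdamp alpha l r + 4 * M * tdamp alpha l r) <= past_diff w x1 t1 r].
Proof.
move=> l0 M0 bw cw w0.
have [x1 [t1 [x1l t1l wmax]]] := penalized_max (4 * M) l0 cw.
have wle x t : w x t <= 2 * M by exact: le_trans (ler_norm _) (bw x t).
have center : w x0 t0 <= w x1 t1 - 4 * M * penalty alpha s x0 t0 l x1 t1.
  have := wmax x0 t0; rewrite !subrr euclid0 normr0 penalty_center mulr0 subr0.
  by apply; [exact/ltW/rs_gt0|exact/ltW/rt_gt0].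
have M4 : 0 <= 4 * M by rewrite mulr_ge0.
have P1 : 0 <= 4 * M * penalty alpha s x0 t0 l x1 t1 by rewrite mulr_ge0// penalty_ge0.
have w1 : w x0 t0 <= w x1 t1 by lra.
have all y tau : w y tau - w x1 t1 <= Num.min (4 * M)
    (4 * M * (penalty alpha s x0 t0 l y tau - penalty alpha s x0 t0 l x1 t1)).
  rewrite le_min; apply/andP; split; first by have := wle y tau; lra.
  rewrite mulrBr; have [/andP[yl tl]|out] :=
    boolP ((euclid (y - x0) <= rs l) && (`|tau - t0| <= rt l)).
    by have := wmax y tau yl tl; lra.
  have p1 := penalty_gt1 l0 out.
  have : 4 * M <= 4 * M * penalty alpha s x0 t0 l y tau by rewrite ler_peMr// ltW.
  by have := wle y tau; lra.
exists x1, t1; have M2 : 0 <= 2 * M by rewrite mulr_ge0.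
have [|||S D] := @max_touch _ n alpha s w x0 t0 x1 t1 (4 * M) (2 * M) l l
  M4 M2 l0 l0 t1l.
- by move=> y _; exact: all.
- by move=> r _; exact: all.
- by move=> y tau; have := wle y tau; lra.
split => //.
- by move=> y; have := S y; rewrite !mulrA; congr (- (_ + _) <= _); congr (_ * _); ring.
- by move=> r r0; have := D r r0; rewrite !mulrA; congr (- (_ + _) <= _); congr (_ * _); ring.
Qed.

Lemma jointly_continuous_sub u v h t x tau :
  jointly_continuous_at u (x + h) (tau + t) -> jointly_continuous_at v x tau ->
  jointly_continuous_at (fun x tau => u (x + h) (tau + t) - v x tau) x tau.
Proof.
move=> cu cv e e0; have e2 : 0 < e / 2 by rewrite divr_gt0.
have [r1 r10 P1] := cu _ e2; have [r2 r20 P2] := cv _ e2.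
exists (Num.min r1 r2) => [|y sig]; first by rewrite lt_min r10.
rewrite !lt_min => /andP[y1 y2] /andP[t1 t2].
have E1 : y + h - (x + h) = y - x by rewrite opprD addrACA subrr addr0.
have E2 : sig + t - (tau + t) = sig - tau by ring.
have := P1 (y + h) (sig + t); rewrite E1 E2 => /(_ y1 t1) h1.
have h2' := P2 y sig y2 t2.
rewrite (_ : _ - _ = (u (y + h) (sig + t) - u (x + h) (tau + t)) - (v y sig - v x tau));
  last by ring.
by apply: le_lt_trans (ler_normB _ _) _; rewrite [ltRHS]splitr ltrD.
Qed.

End modulus.

Section modulus_of_continuity.
Context {R : realType} (n : nat) (alpha s c1 c2 : R).
Hypotheses (alpha01 : 0 < alpha < 1) (s01 : 0 < s < 1).
Hypotheses (c1_gt0 : 0 < c1) (c2_gt0 : 0 < c2).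
Local Notation T := (measurableTypeR R).
Local Notation rs := (rs s).
Local Notation rt := (rt alpha).
Local Notation solution := (@solution R n alpha s c1 c2).
Implicit Types (u v w : 'rV[R]_n -> R -> R) (x y h : 'rV[R]_n) (t tau r l e M : R).

Let s2 : 0 < 2 * s. Proof. by case/andP : s01 => ? _; rewrite mulr_gt0. Qed.
Let a0 : 0 < alpha. Proof. by case/andP : alpha01. Qed.

(** So many translates beat the boundary terms of the telescoping sums: [2 N e - 4 M >= N e] in
    space and [N e - 2 M >= N e / 2] in time. *)
Lemma archimedean_steps M e : 0 < e -> exists2 N : nat, (0 < N)%N & 4 * M < N%:R * e.
Proof.
move=> e0; exists (Num.truncn (4 * M / e)).+1 => //.
by rewrite -ltr_pdivrMr// truncnS_gt.
Qed.

(* A choice of scale making a gain of order [g] exceed a cost of order [D]. *)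
Lemma scale_choice (D g : R) : 0 <= D -> 0 < g -> exists2 kap : R, 0 < kap <= 1 &
  forall a l : R, 0 < a -> 0 < l -> a <= kap * l -> ~ g / a <= D / l.
Proof.
move=> D0 g0; exists (Num.min 1 (g / (D + 1))).
  by rewrite lt_min ltr01 divr_gt0 ?ltr_wpDl//= ge_min lexx.
move=> a l a_gt0 l0 al H.
have {}al : a <= g / (D + 1) * l.
  by apply: le_trans al _; rewrite ler_wpM2r ?(ltW l0)// ge_min lexx orbT.
have D1 : 0 < D + 1 by rewrite ltr_wpDl.
move: H; rewrite ler_pdivrMr// mulrAC ler_pdivlMr// => H.
move: al; rewrite mulrAC ler_pdivlMr// => al.
have : D * a <= a * (D + 1) by lra.
by nra.
Qed.

Lemma continuous_increment u h t : (forall t, continuous (fun y => u y t)) ->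
  continuous (fun y => u (y + h) (t + 0) - u y t).
Proof.
move=> cu y; apply/continuous_atP => e e0; have e2 : 0 < e / 2 by rewrite divr_gt0.
have [r1 r10 P1] := (continuous_atP _ _).1 (cu (t + 0) (y + h)) _ e2.
have [r2 r20 P2] := (continuous_atP _ _).1 (cu t y) _ e2.
exists (Num.min r1 r2) => [|z]; first by rewrite lt_min r10.
rewrite lt_min => /andP[z1 z2]; have h2 := P2 z z2.
have h1 : `|u (y + h) (t + 0) - u (z + h) (t + 0)| < e / 2.
  by apply: P1; rewrite opprD addrACA subrr addr0.
rewrite (_ : _ - _ = (u (y + h) (t + 0) - u (z + h) (t + 0)) - (u y t - u z t));
  last by ring.
by apply: le_lt_trans (ler_normB _ _) _; rewrite [ltRHS]splitr ltrD.
Qed.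

(** The doubled radius leaves room for the shift by [h], whose length is at most [rs l] because
    [kap <= 1]. *)
Lemma space_increment M e : 0 <= M -> 0 < e -> exists2 kap : R, 0 < kap <= 1 &
  forall u l x0 t0 h, solution M u -> 0 < l ->
    (forall y tau, euclid (y - x0) <= 2 * rs l -> `|tau - t0| <= 2 * rt l ->
      jointly_continuous_at u y tau) ->
    euclid h <= rs (kap * l) -> u (x0 + h) t0 - u x0 t0 <= e.
Proof.
move=> M0 e0; have [C C0 CP] := touching n alpha01 s01 c1_gt0 c2_gt0.
have [N N0 NM] := archimedean_steps M e0.
have NR : 0 < N%:R :> R by rewrite ltr0n.
(* The gain is [gam / |h|^(2s)]: per translate, height [e], kernel at distance at most
   [(N + 1) |h|], and a box of volume [(|h| / (n + 1))^n]. *)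
pose gam : R := e / (N.+1%:R `^ (n%:R + 2 * s) * n.+1%:R ^+ n).
have gam0 : 0 < gam by rewrite divr_gt0// mulr_gt0 ?powR_gt0 ?exprn_gt0.
have D0 : 0 <= C * (16 * M) by rewrite !mulr_ge0.
have [kap /andP[kap0 kap1] kapP] := scale_choice D0 gam0.
exists kap => [|u l x0 t0 h [bu cx ct eqn] l0 cu hl]; first by rewrite kap0.
rewrite leNgt; apply/negP => Ae.
(* The idle [+ 0] gives space and time increments a common form for [jointly_continuous_sub]. *)
pose w x t := u (x + h) (t + 0) - u x t.
have w00 : e < w x0 t0 by rewrite /w addr0.
have [h0|h0] := eqVneq (euclid h) 0.
  by move: Ae; rewrite (euclid_eq0 h0) addr0 subrr ltNge ltW.
have {}h0 : 0 < euclid h by rewrite lt_def h0 euclid_ge0.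
have kl : 0 < kap * l by rewrite mulr_gt0.
have hl' : euclid h <= rs l.
  by apply: le_trans hl _; apply: le_rs => //; [exact: ltW|rewrite ger_pMl].
have hs : euclid h `^ (2 * s) <= kap * l.
  rewrite -[leRHS](rsK s01 (ltW kl)).
  by apply: ge0_ler_powR; rewrite ?nnegrE ?(ltW s2) ?euclid_ge0 ?powR_ge0.
have cw t : continuous (fun y => w y t).
  exact: continuous_increment.
have bw x t : `|w x t| <= 2 * M.
  apply: le_trans (ler_normB _ _) _.
  by have := bu (x + h) (t + 0); have := bu x t; lra.
have eqw x t : reduced_eqn alpha s c1 c2 w x t.
  apply: (reduced_eqnB _ _ (eqn (x + h) t) (eqn x t)).
  - by move=> r; rewrite /past_diff /w !addr0; ring.
  - move=> y; rewrite /sym_diff /w !addr0.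
    by rewrite [x + y + h]addrAC [x - y + h]addrAC; ring.
have [|x1 [t1 [x1P S D]]] := global_touch (alpha := alpha) (s := s) l0 M0 bw _ (lt_trans e0 w00).
  move=> y tau yl tl; apply: jointly_continuous_sub; last first.
    by apply: cu; [have := rs_gt0 s l0|have := rt_gt0 alpha l0]; lra.
  rewrite addr0; apply: cu; last by have := rt_gt0 alpha l0; lra.
  rewrite addrAC; apply: le_trans (euclid_triangle _ _) _; lra.
have M12 : 0 <= 12 * M by rewrite mulr_ge0.
have M4 : 0 <= 4 * M by rewrite mulr_ge0.
have [cost _] := CP w x1 t1 _ _ l l (eqw x1 t1) M12 M4 l0 l0 S D.
pose p y := sym_diff w x1 t1 y + (12 * M * sdamp s l y + 4 * M * sdamp s l y).
have p0 y : 0 <= p y by have := S y; rewrite /p; lra.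
have n10 : 0 < n.+1%:R :> R by [].
(* With this half side the box lies in the ball of radius [|h| / 2], so its translates by
   [h, ..., N h] avoid the origin and stay within [(N + 1) |h|]. *)
have rho0 : 0 < euclid h / (2 * n.+1%:R) by rewrite divr_gt0// mulr_gt0.
have small z : box n (euclid h / (2 * n.+1%:R)) z -> euclid (rv_of_tuple z) <= euclid h / 2.
  move=> /(box_euclid rho0) /le_trans; apply.
  have -> : n%:R * (euclid h / (2 * n.+1%:R)) = euclid h / 2 * (n%:R / n.+1%:R).
    by field; rewrite gt_eqF.
  by rewrite ler_piMr ?divr_ge0 ?(ltW h0)// ler_pdivrMr// mul1r ler_nat.
have near_r (z : n.-tuple T) (k : 'I_N) : box n (euclid h / (2 * n.+1%:R)) z ->
    0 < euclid (h *+ k.+1 + rv_of_tuple z) <= N.+1%:R * euclid h.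
  move=> /small zh; have kh := euclidMn h k.+1.
  have k1 : 1 <= k.+1%:R :> R by rewrite ler1n.
  have kN : k.+1%:R <= N%:R :> R by rewrite ler_nat ltn_ord.
  have kh1 : euclid h <= k.+1%:R * euclid h by rewrite ler_peMl// ltW.
  have kh2 : k.+1%:R * euclid h <= N%:R * euclid h by rewrite ler_wpM2r// ltW.
  apply/andP; split.
    have := euclid_triangle (h *+ k.+1 + rv_of_tuple z) (- rv_of_tuple z).
    by rewrite addrK kh euclidN; lra.
  apply: le_trans (euclid_triangle _ _) _; rewrite kh -natr1 mulrDl mul1r; lra.
have sums (z : n.-tuple T) : box n (euclid h / (2 * n.+1%:R)) z ->
    N%:R * e <= \sum_(k < N) p (h *+ k.+1 + rv_of_tuple z).
  move=> _; set y := rv_of_tuple z.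
  apply: (@le_trans _ _ (\sum_(k < N) sym_diff w x1 t1 (h *+ k.+1 + y))); last first.
    apply: ler_sum => k _; rewrite lerDl addr_ge0// mulr_ge0// sdamp_ge0//.
  (* The shift equals the increment defining [w], so both sums telescope and only four values of [u]
     survive. *)
  have fwd : \sum_(k < N) w (x1 + (h *+ k.+1 + y)) t1 =
      u (x1 + y + h *+ N.+1) t1 - u (x1 + y + h) t1.
    have := @telescope_sumr R 0 N (fun k => u (x1 + y + h *+ k.+1) t1) (leq0n _).
    rewrite mulr1n big_mkord => <-; apply: eq_bigr => k _; rewrite /w addr0.
    rewrite [h *+ k.+1 + y]addrC addrA; congr (u _ _ - _).
    by rewrite [h *+ k.+2]mulrSr [RHS]addrA.
  have bwd : \sum_(k < N) w (x1 - (h *+ k.+1 + y)) t1 =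
      u (x1 - y) t1 - u (x1 - y - h *+ N) t1.
    have := @telescope_sumr R 0 N (fun k => - u (x1 - y - h *+ k) t1) (leq0n _).
    rewrite mulr0n subr0 opprK big_mkord => E; rewrite [RHS]addrC -E.
    apply: eq_bigr => k _; rewrite /w addr0 opprK [RHS]addrC.
    rewrite [h *+ k.+1 + y]addrC opprD addrA; congr (u _ _ - _).
    by rewrite mulrSr opprD addrA subrK.
  rewrite /sym_diff 2!sumrB fwd bwd sumr_const card_ord -[_ *+ N]mulr_natl.
  have b1 := le_trans (ler_norm _) (bu (x1 + y + h *+ N.+1) t1).
  have b2 := le_trans (ler_norm (- _)) (eq_ind_r (fun z => z <= M) (bu (x1 + y + h) t1) (normrN _)).
  have b3 := le_trans (ler_norm _) (bu (x1 - y) t1).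
  have b4 := le_trans (ler_norm (- _))
    (eq_ind_r (fun z => z <= M) (bu (x1 - y - h *+ N) t1) (normrN _)).
  have : N%:R * e <= N%:R * w x1 t1 by rewrite ler_wpM2l// ltW// (lt_le_trans w00).
  lra.
have mp : measurable_fun [set: n.-tuple T] (fun z => p (rv_of_tuple z)).
  apply: measurable_funD; first exact: measurable_sym_diff.
  by apply: measurable_funD; apply: measurable_funM => //; exact: measurable_sdamp.
have Ne0 : 0 <= N%:R * e by rewrite mulr_ge0// ltW.
have s0 : 0 < s by case/andP : s01.
have := telescope_space s0 mp p0 rho0 Ne0 sums near_r.
move=> /le_trans /(_ (lee_wpmul2l _ cost)); rewrite lee_fin => /(_ (ltW NR)).
rewrite -EFinM lee_fin => gain.
apply: (kapP (euclid h `^ (2 * s)) l) => //; first by rewrite powR_gt0.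
rewrite -(ler_pM2l NR); apply: le_trans (le_trans gain _); last first.
  by rewrite le_eqVlt; apply/orP; left; apply/eqP; field; rewrite gt_eqF.
have E : (N.+1%:R * euclid h) `^ (n%:R + 2 * s) =
    N.+1%:R `^ (n%:R + 2 * s) * euclid h ^+ n * euclid h `^ (2 * s).
  rewrite powRM ?(ltW h0)// [euclid h `^ (_ + _)]powRD; last first.
    by apply/implyP => _; rewrite gt_eqF.
  by rewrite powR_mulrn ?(ltW h0)// mulrA.
have E2 : 2 * (euclid h / (2 * n.+1%:R)) = euclid h / n.+1%:R by field; rewrite gt_eqF.
rewrite E E2 expr_div_n /gam le_eqVlt; apply/orP; left; apply/eqP.
have X1 : 0 < N.+1%:R `^ (n%:R + 2 * s) :> R by rewrite powR_gt0.
have X2 : 0 < euclid h ^+ n by rewrite exprn_gt0.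
have X3 : 0 < euclid h `^ (2 * s) by rewrite powR_gt0.
have X4 : 0 < (n.+1%:R : R) ^+ n by rewrite exprn_gt0.
move: X1 X2 X3 X4; set a1 := _ `^ _; set a2 := _ ^+ _; set a3 := _ `^ _; set a4 := _ ^+ _.
by move=> *; field; rewrite !gt_eqF.
Qed.

(** Only the past enters, so a single sum telescopes, over the translates of []0, h[] by
    [h, ..., N h]. Two boundary values remain, whence the height [e / 2] in [gam]. *)
Lemma time_increment M e : 0 <= M -> 0 < e -> exists2 kap : R, 0 < kap <= 1 &
  forall u l x0 t0 (h : R), solution M u -> 0 < l ->
    (forall y tau, euclid (y - x0) <= rs l -> `|tau - t0| <= 2 * rt l ->
      jointly_continuous_at u y tau) ->
    0 <= h <= rt (kap * l) -> u x0 (t0 + h) - u x0 t0 <= e.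
Proof.
move=> M0 e0; have [C C0 CP] := touching n alpha01 s01 c1_gt0 c2_gt0.
have [N N0 NM] := archimedean_steps M e0.
have NR : 0 < N%:R :> R by rewrite ltr0n.
pose gam : R := (e / 2) / N.+1%:R `^ (1 + alpha).
have gam0 : 0 < gam by rewrite divr_gt0 ?divr_gt0 ?powR_gt0.
have D0 : 0 <= C * (16 * M) by rewrite !mulr_ge0.
have [kap /andP[kap0 kap1] kapP] := scale_choice D0 gam0.
exists kap => [|u l x0 t0 h [bu cx ct eqn] l0 cu /andP[h0 hl]]; first by rewrite kap0.
rewrite leNgt; apply/negP => Ae.
pose w x t := u (x + 0) (t + h) - u x t.
have w00 : e < w x0 t0 by rewrite /w addr0.
have hE : h != 0 by apply: contraTneq Ae => ->; rewrite addr0 subrr -leNgt ltW.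
have {hE}h0 : 0 < h by rewrite lt_def hE.
have kl : 0 < kap * l by rewrite mulr_gt0.
have hl' : h <= rt l.
  by apply: le_trans hl _; apply: le_rt => //; [exact: ltW|rewrite ger_pMl].
have hs : h `^ alpha <= kap * l.
  rewrite -[leRHS](rtK alpha01 (ltW kl)).
  by apply: ge0_ler_powR; rewrite ?nnegrE ?(ltW a0) ?(ltW h0) ?powR_ge0.
have cw x : continuous (w x).
  move=> t; rewrite /w addr0; apply: cvgB; last exact: ct.
  by apply: (@continuous_comp _ _ _ (fun t => t + h)); [|exact: ct];
    apply: cvgD; [exact: cvg_id|exact: cvg_cst].
have bw x t : `|w x t| <= 2 * M.
  apply: le_trans (ler_normB _ _) _.
  by have := bu (x + 0) (t + h); have := bu x t; lra.
have eqw x t : reduced_eqn alpha s c1 c2 w x t.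
  apply: (reduced_eqnB _ _ (eqn x (t + h)) (eqn x t)).
  - by move=> r; rewrite /past_diff /w !addr0 [t - r + h]addrAC; ring.
  - by move=> y; rewrite /sym_diff /w !addr0; ring.
have [|x1 [t1 [x1P S D]]] := global_touch (alpha := alpha) (s := s) l0 M0 bw _ (lt_trans e0 w00).
  move=> y tau yl tl; apply: jointly_continuous_sub; last first.
    by apply: cu => //; have := rt_gt0 alpha l0; lra.
  rewrite addr0; apply: cu => //.
  rewrite addrAC; apply: le_trans (ler_normD _ _) _; rewrite (gtr0_norm h0); lra.
have M12 : 0 <= 12 * M by rewrite mulr_ge0.
have M4 : 0 <= 4 * M by rewrite mulr_ge0.
have [_ cost] := CP w x1 t1 _ _ l l (eqw x1 t1) M12 M4 l0 l0 S D.
pose p r := past_diff w x1 t1 r + (12 * M * tdamp alpha l r + 4 * M * tdamp alpha l r).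
have p0 r : 0 < r -> 0 <= p r by move=> r0; have := D r r0; rewrite /p; lra.
have sums r : 0 < r < h -> N%:R * (e / 2) <= \sum_(k < N) p (h *+ k.+1 + r).
  move=> /andP[r0 rh].
  apply: (@le_trans _ _ (\sum_(k < N) past_diff w x1 t1 (h *+ k.+1 + r))); last first.
    apply: ler_sum => k _; rewrite lerDl addr_ge0// mulr_ge0// tdamp_ge0//;
    by rewrite addr_ge0// ?mulrn_wge0// ltW.
  have bwd : \sum_(k < N) w x1 (t1 - (h *+ k.+1 + r)) =
      u x1 (t1 - r) - u x1 (t1 - r - h *+ N).
    have := @telescope_sumr R 0 N (fun k => - u x1 (t1 - r - h *+ k)) (leq0n _).
    rewrite mulr0n subr0 opprK big_mkord => E; rewrite [RHS]addrC -E.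
    apply: eq_bigr => k _; rewrite /w addr0 opprK [RHS]addrC.
    rewrite [h *+ k.+1 + r]addrC opprD addrA; congr (u _ _ - _).
    by rewrite mulrSr opprD addrA subrK.
  rewrite /past_diff sumrB bwd sumr_const card_ord -[_ *+ N]mulr_natl.
  have b3 := le_trans (ler_norm _) (bu x1 (t1 - r)).
  have b4 := le_trans (ler_norm (- _))
    (eq_ind_r (fun z => z <= M) (bu x1 (t1 - r - h *+ N)) (normrN _)).
  have : N%:R * e <= N%:R * w x1 t1 by rewrite ler_wpM2l// ltW// (lt_le_trans w00).
  lra.
have mp : measurable_fun (`]0%R, +oo[%classic : set T) (p : T -> T).
  apply: measurable_funD; first exact: measurable_past_diff.
  by apply: measurable_funD; apply: measurable_funM => //; exact: measurable_tdamp.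
have Ne0 : 0 <= N%:R * (e / 2) by rewrite mulr_ge0// divr_ge0// ltW.
have := telescope_time a0 mp p0 h0 Ne0 sums.
move=> /le_trans /(_ (lee_wpmul2l _ cost)); rewrite lee_fin => /(_ (ltW NR)).
rewrite -EFinM lee_fin => gain.
apply: (kapP (h `^ alpha) l) => //; first by rewrite powR_gt0.
rewrite -(ler_pM2l NR); apply: le_trans (le_trans gain _); last first.
  by rewrite le_eqVlt; apply/orP; left; apply/eqP; field; rewrite gt_eqF.
have E : (h *+ N.+1) `^ (1 + alpha) = N.+1%:R `^ (1 + alpha) * h * h `^ alpha.
  rewrite -[h *+ _]mulr_natl powRM ?(ltW h0)// [h `^ (_ + _)]powRD; last first.
    by apply/implyP => _; rewrite gt_eqF.
  by rewrite powRr1 ?(ltW h0)// mulrA.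
rewrite E /gam le_eqVlt; apply/orP; left; apply/eqP.
have X1 : 0 < N.+1%:R `^ (1 + alpha) :> R by rewrite powR_gt0.
have X3 : 0 < h `^ alpha by rewrite powR_gt0.
move: X1 X3; set a1 := N.+1%:R `^ _; set a3 := h `^ alpha.
by move=> *; field; rewrite !gt_eqF.
Qed.

Lemma space_modulus M e : 0 <= M -> 0 < e -> exists2 kap : R, 0 < kap <= 1 &
  forall u l x0 t0 h, solution M u -> 0 < l ->
    (forall y tau, euclid (y - x0) <= 2 * rs l -> `|tau - t0| <= 2 * rt l ->
      jointly_continuous_at u y tau) ->
    euclid h <= rs (kap * l) -> `|u (x0 + h) t0 - u x0 t0| <= e.
Proof.
move=> M0 e0; have [kap kap01 kapP] := space_increment M0 e0.
exists kap => // u l x0 t0 h su l0 cu hl.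
rewrite ler_norml (kapP u l)// andbT.
have := kapP _ l x0 t0 h (solutionN su) l0 _ hl; rewrite opprK => H.
have : - u (x0 + h) t0 + u x0 t0 <= e.
  by apply: H => y tau yl tl; exact/jointly_continuousN/cu.
lra.
Qed.

(** A negative [h] is treated as the positive increment [- h] of [- u] from [t0 + h]. Moving the
    base time by at most [rt l] raises the height of the cylinder to [3 * rt l]. *)
Lemma time_modulus M e : 0 <= M -> 0 < e -> exists2 kap : R, 0 < kap <= 1 &
  forall u l x0 t0 (h : R), solution M u -> 0 < l ->
    (forall y tau, euclid (y - x0) <= rs l -> `|tau - t0| <= 3 * rt l ->
      jointly_continuous_at u y tau) ->
    `|h| <= rt (kap * l) -> `|u x0 (t0 + h) - u x0 t0| <= e.
Proof.
move=> M0 e0; have [kap kap01 kapP] := time_increment M0 e0.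
exists kap => // u l x0 t0 h su l0 cu hl.
have forward v : solution M v -> (forall y tau, euclid (y - x0) <= rs l ->
    `|tau - t0| <= 3 * rt l -> jointly_continuous_at v y tau) ->
    v x0 (t0 + h) - v x0 t0 <= e.
  move=> sv cv; have tl := rt_gt0 alpha l0.
  have [h0|h0] := leP 0 h.
    apply: (kapP v l) => //; last by rewrite h0 -(ger0_norm h0).
    by move=> y tau yl tl'; apply: cv => //; lra.
  have hle : - h <= rt l.
    rewrite -(ltr0_norm h0); apply: le_trans hl _.
    by case/andP : kap01 => k0 k1; apply: le_rt => //; [rewrite mulr_ge0// ltW|rewrite ger_pMl].
  have := kapP _ l x0 (t0 + h) (- h) (solutionN sv) l0; rewrite addrK opprK => H.
  rewrite addrC; apply: H; last by rewrite oppr_ge0 (ltW h0) -(ltr0_norm h0).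
  move=> y tau yl tl'; apply/jointly_continuousN/cv => //.
  rewrite -[tau - t0](subrKA (t0 + h)); apply: le_trans (ler_normD _ _) _.
  by rewrite [t0 + h]addrC addrK (ltr0_norm h0) [h + t0]addrC; lra.
rewrite ler_norml forward// andbT.
have : - u x0 (t0 + h) - - u x0 t0 <= e.
  apply: (forward (fun x t => - u x t)); first exact: solutionN.
  by move=> y tau yl tl; exact/jointly_continuousN/cu.
lra.
Qed.

End modulus_of_continuity.

(** * Joint continuity *)

Section removable_crosses.
Context {R : realType} (n : nat) (alpha s c1 c2 : R).
Hypotheses (alpha01 : 0 < alpha < 1) (s01 : 0 < s < 1).
Hypotheses (c1_gt0 : 0 < c1) (c2_gt0 : 0 < c2).
Local Notation T := (measurableTypeR R).
Local Notation rs := (rs s).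
Local Notation rt := (rt alpha).
Local Notation solution := (@solution R n alpha s c1 c2).
Implicit Types (u v w : 'rV[R]_n -> R -> R) (x y h : 'rV[R]_n) (t tau r l e M : R).

Let s2 : 0 < 2 * s. Proof. by case/andP : s01 => ? _; rewrite mulr_gt0. Qed.
Let a0 : 0 < alpha. Proof. by case/andP : alpha01. Qed.

(* [lra] reifies every hypothesis in the context, which is slow in long proofs. *)
Local Ltac lra_goal := clear -n alpha01 s01 c1_gt0 c2_gt0 s2 a0; lra.

(* The moduli of continuity are scale invariant, hence trivial on the whole space. *)
Lemma continuous_solution_constant M u : 0 <= M -> solution M u ->
  (forall x t, jointly_continuous_at u x t) ->
  forall x t, u x t = u 0 0.
Proof.
move=> M0 su cu x t.
have small (a b : R) : (forall e, 0 < e -> `|a - b| <= e) -> a = b.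
  move=> H; apply/eqP; rewrite -subr_eq0 -normr_le0; apply/ler_addgt0Pr => e e0.
  by rewrite add0r; exact: H.
transitivity (u 0 t); apply: small => e e0.
- have [kap /andP[kap0 _] kapP] := space_modulus n alpha01 s01 c1_gt0 c2_gt0 M0 e0.
  have l0 : 0 < (euclid x `^ (2 * s) + 1) / kap.
    by rewrite divr_gt0// ltr_wpDl// powR_ge0.
  have := kapP u _ 0 t x su l0; rewrite add0r; apply; first by move=> *; exact: cu.
  rewrite mulrC divfK ?gt_eqF// -[leLHS](powR_rsK s01 (euclid_ge0 x)).
  by apply: le_rs; rewrite ?powR_ge0// lerDl.
- have [kap /andP[kap0 _] kapP] := time_modulus n alpha01 s01 c1_gt0 c2_gt0 M0 e0.
  have l0 : 0 < (`|t| `^ alpha + 1) / kap.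
    by rewrite divr_gt0// ltr_wpDl// powR_ge0.
  have := kapP u _ 0 0 t su l0; rewrite add0r; apply; first by move=> *; exact: cu.
  rewrite mulrC divfK ?gt_eqF// -[leLHS](powR_rtK alpha01 (normr_ge0 t)).
  by apply: le_rt; rewrite ?powR_ge0// lerDl.
Qed.

Definition near_point xs ts r y tau := euclid (y - xs) < r /\ `|tau - ts| < r.

(** [S] is the upper limit of [u] at the point, centre included, obtained as the supremum of the
    levels reached in every neighbourhood. *)
Lemma limsup_point u M xs ts (b : R) : (forall x t, `|u x t| <= M) ->
  (forall r, 0 < r -> exists y tau, near_point xs ts r y tau /\ b <= u y tau) ->
  exists S : R, [/\ b <= S,
    forall e, 0 < e -> exists2 r, 0 < r & forall y tau, near_point xs ts r y tau ->
      u y tau < S + e &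
    forall e r, 0 < e -> 0 < r -> exists y tau, near_point xs ts r y tau /\ S - e < u y tau].
Proof.
move=> bu freq.
pose A : set R := [set a | forall r, 0 < r ->
  exists y tau, near_point xs ts r y tau /\ a <= u y tau].
have Ab : A b by [].
have ubA : ubound A M.
  move=> a /(_ 1 ltr01)[y [tau [_ ay]]].
  exact: le_trans ay (le_trans (ler_norm _) (bu _ _)).
have supA : has_sup A by split; [exists b|exists M].
exists (sup A); split.
- exact: (sup_upper_bound supA).
- move=> e e0; apply: contrapT => H.
  have : A (sup A + e).
    move=> r r0; apply: contrapT => H'; apply: H; exists r => // y tau yr.
    by rewrite ltNge; apply/negP => le; apply: H'; exists y, tau.
  by move=> /(sup_upper_bound supA); rewrite gerDl leNgt e0.
- move=> e r e0 r0; have [a Aa aS] := sup_adherent e0 supA.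
  have [y [tau [yr ya]]] := Aa r r0.
  by exists y, tau; split => //; exact: lt_le_trans aS ya.
Qed.

(** A point of [X] within twice the distance is enough later on, so the infimum itself need not be
    reached. *)
Lemma distance_attained (X : set 'rV[R]_n) x xs : X xs ->
  (exists2 d : R, 0 < d & forall y, X y -> d <= euclid (x - y)) ->
  exists d : R, [/\ 0 < d, forall y, X y -> d <= euclid (x - y) &
    exists2 y, X y & euclid (x - y) < 2 * d].
Proof.
move=> Xxs [d0 d00 d0P].
pose A : set R := [set euclid (x - y) | y in X].
have infA : has_inf A.
  by split; [exists (euclid (x - xs)), xs|exists d0 => _ [y Xy <-]; exact: d0P].
have dpos : 0 < inf A.
  by apply: lt_le_trans d00 _; apply: lb_le_inf; [case: infA|move=> _ [y Xy <-]; exact: d0P].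
exists (inf A); split => //.
- by move=> y Xy; apply: (ge_inf infA.2); exists y.
- have [_ [y Xy <-] yd] := inf_adherent dpos infA.
  by exists y => //; rewrite mulr_natl mulr2n.
Qed.

(* If the upper limit [S] of [u] at [(xs, ts)] exceeds [u xs ts] by [J], take a point [xj] off
   [X] where [u] is close to [S], and let [d] be its distance to [X]. At the contact point
   [(x1, t1)] of a bump of length [d / 8], the time [t1] is far from [Y] because [u x1] is close
   to [S]. So [u _ t1] is controlled near a point [x'] of [X] with [|x' - x1| <= 3 * d], where it
   stays below [S - J / 2]; this makes the second difference at [x1] too large on a ball of
   radius proportional to [d]. *)
Lemma cross_upper M u (X : set 'rV[R]_n) (Y : set R) xs ts eps :
  0 <= M -> solution M u -> 0 < eps -> X xs ->
  (forall x, ~ X x -> exists2 d : R, 0 < d & forall y, X y -> d <= euclid (x - y)) ->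
  (forall y tau, near_point xs ts eps y tau -> ~ X y \/ ~ Y tau ->
    jointly_continuous_at u y tau) ->
  (forall e, 0 < e -> exists2 r, 0 < r & forall y tau, near_point xs ts r y tau ->
    X y \/ Y tau -> u y tau < u xs ts + e) ->
  forall e, 0 < e -> exists2 r, 0 < r & forall y tau, near_point xs ts r y tau ->
    u y tau < u xs ts + e.
Proof.
move=> M0 su eps0 Xxs clX cu cross e0 e00; apply: contrapT => noR.
have [bu cx ct eqn] := su.
have freq r : 0 < r -> exists y tau, near_point xs ts r y tau /\ u xs ts + e0 <= u y tau.
  move=> r0; apply: contrapT => H; apply: noR; exists r => // y tau yr.
  by rewrite ltNge; apply/negP => le; apply: H; exists y, tau.
have [S [bS Sup Sfreq]] := limsup_point bu freq.
have [J JE] : exists J : R, J = S - u xs ts by exists (S - u xs ts).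
have J0 : 0 < J by rewrite JE; lra.
have [e eE] : exists e : R, e = J / 8 by exists (J / 8).
have e_gt0 : 0 < e by rewrite eE divr_gt0.
have [ks /andP[ks0 ks1] ksP] := space_modulus n alpha01 s01 c1_gt0 c2_gt0 M0 e_gt0.
have [kt /andP[kt0 kt1] ktP] := time_modulus n alpha01 s01 c1_gt0 c2_gt0 M0 e_gt0.
have [C C0 CP] := touching n alpha01 s01 c1_gt0 c2_gt0.
(* The factor [c] divides [rt] by 4, so that the time window [2 * rt l'] demanded by [space_modulus]
   fits into the window [rt (kt * l)] around [t1] that avoids [Y]. *)
pose c := (4^-1 : R) `^ alpha.
have c0 : 0 < c by rewrite powR_gt0.
have rtc : rt c = 4^-1 by apply: powR_rtK; rewrite ?invr_ge0.
have c1' : c <= 1.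
  rewrite (_ : 1 = 1 `^ alpha); last by rewrite powR1.
  by apply: ge0_ler_powR; rewrite ?nnegrE; [exact: ltW|lra..].
clearbody c.
have [sig sigE] : exists sig : R, sig = rs (ks * (c * kt)) by exists (rs (ks * (c * kt))).
have sig0 : 0 < sig by rewrite sigE rs_gt0// !mulr_gt0.
(* A box of half side [sig * (d / 8) / (n + 1)], at distance at most [4 d = 32 (d / 8)], will yield
   the gain [J * gam / (2 * l)] with [l = (d / 8)^(2s)]. *)
have [gam gamE] : exists gam : R, gam = (2 * sig / n.+1%:R) ^+ n / 32 `^ (n%:R + 2 * s).
  by eexists.
have gam0 : 0 < gam by rewrite gamE divr_gt0 ?powR_gt0// exprn_gt0// divr_gt0// mulr_gt0.
(* The first bound limits the loss [3 * eta] in the second difference to [J / 8]; the second keeps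
   the cost of the low bump below a quarter of the gain. The [+ 1] guards against [C = 0]. *)
pose eta := Num.min (J / 24) (J * gam / (8 * (9 * C + 1))).
have C9 : 0 < 8 * (9 * C + 1) by rewrite mulr_gt0// ltr_wpDl// mulr_ge0.
have eta0 : 0 < eta by rewrite lt_min; apply/andP; split; rewrite divr_gt0 // mulr_gt0.
have etaJ : eta <= J / 24 by rewrite ge_min lexx.
have etaC : C * (9 * eta) <= J * gam / 8.
  have : eta <= J * gam / (8 * (9 * C + 1)) by rewrite ge_min lexx orbT.
  by rewrite ler_pdivlMr//; (move: eta0; lra_goal).
clearbody eta.
have [r1 r1_gt0 r1P] := Sup eta eta0.
have [r2 r2_gt0 r2P] := cross e e_gt0.
pose r0 := Num.min eps (Num.min r1 r2).
have r00 : 0 < r0 by rewrite !lt_min eps0 r1_gt0.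
have nearS y tau : near_point xs ts r0 y tau -> u y tau < S + eta.
  by move=> [yr tr]; apply: r1P; move: yr tr; rewrite /r0 !lt_min => /and3P[_ ? _] /and3P[_ ? _].
have nearX y tau : near_point xs ts r0 y tau -> X y \/ Y tau -> u y tau < u xs ts + e.
  by move=> [yr tr]; apply: r2P; move: yr tr; rewrite /r0 !lt_min => /and3P[_ _ ?] /and3P[_ _ ?].
have nearC y tau : near_point xs ts r0 y tau -> ~ X y \/ ~ Y tau -> jointly_continuous_at u y tau.
  by move=> [yr tr]; apply: cu; move: yr tr; rewrite /r0 !lt_min => /and3P[? _ _] /and3P[? _ _].
clearbody r0.
have r02 : 0 < r0 / 2 by rewrite divr_gt0.
(* Up to the order [l0] the estimates near [(xs, ts)] apply; beyond it only the bound [2 * M] on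
   increments is available. *)
pose l0 := Num.min ((r0 / 2) `^ (2 * s)) ((r0 / 2) `^ alpha).
have l0_gt0 : 0 < l0 by rewrite lt_min !powR_gt0.
have rsl0 : rs l0 <= r0 / 2.
  rewrite -[leRHS](powR_rsK s01 (ltW r02)); apply: le_rs => //; first exact: ltW.
  by rewrite ge_min lexx.
have rtl0 : rt l0 <= r0 / 2.
  rewrite -[leRHS](powR_rtK alpha01 (ltW r02)); apply: le_rt => //; first exact: ltW.
  by rewrite ge_min lexx orbT.
clearbody l0.
have r016 : 0 < r0 / 16 by rewrite divr_gt0.
(* For [l <= L] the cost [4 C M / l0] of the far bump is at most half of the gain, and the cylinder
   of order [l] is short in time. *)
pose L := Num.min ((r0 / 16) `^ alpha) (J * gam * l0 / (16 * (C * M + 1))).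
have CM : 0 < 16 * (C * M + 1) by rewrite mulr_gt0// ltr_wpDl// mulr_ge0.
have L0 : 0 < L.
  rewrite lt_min; apply/andP; split; first exact: powR_gt0.
  exact: divr_gt0 (mulr_gt0 (mulr_gt0 J0 gam0) l0_gt0) CM.
have L1 : L <= (r0 / 16) `^ alpha by rewrite ge_min lexx.
have L2 : L <= J * gam * l0 / (16 * (C * M + 1)) by rewrite ge_min lexx orbT.
clearbody L.
pose rr := Num.min (rs L) (r0 / 4).
have rr0 : 0 < rr.
  by rewrite lt_min; apply/andP; split; [exact: rs_gt0|rewrite divr_gt0].
have rrle : rr <= r0 / 4 by rewrite ge_min lexx orbT.
have rrL : rr <= rs L by rewrite ge_min lexx.
clearbody rr.
have [xj [tj [[xjr tjr] uj]]] := Sfreq eta rr eta0 rr0.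
have near_j : near_point xs ts r0 xj tj by split; (move: xjr tjr rrle rr0; lra_goal).
have nXj : ~ X xj.
  by move=> Xxj; have := nearX xj tj near_j (or_introl Xxj); (move: uj etaJ JE eE J0; lra_goal).
have [d [d0 dP [x' Xx' x'd]]] := distance_attained Xxs (clX xj nXj).
have drr : d < rr by exact: le_lt_trans (dP xs Xxs) xjr.
have [l lE] : exists l : R, l = (d / 8) `^ (2 * s) by eexists.
have d8 : 0 < d / 8 by rewrite divr_gt0.
have l_gt0 : 0 < l by rewrite lE powR_gt0.
have rsl : rs l = d / 8 by rewrite lE (powR_rsK s01)// ltW.
have lL : l <= L.
  rewrite lE -[leRHS](rsK s01 (ltW L0)); apply: ge0_ler_powR;
    rewrite ?nnegrE ?(ltW s2) ?(ltW d8) ?powR_ge0//.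
  by apply: le_trans rrL; (move: drr d0; lra_goal).
have rtl : rt l <= r0 / 16.
  rewrite -[leRHS](powR_rtK alpha01 (ltW r016)); apply: le_rt => //; first exact: ltW.
  exact: le_trans lL L1.
have rtl0' := rt_gt0 alpha l_gt0.
have cyl y tau : euclid (y - xj) <= rs l -> `|tau - tj| <= rt l -> jointly_continuous_at u y tau.
  rewrite rsl => yd taul; apply: nearC; last first.
    by left => Xy; have := dP y Xy; rewrite euclidB; (move: yd d0; lra_goal).
  split.
    by have := euclid_dist_triangle y xj xs; (move: yd xjr drr rrle d0 rr0; lra_goal).
  by rewrite -[tau - ts](subrKA tj); apply: le_lt_trans (ler_normD _ _) _;
    (move: taul tjr rtl rrle r00; lra_goal).
(* Nearby [u] stays below [S + eta], and it exceeds [S - eta] at [(xj, tj)]; the weight [3 * eta] is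
   more than the possible gain [2 * eta]. *)
have [x1 [t1 [x1l t1l umax]]] := penalized_max (3 * eta) l_gt0 cyl.
have K0 : 0 <= 3 * eta by rewrite mulr_ge0// ltW.
have pen0 y tau : 0 <= 3 * eta * penalty alpha s xj tj l y tau by rewrite mulr_ge0// penalty_ge0.
have ctr : u xj tj <= u x1 t1 - 3 * eta * penalty alpha s xj tj l x1 t1.
  have := umax xj tj; rewrite !subrr euclid0 normr0 penalty_center mulr0 subr0.
  by apply; [exact/ltW/rs_gt0|exact/ltW/rt_gt0].
have pen1 := pen0 x1 t1.
have u1S : S - eta < u x1 t1 by (move: uj ctr pen1; lra_goal).
rewrite rsl in x1l.
have x1s : euclid (x1 - xs) < rr + d / 8.
  by have := euclid_dist_triangle x1 xj xs; (move: x1l xjr; lra_goal).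
have t1s : `|t1 - ts| < rr + rt l.
  by rewrite -(subrKA tj); apply: le_lt_trans (ler_normD _ _) _; (move: t1l tjr; lra_goal).
have touch y tau : near_point xs ts r0 y tau -> u y tau - u x1 t1 <=
    Num.min (3 * eta) (3 * eta * (penalty alpha s xj tj l y tau - penalty alpha s xj tj l x1 t1)).
  move=> yr; have yS := nearS y tau yr.
  rewrite le_min; apply/andP; split; first (move: yS u1S eta0; lra_goal).
  rewrite mulrBr; have [/andP[yl tl]|out] :=
    boolP ((euclid (y - xj) <= rs l) && (`|tau - tj| <= rt l)).
    by have := umax y tau yl tl; lra_goal.
  have p1 : 1 < penalty alpha s xj tj l y tau by exact: penalty_gt1.
  have : 3 * eta <= 3 * eta * penalty alpha s xj tj l y tau by rewrite ler_peMr// ltW.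
  by move: yS uj ctr eta0; lra_goal.
have M2 : 0 <= 2 * M by rewrite mulr_ge0.
have [|||Ssym Spast] := @max_touch _ n alpha s u xj tj x1 t1 (3 * eta) (2 * M) l l0
  K0 M2 l_gt0 l0_gt0 t1l.
- move=> y yl; apply: touch; split.
    by rewrite addrAC; apply: le_lt_trans (euclid_triangle _ _) _;
      (move: x1s yl rsl0 drr rrle rr0 d0; lra_goal).
  by move: t1s rtl rrle r00; lra_goal.
- move=> r /andP[r_gt0 rl]; apply: touch; split; first (move: x1s drr rrle rr0; lra_goal).
  by rewrite addrAC; apply: le_lt_trans (ler_normB _ _) _; rewrite (gtr0_norm r_gt0);
    (move: t1s rtl rrle rl rtl0 r00; lra_goal).
- move=> y tau; have := le_trans (ler_norm _) (bu y tau).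
  by have := le_trans (ler_norm (- _)) (eq_ind_r (fun z => z <= M) (bu x1 t1) (normrN _)); lra_goal.
have a1_ge0 : 0 <= 3 * (3 * eta) by rewrite mulr_ge0.
have a2_ge0 : 0 <= 2 * (2 * M) by rewrite mulr_ge0.
have [cost _] := CP u x1 t1 _ _ l l0 (eqn x1 t1) a1_ge0 a2_ge0 l_gt0 l0_gt0 Ssym Spast.
(* At a time of [Y] the cross keeps [u x1] below [u xs ts + e], whereas the time modulus keeps it
   within [e] of a value above [S - eta]; the two levels are too far apart. *)
have noY t' : `|t' - t1| <= rt (kt * l) -> ~ Y t'.
  move=> t't1 Yt'.
  have rtkl : rt (kt * l) <= rt l.
    by apply: le_rt => //; [rewrite mulr_ge0// ltW|rewrite ger_pMl].
  have := ktP u l x1 t1 (t' - t1) su l_gt0; rewrite [t1 + _]addrC subrK => H.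
  have : `|u x1 t' - u x1 t1| <= e.
    apply: H => // y tau yl taul; apply: nearC; last first.
      left => Xy; have := dP y Xy; rewrite rsl in yl.
      by have := euclid_dist_triangle y x1 xj; rewrite (euclidB y xj); (move: yl x1l d0; lra_goal).
    split; first by have := euclid_dist_triangle y x1 xs; rewrite rsl in yl;
      (move: yl x1s drr rrle rr0 d0; lra_goal).
    by rewrite -(subrKA t1); apply: le_lt_trans (ler_normD _ _) _;
      (move: taul t1s rtl rrle r00; lra_goal).
  rewrite ler_norml => /andP[lo _].
  have : u x1 t' < u xs ts + e.
    apply: nearX; [split; first (move: x1s drr rrle rr0; lra_goal)|by right].
    by rewrite -(subrKA t1); apply: le_lt_trans (ler_normD _ _) _;
      (move: t't1 rtkl t1s rtl rrle r00; lra_goal).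
  by move: lo u1S etaJ JE eE J0; lra_goal.
have [l' l'E] : exists l' : R, l' = c * kt * l by eexists.
have ckt0 : 0 < c * kt by rewrite mulr_gt0.
have l'0 : 0 < l' by rewrite l'E mulr_gt0.
have ckt1 : c * kt <= 1 by rewrite mulr_ile1// ltW.
have rsl' : rs l' <= d / 8.
  by rewrite -rsl; apply: le_rs => //; [exact: ltW|rewrite l'E ger_pMl].
have rtl' : rt l' = rt (kt * l) / 4.
  by rewrite l'E -mulrA rtM ?ltW// ?mulr_gt0// rtc mulrC.
have rtkl0 : 0 < rt (kt * l) by rewrite rt_gt0// mulr_gt0.
have x's : euclid (x' - xs) < 3 * rr.
  by have := euclid_dist_triangle x' xj xs; rewrite (euclidB x' xj); (move: x'd xjr drr; lra_goal).
(* Around [x'] the set [X] is present, but all times of the window avoid [Y], so [u] is jointly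
   continuous there and the space modulus applies. *)
have low h : euclid h <= rs (ks * l') -> u (x' + h) t1 <= u xs ts + 2 * e.
  move=> hl; have := ksP u l' x' t1 h su l'0 => H.
  have : `|u (x' + h) t1 - u x' t1| <= e.
    apply: H => // y tau yl taul; apply: nearC; last first.
      by right; apply: noY; move: taul; rewrite rtl'; (move: rtkl0; lra_goal).
    split; first by have := euclid_dist_triangle y x' xs;
      (move: yl rsl' x's drr rrle d0 rr0; lra_goal).
    rewrite -(subrKA t1); apply: le_lt_trans (ler_normD _ _) _.
    have : rt l' <= rt l by apply: le_rt => //; [exact: ltW|rewrite l'E ger_pMl].
    by move: taul t1s rtl rrle r00; lra_goal.
  rewrite ler_norml => /andP[_ hi].
  have : u x' t1 < u xs ts + e by apply: nearX; [split;
    (move: x's t1s rtl rrle r00 rr0; lra_goal)|left].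
  by move: hi; lra_goal.
have rsks : rs (ks * l') = sig * (d / 8).
  by rewrite l'E sigE mulrA -rsl -rsM// ?ltW// ?mulr_gt0.
have rsks8 : rs (ks * l') <= d / 8.
  by apply: le_trans rsl'; apply: le_rs => //; [rewrite mulr_ge0// ltW|rewrite ger_pMl].
have n10 : 0 < n.+1%:R :> R by [].
have [rho rhoE] : exists rho : R, rho = rs (ks * l') / n.+1%:R by eexists.
have rho0 : 0 < rho by rewrite rhoE divr_gt0// rs_gt0// mulr_gt0.
have small z : box n rho z -> euclid (rv_of_tuple z) <= rs (ks * l').
  move=> /(box_euclid rho0) /le_trans; apply.
  rewrite rhoE mulrCA -[leRHS]mulr1 ler_wpM2l//; first by rewrite powR_ge0.
  by rewrite ler_pdivrMr// mul1r ler_nat.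
pose q := x' - x1.
have q_up : euclid q <= 2 * d + d / 8.
  have := euclid_dist_triangle x' xj x1; rewrite -/q (euclidB xj x1) (euclidB x' xj);
    (move: x'd x1l; lra_goal).
have q_low : d - d / 8 <= euclid q.
  have := euclid_dist_triangle xj x1 x'; rewrite (euclidB xj x1) (euclidB x1 x') -/q.
  by have := dP x' Xx'; (move: x1l; lra_goal).
pose p y := sym_diff u x1 t1 y + (3 * (3 * eta) * sdamp s l y + 2 * (2 * M) * sdamp s l0 y).
have p0 y : 0 <= p y by have := Ssym y; rewrite /p; lra_goal.
have mp : measurable_fun [set: n.-tuple T] (fun z => p (rv_of_tuple z)).
  apply: measurable_funD; first exact: measurable_sym_diff.
  by apply: measurable_funD; apply: measurable_funM => //; exact: measurable_sdamp.
have near_r (z : n.-tuple T) (k : 'I_1) : box n rho z ->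
    0 < euclid (q *+ k.+1 + rv_of_tuple z) <= 4 * d.
  move=> /small zr; rewrite ord1 mulr1n; apply/andP; split.
    have := euclid_triangle (q + rv_of_tuple z) (- rv_of_tuple z).
    by rewrite addrK euclidN; (move: zr rsks8 q_low d0; lra_goal).
  by apply: le_trans (euclid_triangle _ _) _; (move: zr rsks8 q_up d0; lra_goal).
(* One translate suffices. The point near [x'] is low and its mirror image is below [S + eta]: the
   second difference is at least [J - 3 * eta - 2 * e >= 5 J / 8]. *)
have sums (z : n.-tuple T) : box n rho z ->
    J / 2 <= \sum_(k < 1) p (q *+ k.+1 + rv_of_tuple z).
  move=> /small zr; rewrite big_ord_recl big_ord0 addr0 mulr1n.
  apply: (@le_trans _ _ (sym_diff u x1 t1 (q + rv_of_tuple z))); last first.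
    by rewrite lerDl addr_ge0// mulr_ge0// sdamp_ge0.
  have := low _ zr; rewrite /sym_diff addrA /q [x1 + (_ - _)]addrC subrK => lo.
  have qz : euclid (x' - x1 + rv_of_tuple z) <= 2 * d + d / 4.
    by apply: le_trans (euclid_triangle _ _) _; rewrite -/q; (move: zr rsks8 q_up; lra_goal).
  have hi : u (x1 - (x' - x1 + rv_of_tuple z)) t1 < S + eta.
    apply: nearS; split; last (move: t1s rtl rrle r00; lra_goal).
    rewrite addrAC; apply: le_lt_trans (euclid_triangle _ _) _.
    by rewrite euclidN; (move: x1s qz drr rrle d0 rr0; lra_goal).
  by move: lo hi u1S etaJ JE eE J0; lra_goal.
have s0 : 0 < s by case/andP : s01.
have J2 : 0 <= J / 2 by rewrite divr_ge0// ltW.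
have := telescope_space s0 mp p0 rho0 J2 sums near_r.
move=> /le_trans /(_ (lee_wpmul2l _ cost)); rewrite lee_fin => /(_ ler01).
rewrite mul1e lee_fin.
have -> : J / 2 / (4 * d) `^ (n%:R + 2 * s) * (2 * rho) ^+ n = J / 2 * gam / l.
  have -> : (4 * d) `^ (n%:R + 2 * s) = 32 `^ (n%:R + 2 * s) * ((d / 8) ^+ n * l).
    have -> : 4 * d = 32 * (d / 8) by field.
    rewrite powRM ?(ltW d8)// [(d / 8) `^ (_ + _)]powRD; last first.
      by apply/implyP => _; rewrite gt_eqF.
    by rewrite powR_mulrn ?(ltW d8)// lE.
  have -> : 2 * rho = 2 * sig / n.+1%:R * (d / 8) by rewrite rhoE rsks; field; rewrite gt_eqF.
  rewrite [(_ * (d / 8)) ^+ n]exprMn gamE.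
  have X1 : 0 < 32 `^ (n%:R + 2 * s) :> R by rewrite powR_gt0.
  have X2 : 0 < (d / 8) ^+ n by rewrite exprn_gt0.
  move: X1 X2; set b1 := 32 `^ _; set b2 := (d / 8) ^+ _; set b3 := (_ / _) ^+ _.
  by move=> *; field; rewrite !gt_eqF.
(* The two costs are at most 1/8 and 1/4 of [J * gam / l], the gain is 1/2 of it. *)
apply/negP; rewrite -ltNge.
have Jg : 0 < J * gam by exact: mulr_gt0.
have CM0 : 0 <= C * M by rewrite mulr_ge0.
have lJ : l * (16 * (C * M + 1)) <= J * gam * l0.
  by rewrite -ler_pdivlMr//; exact: le_trans lL L2.
have far_cost : 4 * (C * M) / l0 <= (J * gam / 4) / l.
  rewrite ler_pdivrMr// mulrAC ler_pdivlMr//.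
  have : 0 <= C * M * l by rewrite mulr_ge0// ltW.
  by move: lJ; (move: l_gt0; lra_goal).
have near_cost : C * (9 * eta) / l <= (J * gam / 8) / l.
  by rewrite ler_wpM2r ?invr_ge0 ?(ltW l_gt0).
have Jgl : 0 < J * gam / l by rewrite divr_gt0.
have -> : C * (3 * (3 * eta) / l + 2 * (2 * M) / l0) =
  C * (9 * eta) / l + 4 * (C * M) / l0 by ring.
have -> : J / 2 * gam / l = J * gam / l / 2 by ring.
have E1 : (J * gam / 4) / l = J * gam / l / 4 by ring.
have E2 : (J * gam / 8) / l = J * gam / l / 8 by ring.
by move: far_cost near_cost Jgl; rewrite E1 E2; lra_goal.
Qed.

Lemma cross_continuous M u (X : set 'rV[R]_n) (Y : set R) xs ts eps :
  0 <= M -> solution M u -> 0 < eps -> X xs ->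
  (forall x, ~ X x -> exists2 d : R, 0 < d & forall y, X y -> d <= euclid (x - y)) ->
  (forall y tau, near_point xs ts eps y tau -> ~ X y \/ ~ Y tau ->
    jointly_continuous_at u y tau) ->
  (forall e, 0 < e -> exists2 r, 0 < r & forall y tau, near_point xs ts r y tau ->
    X y \/ Y tau -> `|u y tau - u xs ts| < e) ->
  jointly_continuous_at u xs ts.
Proof.
move=> M0 su eps0 Xxs clX cu cross e e0.
have [|r1 r10 P1] := @cross_upper M u X Y xs ts eps M0 su eps0 Xxs clX cu _ e e0.
  move=> e' e'0; have [r r0 rP] := cross e' e'0; exists r => // y tau yr yX.
  by have := rP y tau yr yX; rewrite ltr_norml => /andP[_]; lra.
have [||r2 r20 P2] := @cross_upper M (fun x t => - u x t) X Y xs ts eps M0 (solutionN su)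
    eps0 Xxs clX _ _ e e0.
- by move=> y tau yr yX; exact/jointly_continuousN/cu.
- move=> e' e'0; have [r r0 rP] := cross e' e'0; exists r => // y tau yr yX.
  by have := rP y tau yr yX; rewrite ltr_norml => /andP[? _]; lra.
exists (Num.min r1 r2) => [|y tau]; first by rewrite lt_min r10.
rewrite !lt_min => /andP[y1 y2] /andP[t1 t2].
have := P1 y tau (conj y1 t1); have := P2 y tau (conj y2 t2).
by rewrite ltr_norml => ? ?; apply/andP; split; lra.
Qed.

End removable_crosses.

(** * A category argument on product neighbourhoods *)

Section baire.
Context {R : realType} (n : nat).
Implicit Types (u : 'rV[R]_n -> R -> R) (x y : 'rV[R]_n) (t tau r e : R).
Local Notation point := ('rV[R]_n * R)%type.
Implicit Types p q : point.

Definition near_pt p r q := near_point p.1 p.2 r q.1 q.2.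

Lemma near_pt_refl p r : 0 < r -> near_pt p r p.
Proof. by move=> r0; split; rewrite subrr ?euclid0 ?normr0. Qed.

Lemma near_pt_sym p q r : near_pt p r q -> near_pt q r p.
Proof. by move=> [? ?]; split; rewrite ?(euclidB p.1) // distrC. Qed.

Lemma near_pt_trans p q w r r' : near_pt p r q -> near_pt q r' w -> near_pt p (r + r') w.
Proof.
move=> [a b] [a' b']; split.
  by have := euclid_dist_triangle w.1 q.1 p.1; lra.
by rewrite -(subrKA q.2); apply: le_lt_trans (ler_normD _ _) _; lra.
Qed.

Lemma near_pt_le p q r r' : r <= r' -> near_pt p r q -> near_pt p r' q.
Proof. by move=> rr' [a b]; split; exact: lt_le_trans rr'. Qed.

Lemma near_pt_open p q r : near_pt p r q ->
  exists2 r', 0 < r' & forall w, near_pt q r' w -> near_pt p r w.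
Proof.
move=> [a b]; exists (Num.min (r - euclid (q.1 - p.1)) (r - `|q.2 - p.2|)).
  by rewrite lt_min !subr_gt0 a.
move=> w [c d]; move: c d; rewrite !lt_min => /andP[c _] /andP[_ d]; split.
  by have := euclid_dist_triangle w.1 q.1 p.1; lra.
by rewrite -(subrKA q.2); apply: le_lt_trans (ler_normD _ _) _; lra.
Qed.

Lemma cluster_sequence (x0 : 'rV[R]_n) (t0 : R) (z : nat -> point) :
  (forall j, euclid ((z j).1 - x0) <= 1 /\ `|(z j).2 - t0| <= 1) ->
  exists q, forall k r, 0 < r -> exists2 j, (k <= j)%N & near_pt q r (z j).
Proof.
move=> zb; have cA := @compact_cylinder R n x0 t0 1 1.
have [|q [_ clq]] := cA (z @ \oo) _.
  by exists 0%N => // j _; have [? ?] := zb j; split => //=; rewrite in_itv/= -ler_distl.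
exists q => k r r0.
have n10 : 0 < n.+1%:R :> R by [].
have [||w [[j /= kj <-] qr]] := clq (z @` [set j | (k <= j)%N]) (ball q (r / n.+1%:R)).
- by exists k => // j /= kj; exists j.
- by apply: nbhsx_ballx; rewrite divr_gt0.
exists j => //; move: qr; rewrite -ball_normE /= prod_normE /= ltr_pdivlMr// => qr.
split.
- rewrite euclidB; apply: le_lt_trans (euclid_le_norm _) _; apply: le_lt_trans qr.
  rewrite mulrC; apply: ler_pM => //; first by rewrite le_max lexx.
  by rewrite ler_nat.
- rewrite distrC; apply: le_lt_trans qr; rewrite -[leLHS]mulr1.
  by apply: ler_pM => //; rewrite ?le_max ?lexx ?orbT// ler1n.
Qed.

(** If no portion of [Z] lies in a single [F k], neighbourhoods centred in [Z] can be nested so that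
    the [k]-th choice misses [F k]. Compactness gives a cluster point of the centres, which avoids
    every [F k]. It may lie outside [Z], but [F] covers the whole space. *)
Lemma baire_portion (Z : set point) (F : nat -> set point) z0 :
  Z z0 ->
  (forall k p, ~ F k p -> exists2 r, 0 < r & forall q, near_pt p r q -> ~ F k q) ->
  (forall p, exists k, F k p) ->
  exists k z r, [/\ Z z, 0 < r, forall q, near_pt z r q -> near_pt z0 1 q &
    forall q, near_pt z r q -> Z q -> F k q].
Proof.
move=> Zz0 clF covF; apply: contrapT => noportion.
pose state := (point * R)%type.
pose ok (st : state) := [/\ Z st.1, 0 < st.2 &
    forall q, near_pt st.1 (2 * st.2) q -> near_pt z0 1 q].
pose step (k : nat) (st st' : state) :=
  (forall q, near_pt st'.1 (2 * st'.2) q -> near_pt st.1 st.2 q) /\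
  (forall q, near_pt st'.1 (2 * st'.2) q -> ~ F k q).
have next (ks : nat * state) : exists st', ok ks.2 -> ok st' /\ step ks.1 ks.2 st'.
  case: ks => k [p r] /=; have [[/= Zp r0 pr]|nok] := pselect (ok (p, r)); last by exists (p, r).
  have [q [pq Zq nFq]] : exists q, [/\ near_pt p r q, Z q & ~ F k q].
    apply: contrapT => H; apply: noportion; exists k, p, r; split => //.
      by move=> q pq; apply: pr; apply: near_pt_le pq; lra.
    by move=> q pq Zq; apply: contrapT => nF; apply: H; exists q.
  have [r1 r10 r1P] := clF k q nFq.
  have [r2 r20 r2P] := near_pt_open pq.
  have m0 : 0 < Num.min r1 r2 by rewrite lt_min r10.
  have st : step k (p, r) (q, Num.min r1 r2 / 2).
    split=> w /=; rewrite mulrC divfK// => qw.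
      by apply: r2P; apply: near_pt_le qw; rewrite ge_min lexx orbT.
    by apply: r1P; apply: near_pt_le qw; rewrite ge_min lexx.
  exists (q, Num.min r1 r2 / 2) => _; split => //; split => //=; first by rewrite divr_gt0.
  move=> w qw; apply: pr; have := st.1 w qw; apply: near_pt_le => /=; lra.
have [f fP] := choice next.
pose g j := iteri j (fun k st => f (k, st)) (z0, 2^-1 : R).
have gok j : ok (g j).
  elim: j => [|j IH]; last by have [] := fP (j, g j) IH.
  by split => //= q; rewrite mulfV.
have gstep j : step j (g j) (g j.+1) by have [] := fP (j, g j) (gok j).
have nested k j : (k <= j)%N -> forall q, near_pt (g j).1 (2 * (g j).2) q ->
    near_pt (g k).1 (2 * (g k).2) q.
  elim: j => [|j IH]; first by rewrite leqn0 => /eqP ->.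
  rewrite leq_eqVlt => /orP[/eqP -> //|kj] q qj; apply: IH => //.
  have [_ gj0 _] := gok j; apply: (@near_pt_le _ _ (g j).2); first lra.
  exact: (gstep j).1.
have [|q qP] := @cluster_sequence z0.1 z0.2 (fun j => (g j).1).
  move=> j; have [_ gj0 gz0] := gok j.
  by have [|a b] := gz0 (g j).1; [apply: near_pt_refl; rewrite mulr_gt0|split; exact: ltW].
have [k Fkq] := covF q.
have [_ gk0 _] := gok k.+1.
(* The steps were built with doubled radii: a late centre is within one radius of the centre of
   stage [k + 1], and [q] within one more. *)
have [j kj qj] := qP k.+2 (g k.+1).2 gk0.
apply: ((gstep k).2 q) => //.
have gj : near_pt (g k.+1).1 (g k.+1).2 (g j).1.
  have [_ gj0 _] := gok j; apply: (gstep k.+1).1.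
  by apply: (nested _ _ kj); apply: near_pt_refl; rewrite mulr_gt0.
have := near_pt_trans gj (near_pt_sym qj); apply: near_pt_le; lra.
Qed.

End baire.

Section joint_continuity.
Context {R : realType} (n : nat) (alpha s c1 c2 : R).
Hypotheses (alpha01 : 0 < alpha < 1) (s01 : 0 < s < 1).
Hypotheses (c1_gt0 : 0 < c1) (c2_gt0 : 0 < c2).
Implicit Types (u : 'rV[R]_n -> R -> R) (x y : 'rV[R]_n) (t tau r e : R).

Let lipschitz_in_time u t0 (k : nat) : set 'rV[R]_n :=
  [set x | forall t tau, `|t - t0| <= 1 -> `|tau - t0| <= 1 ->
    `|u x t - u x tau| <= k%:R * `|t - tau|].

Let lipschitz_in_space u x0 (k : nat) : set R :=
  [set t | forall y z, euclid (y - x0) <= 1 -> euclid (z - x0) <= 1 ->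
    `|u y t - u z t| <= k%:R * euclid (y - z)].

(** A failure at [x] is witnessed by a fixed pair of times, and persists nearby by continuity in
    space at these two times: separate continuity makes the set closed. *)
Let lipschitz_in_time_closed u t0 k x : (forall t, continuous (fun y => u y t)) ->
  ~ lipschitz_in_time u t0 k x ->
  exists2 d : R, 0 < d & forall y, lipschitz_in_time u t0 k y -> d <= euclid (x - y).
Proof.
move=> cu; rewrite /lipschitz_in_time /= => /existsNP[t /existsNP[tau]].
move=> /not_implyP[t1 /not_implyP[tau1 /negP]]; rewrite -ltNge => gap.
pose e := (`|u x t - u x tau| - k%:R * `|t - tau|) / 2.
have e0 : 0 < e by rewrite divr_gt0// subr_gt0.
have [d1 d10 d1P] := (continuous_atP _ _).1 (cu t x) e e0.
have [d2 d20 d2P] := (continuous_atP _ _).1 (cu tau x) e e0.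
exists (Num.min d1 d2) => [|y yP]; first by rewrite lt_min d10.
rewrite leNgt; apply/negP; rewrite lt_min => /andP[y1 y2].
have h1 := d1P y (le_lt_trans (norm_le_euclid _) y1).
have h2 := d2P y (le_lt_trans (norm_le_euclid _) y2).
have h3 := yP t tau t1 tau1.
have : `|u x t - u x tau| <=
    `|u x t - u y t| + `|u y t - u y tau| + `|u x tau - u y tau|.
  rewrite (distrC (u x tau)) -addrA.
  rewrite (_ : u x t - u x tau = (u x t - u y t) + ((u y t - u y tau) + (u y tau - u x tau)));
    last by ring.
  apply: le_trans (ler_normD _ _) _; rewrite lerD2l; exact: ler_normD.
move: h1 h2 h3; rewrite /e; lra.
Qed.

Let lipschitz_in_space_closed u x0 k t : (forall x, continuous (u x)) ->
  ~ lipschitz_in_space u x0 k t ->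
  exists2 d : R, 0 < d & forall tau, lipschitz_in_space u x0 k tau -> d <= `|t - tau|.
Proof.
move=> cu; rewrite /lipschitz_in_space /= => /existsNP[y /existsNP[z]].
move=> /not_implyP[y1 /not_implyP[z1 /negP]]; rewrite -ltNge => gap.
pose e := (`|u y t - u z t| - k%:R * euclid (y - z)) / 2.
have e0 : 0 < e by rewrite divr_gt0// subr_gt0.
have [d1 d10 d1P] := (continuous_atP _ _).1 (cu y t) e e0.
have [d2 d20 d2P] := (continuous_atP _ _).1 (cu z t) e e0.
exists (Num.min d1 d2) => [|tau tauP]; first by rewrite lt_min d10.
rewrite leNgt; apply/negP; rewrite lt_min => /andP[t1 t2].
have h1 := d1P tau t1; have h2 := d2P tau t2; have h3 := tauP y z y1 z1.
have : `|u y t - u z t| <=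
    `|u y t - u y tau| + `|u y tau - u z tau| + `|u z t - u z tau|.
  rewrite (distrC (u z t)) -addrA.
  rewrite (_ : u y t - u z t = (u y t - u y tau) + ((u y tau - u z tau) + (u z tau - u z t)));
    last by ring.
  apply: le_trans (ler_normD _ _) _; rewrite lerD2l; exact: ler_normD.
move: h1 h2 h3; rewrite /e; lra.
Qed.

Lemma solution_jointly_continuous M u : 0 <= M -> solution alpha s c1 c2 M u ->
  (forall x t0, exists k : R, forall t tau, `|t - t0| <= 1 -> `|tau - t0| <= 1 ->
    `|u x t - u x tau| <= k * `|t - tau|) ->
  (forall t x0, exists k : R, forall y z, euclid (y - x0) <= 1 -> euclid (z - x0) <= 1 ->
    `|u y t - u z t| <= k * euclid (y - z)) ->
  forall x t, jointly_continuous_at u x t.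
Proof.
move=> M0 su lip_time lip_space x0 t0.
have [_ cx ct _] := su.
(* The points that are not [good] form the closure of the set of discontinuities. *)
pose good p := exists2 r : R, 0 < r & forall q, near_pt p r q -> jointly_continuous_at u q.1 q.2.
have goodJ p : good p -> jointly_continuous_at u p.1 p.2.
  by move=> [r r0 rP]; apply: rP; exact: near_pt_refl.
apply: (goodJ (x0, t0)); apply: contrapT => bad0.
pose F k := [set p : 'rV[R]_n * R | lipschitz_in_time u t0 k p.1 /\ lipschitz_in_space u x0 k p.2].
have nat_above (a : R) : exists k : nat, a <= k%:R.
  by exists (Num.truncn a).+1; rewrite ltW// truncnS_gt.
have [||k [z [r [badz r0 zsub zF]]]] := @baire_portion R n [set p | ~ good p] F (x0, t0) bad0.
- move=> k p nF.
  have [Xp|nXp] := pselect (lipschitz_in_time u t0 k p.1).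
    have nYp : ~ lipschitz_in_space u x0 k p.2 by move=> Yp; apply: nF.
    have [d d0 dP] := lipschitz_in_space_closed ct nYp.
    by exists d => // q [_ qd] [_ /dP]; rewrite distrC leNgt qd.
  have [d d0 dP] := lipschitz_in_time_closed cx nXp.
  by exists d => // q [qd _] [/dP + _]; rewrite euclidB leNgt qd.
- move=> [x t]; have [a aP] := lip_time x t0; have [b bP] := lip_space t x0.
  have [k ak] := nat_above (Num.max a b); move: ak; rewrite ge_max => /andP[ak bk].
  exists k; split => [t' tau' h1 h2|y z h1 h2] /=.
    by apply: le_trans (aP _ _ h1 h2) _; rewrite ler_wpM2r.
  by apply: le_trans (bP _ _ h1 h2) _; rewrite ler_wpM2r ?euclid_ge0.
apply: badz; exists r => // p zp.
have [|badp] := pselect (good p); first exact: goodJ.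
have [Xp Yp] := zF p zp badp.
have [r1 r10 r1P] := near_pt_open zp.
apply: (cross_continuous alpha01 s01 c1_gt0 c2_gt0 M0 su r10 Xp
  (Y := lipschitz_in_space u x0 k)).
- by move=> x nX; exact: lipschitz_in_time_closed.
- move=> y tau yr nXY; apply: (goodJ (y, tau)); apply: contrapT => bad.
  have [Xy Yt] := zF (y, tau) (r1P (y, tau) yr) bad.
  by case: nXY.
move=> e e0; have K0 : 0 < 2 * k%:R + 1 :> R by rewrite ltr_wpDl// mulr_ge0.
exists (Num.min r1 (e / (2 * k%:R + 1))); first by rewrite lt_min r10 divr_gt0.
move=> y tau [ye te] XY; move: ye te; rewrite !lt_min => /andP[y1 ye] /andP[t1 te].
(* The portion stays within distance 1 of [(x0, t0)], where the Lipschitz bounds defining [F] are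
   valid. *)
have [py pt] := zsub _ (r1P (y, tau) (conj y1 t1)).
have [py' pt'] := zsub _ zp.
rewrite /= in py pt py' pt'.
have kk : 0 <= k%:R :> R by [].
have small : k%:R * `|tau - p.2| + k%:R * euclid (y - p.1) < e.
  rewrite -mulrDr; move: ye te; rewrite !ltr_pdivlMr//.
  set a := euclid _; set b := `|_| => ha hb.
  have a0 : 0 <= a by exact: euclid_ge0.
  have b0 : 0 <= b by exact: normr_ge0.
  have := mulr_ge0 kk a0; have := mulr_ge0 kk b0; lra.
(* Two legs parallel to the axes join [(y, tau)] to [p], through [(y, p.2)] if [X y] and through
   [(p.1, tau)] otherwise; one leg uses the assumption on [y] or [tau], the other that [p] lies in
   [X * Y]. *)
case: XY => [Xy|Yt].
- rewrite (_ : _ - _ = (u y tau - u y p.2) + (u y p.2 - u p.1 p.2)); last by ring.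
  apply: le_lt_trans (ler_normD _ _) _; apply: le_lt_trans small; apply: lerD.
    by apply: Xy; exact: ltW.
  by apply: Yp; exact: ltW.
- rewrite (_ : _ - _ = (u p.1 tau - u p.1 p.2) + (u y tau - u p.1 tau)); last by ring.
  apply: le_lt_trans (ler_normD _ _) _; apply: le_lt_trans small; apply: lerD.
    by apply: Xp; exact: ltW.
  by apply: Yt; exact: ltW.
Qed.

End joint_continuity.

(** * Reduction of the hypotheses *)

Section regularity.
Context {R : realType} {n : nat}.
Implicit Types (x y z : 'rV[R]_n) (v : 'rV[R]_n -> R).

Lemma derive_bound (f df : R -> R) (a b k : R) : a <= b ->
  (forall c : R, is_derive c (1 : R) f (df c)) -> (forall c, a <= c <= b -> `|df c| <= k) ->
  `|f b - f a| <= k * (b - a).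
Proof.
move=> ab fdf dfk.
have cf : {within `[a, b], continuous f}.
  apply: continuous_subspaceT => c; apply: differentiable_continuous.
  by apply/derivable1_diffP; have [] := fdf c.
have [c + ->] := MVT_segment ab (fun c _ => fdf c) cf.
rewrite in_itv/= => /dfk dfc; rewrite normrM (ger0_norm (x := b - a)) ?subr_ge0//.
by rewrite ler_wpM2r// subr_ge0.
Qed.

Lemma C1_continuous (g : R -> R) : C1 g -> continuous g.
Proof.
by move=> [dg _] t; apply: differentiable_continuous; apply/derivable1_diffP; exact: dg.
Qed.

Lemma C1_locally_lipschitz (g : R -> R) t0 : C1 g -> exists2 k : R, 0 <= k &
  forall t tau, `|t - t0| <= 1 -> `|tau - t0| <= 1 -> `|g t - g tau| <= k * `|t - tau|.
Proof.
move=> [dg cdg].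
have le0 : t0 - 1 <= t0 + 1 by lra.
have [|c _ cP] := @EVT_max R (fun t => `|derive1 g t|) _ _ le0.
  by apply: continuous_subspaceT => t; apply: cvg_norm; exact: cdg.
exists `|derive1 g c| => // t tau; rewrite ![_ <= 1]ler_distl => ht htau.
wlog tt : t tau ht htau / tau <= t.
  move=> W; have [|/ltW] := leP tau t; first exact: W.
  by rewrite (distrC (g t)) (distrC t); exact: W.
rewrite (ger0_norm (x := t - tau)) ?subr_ge0//; apply: (@derive_bound _ (derive1 g)) => // b.
  by rewrite derive1E; exact/derivableP.
by move=> hb; apply: cP; rewrite in_itv/=; lra.
Qed.

Lemma is_derive_line v x y (a : R) : (forall z, differentiable v z) ->
  is_derive a (1 : R) (fun b => v (x + b *: y)) ('D_y v (x + a *: y)).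
Proof.
move=> dv; have dy : derivable v (x + a *: y) y by exact/diff_derivable.
have E : (fun h : R => h^-1 *: (((fun b => v (x + b *: y)) \o shift a) (h *: 1) - v (x + a *: y))) =
    (fun h : R => h^-1 *: ((v \o shift (x + a *: y)) (h *: y) - v (x + a *: y))).
  by apply/funext => h /=; rewrite scalerDl addrCA [_ *: 1]mulr1.
by split; rewrite /derivable /derive E.
Qed.

Lemma derive_gradient v x y : differentiable v x ->
  'D_y v x = \sum_i y 0 i * gradient v x 0 i.
Proof.
move=> dv; rewrite deriveE// {1}[y]row_sum_delta linear_sum.
by apply: eq_bigr => i _; rewrite linearZ /= mxE deriveE.
Qed.

End regularity.

Section C11.
Context {R : realType} {n : nat}.
Implicit Types (x y z : 'rV[R]_n) (v : 'rV[R]_n -> R).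

Lemma C11_derive_lipschitz v x0 : C11_loc v -> exists2 L : R, 0 <= L &
  forall z y, euclid (z - x0) <= 1 -> `|'D_y v z| <= L * euclid y /\
    forall z', euclid (z' - x0) <= 1 ->
      `|'D_y v z - 'D_y v z'| <= L * euclid (z - z') * euclid y.
Proof.
move=> [dv /(_ _ (@compact_euclid_ball R n x0 1))] lip.
have [L0 [L00 lipL]] : exists L : R, 0 < L /\ forall z z', euclid (z - x0) <= 1 ->
    euclid (z' - x0) <= 1 -> `|gradient v z - gradient v z'| <= L * `|z - z'|.
  have /pinfty_ex_gt0[L L0 LP] := lip.
  by exists L; split => // z z' zK zK'; exact: (LP (z, z')).
have sum_le (y g : 'rV[R]_n) : `|\sum_i y 0 i * g 0 i| <= n%:R * `|g| * euclid y.
  apply: le_trans (ler_norm_sum _ _ _) _.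
  apply: le_trans (_ : \sum_(i < n) `|g| * euclid y <= _).
    apply: ler_sum => i _; rewrite normrM mulrC ler_pM// ?coord_le_euclid//.
    exact: coord_le_norm.
  by rewrite sumr_const card_ord -mulrA mulr_natl.
have lip1 z z' : euclid (z - x0) <= 1 -> euclid (z' - x0) <= 1 ->
    `|gradient v z - gradient v z'| <= L0 * euclid (z - z').
  move=> zK zK'; apply: le_trans (lipL _ _ zK zK') _.
  by rewrite ler_pM2l// norm_le_euclid.
exists (n%:R * (`|gradient v x0| + L0)); first by rewrite mulr_ge0// addr_ge0// ltW.
move=> z y zK; split=> [|z' zK'].
  rewrite derive_gradient//; apply: le_trans (sum_le _ _) _.
  rewrite ler_wpM2r ?euclid_ge0// ler_wpM2l//.
  rewrite -[gradient v z](subrKC (gradient v x0)) (le_trans (ler_normD _ _))// lerD2l.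
  apply: le_trans (lip1 _ _ zK _) _; first by rewrite subrr euclid0.
  by rewrite ler_piMr// ltW.
rewrite !derive_gradient// -sumrB.
rewrite (eq_bigr (fun i => y 0 i * (gradient v z - gradient v z') 0 i)); last first.
  by move=> i _; rewrite -mulrBr; congr (_ * _); rewrite [RHS]mxE [X in _ = _ + X]mxE.
apply: le_trans (sum_le _ _) _; rewrite ler_wpM2r ?euclid_ge0// -mulrA ler_wpM2l//.
apply: le_trans (lip1 _ _ zK zK') _.
by rewrite ler_wpM2r ?euclid_ge0// lerDr.
Qed.

Lemma C11_locally_lipschitz v x0 : C11_loc v -> exists2 L : R, 0 <= L &
  forall y z, euclid (y - x0) <= 1 -> euclid (z - x0) <= 1 ->
    `|v y - v z| <= L * euclid (y - z).
Proof.
move=> Cv; have [L L0 LP] := C11_derive_lipschitz x0 Cv.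
exists L => // y z y1 z1.
have := @derive_bound _ (fun a : R => v (z + a *: (y - z)))
  (fun a => 'D_(y - z) v (z + a *: (y - z))) 0 1 (L * euclid (y - z)) ler01.
rewrite scale1r scale0r addr0 subrKC subr0 mulr1; apply=> a.
  by apply: is_derive_line; case: Cv.
move=> /andP[a0 a1]; have [|//] := LP (z + a *: (y - z)) (y - z).
rewrite (_ : _ - x0 = a *: (y - x0) + (1 - a) *: (z - x0)); last first.
  by apply/rowP => i; rewrite !mxE; ring.
apply: le_trans (euclid_triangle _ _) _; rewrite !euclidZ !ger0_norm ?subr_ge0//.
have := euclid_ge0 (y - x0); have := euclid_ge0 (z - x0); nra.
Qed.

(** The mean value theorem along [a |-> v (x0 + a y) + v (x0 - a y)]: its derivative compares
    ['D_y v] at two points at distance [2 a |y|], so a Lipschitz gradient gives the quadratic bound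
    without second derivatives. *)
Lemma C11_second_difference v x0 : C11_loc v -> exists2 L : R, 0 <= L &
  forall y, euclid y <= 1 -> `|v (x0 + y) + v (x0 - y) - 2 * v x0| <= L * euclid y ^+ 2.
Proof.
move=> Cv; have [L L0 LP] := C11_derive_lipschitz x0 Cv; have [dv _] := Cv.
exists (2 * L) => [|y y1]; first by rewrite mulr_ge0.
have := @derive_bound _ (fun a : R => v (x0 + a *: y) + v (x0 + a *: (- y)))
  (fun a => 'D_y v (x0 + a *: y) + 'D_(- y) v (x0 + a *: (- y))) 0 1
  (2 * L * euclid y ^+ 2) ler01.
rewrite !scale1r !scale0r addr0 subr0 mulr1 (_ : v x0 + v x0 = 2 * v x0); last by ring.
apply=> a.
  by apply: is_deriveD; exact: is_derive_line.
move=> /andP[a0 a1].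
have ball (y' : 'rV[R]_n) : euclid y' = euclid y -> euclid (x0 + a *: y' - x0) <= 1.
  move=> yy; rewrite addrAC subrr add0r euclidZ yy ger0_norm//.
  by have := euclid_ge0 y; nra.
rewrite [X in _ + X](_ : _ = - 'D_y v (x0 + a *: - y)); last first.
  rewrite !derive_gradient// -sumrN; apply: eq_bigr => i _.
  by rewrite [(- y) _ _]mxE mulNr.
have [|_ /(_ (x0 + a *: - y)) H] := LP (x0 + a *: y) y; first exact: ball.
apply: le_trans (H _) _; first by apply: ball; rewrite euclidN.
rewrite (_ : _ - _ = (2 * a) *: y); last by apply/rowP => i; rewrite !mxE; ring.
rewrite euclidZ ger0_norm ?mulr_ge0// expr2 !mulrA ler_wpM2r ?euclid_ge0//.
rewrite ler_wpM2r ?euclid_ge0//; nra.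
Qed.

End C11.

Section constants.
Context {R : realType}.

Lemma marchaud_const_gt0 (alpha : R) : 0 < alpha < 1 -> 0 < marchaud_const alpha.
Proof.
move=> /andP[a0 a1]; have ga : 0 < 1 - alpha by rewrite subr_gt0.
by rewrite /marchaud_const /Gamma ga divr_gt0// Gamma_integral_gt0.
Qed.

Lemma frac_laplacian_const_gt0 (n : nat) (s : R) : 0 < s < 1 ->
  0 < frac_laplacian_const n s.
Proof.
move=> /andP[s0 s1]; have h0 : 0 < (n%:R + 2 * s) / 2.
  by rewrite divr_gt0// ltr_wpDl// mulr_gt0.
rewrite /frac_laplacian_const {1}/Gamma h0 divr_gt0//.
  by rewrite mulr_gt0 ?powR_gt0// Gamma_integral_gt0.
rewrite mulr_gt0 ?powR_gt0 ?pi_gt0// normr_gt0 /Gamma ltNge oppr_le0 (ltW s0)/=.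
(* Only one factor occurs in the continuation: [Gamma (- s)] is [Gamma_integral (1 - s) / (- s)]. *)
rewrite opprK (_ : Num.truncn s = 0%N); last first.
  by apply/eqP; rewrite truncn_eq ?(ltW s0)// ltW.
rewrite big_ord1 addr0 mulf_neq0 ?invr_eq0 ?oppr_eq0 ?(gt_eqF s0)//.
by rewrite gt_eqF// Gamma_integral_gt0// addrC subr_gt0.
Qed.

End constants.

(** * From the two fractional operators to integrals of differences *)

Section reduction.
Context {R : realType} (n : nat) (alpha s : R).
Hypotheses (alpha01 : 0 < alpha < 1) (s01 : 0 < s < 1).
Implicit Types (x y : 'rV[R]_n) (u : 'rV[R]_n -> R -> R).
Local Notation T := (measurableTypeR R).
Local Notation mu := (@lebesgue_measure R).
Local Notation nu := (lebesgue_tuple R n).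
Local Notation rv := (@rv_of_tuple R n).
Local Notation time_kernel r := ((r `^ (1 + alpha))^-1).
Local Notation space_kernel y := ((euclid y `^ (n%:R + 2 * s))^-1).

Lemma marchaudE u x t : continuous (u x) -> marchaud alpha u x t =
  marchaud_const alpha * \int[mu]_(r in (`]0%R, +oo[%classic : set T))
    (past_diff u x t r * time_kernel r).
Proof.
move=> cu; rewrite /marchaud /Rintegral; congr (_ * fine _).
rewrite -(@integral_measure_preserving _ _ _ mu (affine true t)).
- rewrite (_ : affine true t @^-1` `]-oo, t[%classic = `]0%R, +oo[%classic).
    by apply: eq_integral => r _; rewrite /past_diff /affine subKr.
  apply/seteqP; split => r /=; rewrite !in_itv/= andbT gtrBl//.
- exact: measure_preserving_affine.
- exact: measurable_itv.
apply/measurable_EFinP; apply: measurable_funTS; apply: measurable_funM.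
  by apply: measurable_funB => //; exact: continuous_measurable_fun.
apply: (@measurableT_comp _ _ _ _ _ _ (fun r : T => time_kernel r)).
  exact: measurable_time_kernel.
exact: measurable_funB.
Qed.

Lemma integrable_past_diff u x t (M k : R) : (forall t, `|u x t| <= M) -> continuous (u x) ->
  0 <= k -> (forall tau, `|tau - t| <= 1 -> `|u x t - u x tau| <= k * `|t - tau|) ->
  mu.-integrable `]0, +oo[%classic (fun r => (past_diff u x t r * time_kernel r)%:E).
Proof.
move=> uM cu k0 lip; have M0 : 0 <= M by exact: le_trans (uM t).
have [C C0 CP] := time_cost alpha01.
have A0 : 0 <= k + 2 * M by rewrite addr_ge0// mulr_ge0.
apply: (@le_integrable _ T R mu _ _ _
  (fun r : T => ((k + 2 * M) * tdamp alpha 1 r * time_kernel r)%:E)).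
- exact: measurable_itv.
- apply/measurable_EFinP/measurable_funM; last exact: measurable_time_kernel.
  exact: measurable_past_diff.
- move=> r; rewrite /= in_itv/= andbT => r0; rewrite !lee_fin !normrM.
  rewrite ler_wpM2r// (ger0_norm A0) (ger0_norm (tdamp_ge0 _ ltr01 (ltW r0)))//.
  rewrite /tdamp /rt powR1 divr1 /past_diff; have [r1|r1] := leP r 1.
    have := lip (t - r); rewrite distrC subKr (gtr0_norm r0) => /(_ r1) /le_trans; apply.
    by rewrite ler_wpM2r ?(ltW r0)// lerDl mulr_ge0.
  rewrite mulr1; apply: le_trans (ler_normB _ _) _.
  by have := uM t; have := uM (t - r); lra.
apply/integrableP; split.
  apply/measurable_EFinP/measurable_funM; last exact: measurable_time_kernel.
  by apply: measurable_funM => //; exact: measurable_tdamp.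
under eq_integral => r.
  rewrite inE/= in_itv/= andbT => r0; rewrite ger0_norm; last first.
    by rewrite !mulr_ge0 ?tdamp_ge0 ?invr_ge0 ?powR_ge0 ?(ltW r0).
  over.
by apply: le_lt_trans (CP _ 1 A0 ltr01) _; rewrite ltry.
Qed.

Lemma sym_diff_le u x t (M L : R) y : (forall x, `|u x t| <= M) -> 0 <= L ->
  (forall y, euclid y <= 1 -> `|u (x + y) t + u (x - y) t - 2 * u x t| <= L * euclid y ^+ 2) ->
  `|sym_diff u x t y| <= (L + 4 * M) * sdamp s 1 y.
Proof.
move=> uM L0 second; have M0 : 0 <= M by exact: le_trans (uM x).
rewrite /sym_diff /sdamp /rs powR1 divr1.
rewrite (_ : _ - _ = - (u (x + y) t + u (x - y) t - 2 * u x t)) ?normrN; last by ring.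
have := euclid_ge0 y; have [y1 y0|y1 y0] := leP (euclid y) 1.
  rewrite min_l ?expr_le1//; apply: le_trans (second y y1) _.
  by rewrite ler_wpM2r ?sqr_ge0// lerDl mulr_ge0.
rewrite min_r; last by rewrite expr_ge1// ltW.
rewrite mulr1; have := uM (x + y); have := uM (x - y); have := uM x.
by rewrite !ler_norml => /andP[? ?] /andP[? ?] /andP[? ?]; apply/andP; split; lra.
Qed.

Lemma integrable_sym_diff u x t (M L : R) : (forall x, `|u x t| <= M) ->
  continuous (fun y => u y t) -> 0 <= L ->
  (forall y, euclid y <= 1 -> `|u (x + y) t + u (x - y) t - 2 * u x t| <= L * euclid y ^+ 2) ->
  nu.-integrable [set: n.-tuple T] (fun z => (sym_diff u x t (rv z) * space_kernel (rv z))%:E).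
Proof.
move=> uM cu L0 second; have M0 : 0 <= M by exact: le_trans (uM x).
have [C C0 CP] := space_cost n s01.
have A0 : 0 <= L + 4 * M by rewrite addr_ge0// mulr_ge0.
apply: (@le_integrable _ _ R nu _ _ _
  (fun z => ((L + 4 * M) * sdamp s 1 (rv z) * space_kernel (rv z))%:E)).
- exact: measurableT.
- apply/measurable_EFinP/measurable_funM; last exact: measurable_space_kernel.
  exact: measurable_sym_diff.
- move=> z _; rewrite /= !lee_fin !normrM.
  rewrite ler_wpM2r// (ger0_norm A0) (ger0_norm (sdamp_ge0 _ _ _))//.
  exact: sym_diff_le.
apply/integrableP; split.
  apply/measurable_EFinP/measurable_funM; last exact: measurable_space_kernel.
  by apply: measurable_funM => //; exact: measurable_sdamp.
under eq_integral => r _.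
  rewrite /= ger0_norm; last first.
    by rewrite !mulr_ge0 ?sdamp_ge0 ?invr_ge0 ?powR_ge0.
  over.
by apply: le_lt_trans (CP _ 1 A0 ltr01) _; rewrite ltry.
Qed.

Let far (eps : R) : set (n.-tuple T) := [set z | eps <= euclid (rv z)].

Let measurable_far eps : measurable (far eps).
Proof.
rewrite (_ : far eps = (fun z => euclid (rv z)) @^-1` `[eps, +oo[%classic).
  by rewrite -[X in measurable X]setTI; exact: measurable_euclid.
by apply/seteqP; split => y /=; rewrite in_itv/= andbT.
Qed.

Let integrable_damped_kernel l : 0 < l ->
  nu.-integrable [set: n.-tuple T] (fun z => (sdamp s l (rv z) * space_kernel (rv z))%:E).
Proof.
move=> l0; have [C C0 /(_ 1 _ ler01 l0) CP] := space_cost n s01.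
apply/integrableP; split.
  apply/measurable_EFinP/measurable_funM; last exact: measurable_space_kernel.
  exact: measurable_sdamp.
under eq_integral => r _.
  rewrite /= ger0_norm; last first.
    by rewrite !mulr_ge0 ?sdamp_ge0 ?invr_ge0 ?powR_ge0.
  rewrite -[_ * _]mul1r mulrA.
  over.
by apply: le_lt_trans CP _; rewrite ltry.
Qed.

(** Both [y = x + z] and [y = x - z] give the same truncated integral; their sum produces the second
    difference. *)
Let truncated_shift (b : bool) u x t eps : continuous (fun y => u y t) ->
  frac_laplacian_truncated s u x t eps =
  \int[nu]_(z in far eps) ((u x t - u (if b then x - rv z else x + rv z) t) * space_kernel (rv z)).
Proof.
move=> cu; rewrite /frac_laplacian_truncated /Rintegral; apply: (congr1 fine).
rewrite -(@integral_measure_preserving _ _ _ nu (tuple_affine b x)).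
- rewrite (_ : tuple_affine b x @^-1` _ = far eps); last first.
    by apply/seteqP; split => z; rewrite /= /far /= tuple_affineE;
      case: b; rewrite ?subKr// opprD addrA subrr sub0r euclidN.
  apply: eq_integral => z _; rewrite tuple_affineE; case: b; rewrite ?subKr//.
  by rewrite opprD addrA subrr sub0r euclidN.
- exact: measure_preserving_tuple_affine.
- rewrite (_ : [set y | _] = tuple_affine true x @^-1` far eps); last first.
    by apply/seteqP; split => z; rewrite /= /far /= tuple_affineE.
  by rewrite -[X in measurable X]setTI; apply: measurable_tuple_affine => //; exact: measurable_far.
apply/measurable_EFinP; apply: measurable_funTS; apply: measurable_funM.
  by apply: measurable_funB => //; exact: (continuous_rv_of_tuple_measurable cu).
rewrite (_ : (fun z => _) = (fun z => space_kernel (rv z)) \o tuple_affine true x).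
  apply: measurableT_comp; first exact: measurable_space_kernel.
  exact: measurable_tuple_affine.
by apply/funext => z /=; rewrite tuple_affineE.
Qed.

Let integrable_far (b : bool) u x t (M eps : R) : 0 < eps -> (forall x, `|u x t| <= M) ->
  continuous (fun y => u y t) -> nu.-integrable (far eps)
  (fun z => ((u x t - u (if b then x - rv z else x + rv z) t) * space_kernel (rv z))%:E).
Proof.
move=> eps0 uM cu; have M0 : 0 <= M by exact: le_trans (uM x).
have l0 : 0 < eps `^ (2 * s) by exact: powR_gt0.
apply: (@le_integrable _ _ R nu _ _ _
  (fun z => (2 * M * (sdamp s (eps `^ (2 * s)) (rv z) * space_kernel (rv z)))%:E)) => //.
- apply/measurable_EFinP; apply: measurable_funTS.
  apply: measurable_funM; last exact: measurable_space_kernel.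
  apply: measurable_funB => //.
  rewrite (_ : (fun z => _) =
    ((fun y => u y t) \o @rv_of_tuple R n) \o tuple_affine b x); last first.
    by apply/funext => z /=; rewrite tuple_affineE.
  apply: measurableT_comp; last exact: measurable_tuple_affine.
  exact: continuous_rv_of_tuple_measurable.
- move=> z /= ez; rewrite lee_fin mulrA 2!normrM ler_wpM2r//.
  (* For the order [eps^(2s)] the damping equals 1 on the far set, so the damped kernel, integrable
     on the whole space, dominates there. *)
  rewrite /sdamp (powR_rsK s01 (ltW eps0)) min_r; last first.
    by rewrite expr_ge1 ?divr_ge0 ?euclid_ge0 ?(ltW eps0)// ler_pdivlMr// mul1r.
  rewrite mulr1 (ger0_norm (x := 2 * M)) ?mulr_ge0//.
  apply: le_trans (ler_normB _ _) _.
  by have := uM x; have := uM (if b then x - rv z else x + rv z); lra.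
under [X in _.-integrable _ X]eq_fun do rewrite EFinM.
apply: integrableZl => //; apply: (@integrableS _ _ _ _ setT) => //.
exact: integrable_damped_kernel.
Qed.

Let truncated_sym u x t (M eps : R) : 0 < eps -> (forall x, `|u x t| <= M) ->
  continuous (fun y => u y t) -> 2 * frac_laplacian_truncated s u x t eps =
  \int[nu]_(z in far eps) (sym_diff u x t (rv z) * space_kernel (rv z)).
Proof.
move=> eps0 uM cu; rewrite mulrDl mul1r.
rewrite {1}(truncated_shift false x eps cu) (truncated_shift true x eps cu).
rewrite -RintegralD//; last 2 first.
- exact: (integrable_far false x eps0 uM cu).
- exact: (integrable_far true x eps0 uM cu).
by apply: eq_Rintegral => z _ /=; rewrite /sym_diff; ring.
Qed.

(** On the ball of radius [eps] the profile of order [eps^(2s)] is [(|z| / eps)^2], so [L |z|^2] is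
    [L eps^2] times it. *)
Let near_part u x t (M L eps : R) : 0 < eps <= 1 -> (forall x, `|u x t| <= M) ->
  continuous (fun y => u y t) -> 0 <= L ->
  (forall y, euclid y <= 1 -> `|u (x + y) t + u (x - y) t - 2 * u x t| <= L * euclid y ^+ 2) ->
  `|\int[nu]_(z in ~` far eps) (sym_diff u x t (rv z) * space_kernel (rv z))| <=
  L * eps ^+ 2 * \int[nu]_z (sdamp s (eps `^ (2 * s)) (rv z) * space_kernel (rv z)).
Proof.
move=> /andP[eps0 eps1] uM cu L0 second; have l0 : 0 < eps `^ (2 * s) by exact: powR_gt0.
have ik := integrable_damped_kernel l0.
have mfarC : measurable (~` far eps) by exact: measurableC.
have isym := integrable_sym_diff uM cu L0 second.
have isymC : nu.-integrable (~` far eps)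
    (fun z => (sym_diff u x t (rv z) * space_kernel (rv z))%:E).
  exact: (@integrableS _ _ _ _ setT).
apply: le_trans (le_normr_Rintegral _ isymC) _ => //.
rewrite -RintegralZl//.
apply: le_trans (_ : \int[nu]_(z in ~` far eps)
    (L * eps ^+ 2 * (sdamp s (eps `^ (2 * s)) (rv z) * space_kernel (rv z))) <= _).
  apply: le_Rintegral => //.
  - exact: integrable_norm.
  - under [X in _.-integrable _ X]eq_fun do rewrite /= EFinM.
    by apply: integrableZl => //; exact: (@integrableS _ _ _ _ setT).
  move=> z /= /negP; rewrite -ltNge => ze.
  have k0 : 0 <= space_kernel (rv z) by rewrite invr_ge0 powR_ge0.
  rewrite normrM mulrA (ger0_norm k0) ler_wpM2r//.
  have z1 : euclid (rv z) <= 1 by exact: le_trans (ltW ze) eps1.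
  rewrite /sym_diff (_ : _ - _ = - (u (x + rv z) t + u (x - rv z) t - 2 * u x t)) ?normrN;
    last by ring.
  apply: le_trans (second _ z1) _; rewrite /sdamp (powR_rsK s01 (ltW eps0)) min_l.
    by rewrite exprMn exprVn -mulrA [eps ^+ 2 * _]mulrC divfK// expf_neq0// gt_eqF.
  rewrite expr_le1 ?divr_ge0 ?euclid_ge0 ?(ltW eps0)//.
  by rewrite ler_pdivrMr// mul1r ltW.
apply: fine_le.
- apply: integrable_fin_num => //.
  under [X in _.-integrable _ X]eq_fun do rewrite /= EFinM.
  by apply: integrableZl => //; exact: (@integrableS _ _ _ _ setT).
- apply: integrable_fin_num => //.
  under [X in _.-integrable _ X]eq_fun do rewrite /= EFinM.
  exact: integrableZl.
apply: ge0_subset_integral => //.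
  apply/measurable_EFinP; apply: measurable_funM => //; apply: measurable_funM.
    exact: measurable_sdamp.
  exact: measurable_space_kernel.
by move=> z _; rewrite lee_fin !mulr_ge0 ?(ltW eps0) ?sdamp_ge0 ?invr_ge0 ?powR_ge0.
Qed.

(** The removed ball contributes [O(eps^2 * eps^(-2s))], which tends to 0 as [s < 1]; this proves
    that the limit in the principal value exists and identifies it. *)
Lemma frac_laplacianE u x t (M L : R) : (forall x, `|u x t| <= M) ->
  continuous (fun y => u y t) -> 0 <= L ->
  (forall y, euclid y <= 1 -> `|u (x + y) t + u (x - y) t - 2 * u x t| <= L * euclid y ^+ 2) ->
  frac_laplacian s u x t = frac_laplacian_const n s / 2 *
    \int[nu]_z (sym_diff u x t (rv z) * space_kernel (rv z)).
Proof.
move=> uM cu L0 second; rewrite /frac_laplacian -mulrA; congr (_ * _).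
have [C C0 CP] := space_cost n s01.
have isym := integrable_sym_diff uM cu L0 second.
set I := \int[nu]_z _.
have bound (eps : R) : 0 < eps <= 1 ->
    `|frac_laplacian_truncated s u x t eps - 2^-1 * I| <= L * C / 2 * eps `^ (2 - 2 * s).
  move=> eps01; have [eps0 eps1] := andP eps01.
  have l0 : 0 < eps `^ (2 * s) by exact: powR_gt0.
  have mfarC : measurable (~` far eps) by exact: measurableC.
  have -> : frac_laplacian_truncated s u x t eps =
      2^-1 * \int[nu]_(z in far eps) (sym_diff u x t (rv z) * space_kernel (rv z)).
    by rewrite -(truncated_sym x eps0 uM cu) mulKf.
  have -> : I = \int[nu]_(z in far eps) (sym_diff u x t (rv z) * space_kernel (rv z)) +
      \int[nu]_(z in ~` far eps) (sym_diff u x t (rv z) * space_kernel (rv z)).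
    by rewrite -Rintegral_setU ?setUv//; apply/disj_setPS => z [].
  rewrite -mulrBr opprD addrA subrr sub0r normrM normrN ger0_norm//.
  rewrite (_ : L * C / 2 * _ = 2^-1 * (L * (C * eps `^ (2 - 2 * s)))); last by ring.
  rewrite ler_wpM2l//; apply: le_trans (near_part eps01 uM cu L0 second) _.
  rewrite -mulrA ler_wpM2l//.
  have dK : \int[nu]_z (sdamp s (eps `^ (2 * s)) (rv z) * space_kernel (rv z)) <=
      C / eps `^ (2 * s).
    rewrite -lee_fin fineK; last first.
      by apply: integrable_fin_num => //; exact: integrable_damped_kernel.
    have := CP 1 _ ler01 l0; rewrite mul1r; apply: le_trans.
    rewrite le_eqVlt; apply/orP; left; apply/eqP; apply: eq_integral => z _.
    by rewrite mul1r.
  apply: le_trans (_ : eps ^+ 2 * (C / eps `^ (2 * s)) <= _); first by rewrite ler_wpM2l ?sqr_ge0.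
  rewrite mulrCA ler_wpM2l// -powR_mulrn ?(ltW eps0)// -powRN -powRD//.
  by rewrite (gt_eqF eps0) implybT.
have s22 : 0 < 2 - 2 * s by case/andP : s01 => ? ?; lra.
have lim0 : L * C / 2 * eps `^ (2 - 2 * s) @[eps --> 0^'+] --> 0.
  by rewrite -[X in _ --> X](mulr0 (L * C / 2)); apply: cvgM; [exact: cvg_cst|exact: powR_cvg0].
apply: cvg_lim => //; apply/subr_cvg0.
apply: (squeeze_cvgr _ (f := fun eps => - (L * C / 2 * eps `^ (2 - 2 * s))) _ lim0).
  near=> eps; rewrite -ler_norml; apply: bound; apply/andP; split.
    by near: eps; exact: nbhs_right_gt.
  by near: eps; exact: nbhs_right_le.
by rewrite -[X in _ --> X]oppr0; exact: cvgN lim0.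
Unshelve. all: by end_near.
Qed.

End reduction.

Theorem theorem1p5 (R : realType) (n : nat) (alpha s : R)
    (u : 'rV[R]_n -> R -> R) :
  (0 < n)%N ->
  0 < alpha < 1 ->
  0 < s < 1 ->
  (forall t, C11_loc (fun x => u x t)) ->
  (forall x, C1 (u x)) ->
  (exists M : R, forall x t, `|u x t| <= M) ->
  (forall x t, marchaud alpha u x t + frac_laplacian s u x t = 0) ->
  exists c : R, forall x t, u x t = c.
Proof.
move=> _ alpha01 s01 uC11 uC1 [M uM] eqn; exists (u 0 0).
have M0 : 0 <= M by exact: le_trans (uM 0 0).
have cx t : continuous (fun x => u x t).
  by move=> x; apply: differentiable_continuous; have [] := uC11 t.
have ct x : continuous (u x) by exact: C1_continuous.
have c1 := marchaud_const_gt0 alpha01.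
(* Symmetrisation counts [z] and [-z], hence the half. *)
have c2 : 0 < frac_laplacian_const n s / 2 by rewrite divr_gt0// frac_laplacian_const_gt0.
have su : solution alpha s (marchaud_const alpha) (frac_laplacian_const n s / 2) M u.
  split=> // x t.
  have [k k0 lip] := C1_locally_lipschitz t (uC1 x).
  have [L L0 second] := C11_second_difference x (uC11 t).
  have uMt y : `|u y t| <= M by exact: uM.
  split.
  - apply: (integrable_past_diff alpha01 (uM x) (ct x) k0) => tau htau.
    by apply: lip => //; rewrite subrr normr0.
  - exact: integrable_sym_diff uMt (cx t) L0 second.
  - rewrite -(marchaudE alpha t (ct x)).
    by rewrite -(frac_laplacianE s01 uMt (cx t) L0 second).
apply: (continuous_solution_constant alpha01 s01 c1 c2 M0 su).
apply: (solution_jointly_continuous alpha01 s01 c1 c2 M0 su).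
- by move=> x t0; have [k _ lip] := C1_locally_lipschitz t0 (uC1 x); exists k.
- by move=> t x0; have [k _ lip] := C11_locally_lipschitz x0 (uC11 t); exists k.
Qed.
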